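(* For every fixed integer $d\ge3$, given a unit disk graph $G$ on $n$ vertices (with its geometric representation) and an integer $k$, one can solve $d$-Cycle Packing on $(G,k)$, i.e., decide whether $G$ contains $k$ pairwise vertex-disjoint cycles each of length exactly $d$ (and find them), in time $2^{O_d(\sqrt{k})}n^{O_d(1)}$.
   Context: A unit disk graph on a point set $V\subset\mathbb{R}^2$ has an edge between two points iff their Euclidean distance is at most one; the geometric representation is the point set. A $d$-cycle is a cycle with exactly $d$ vertices. $O_d$ hides constants depending on $d$. *)

(* Defs.v *)
From mathcomp Require Import all_boot all_order all_algebra.
From mathcomp Require Import reals exp.

Set Implicit Arguments.
Unset Strict Implicit.
Unset Printing Implicit Defensive.

Import Order.TTheory GRing.Theory Num.Theory.
Local Open Scope ring_scope.

Definition euclid_dist (R : realType) (p q : R * R) : R :=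
  Num.sqrt ((p.1 - q.1) ^+ 2 + (p.2 - q.2) ^+ 2).

(* The vertices are indices into the point set: the algorithm receives and
   returns indices. [i != j] rules out loops. *)
Definition unit_disk_graph (R : realType) (n : nat) (V : 'I_n -> R * R) :
  rel 'I_n := fun i j => (i != j) && (euclid_dist (V i) (V j) <= 1).

(* Subgraph cycles, not necessarily induced. For [d <= 2], [cycle] would accept
   single vertices (if loops exist) and single edges, so [2 < d] is needed. *)
Definition is_dcycle (T : finType) (e : rel T) (d : nat) (c : seq T) : bool :=
  [&& size c == d, uniq c & cycle e c].

Definition is_dcycle_packing (T : finType) (e : rel T) (d k : nat)
    (P : seq (seq T)) : bool :=
  [&& size P == k, all (is_dcycle e d) P
    & pairwise (fun c c' : seq T => [disjoint c & c']) P].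

(* Model of computation: a real RAM, presented as a structured imperative
   language whose syntax is independent of the real field, so that a program is
   a finite object containing no real constants. The memory consists of cells
   for natural numbers ("words") and cells for exact real numbers, both with
   indirect addressing; cell [i] of array [a] is addressed by the constant [a]
   and the computed index [i].

   Every operation has unit cost. Two omissions keep this honest: words have no
   multiplication, so after [t] steps their bit length is at most the input bit
   length plus O(t), and unit cost is polynomially related to bit cost on words;
   and a real can influence words only through comparisons (no rounding). *)

Inductive wexp : Type :=
| WConst of nat
| WGet of nat & wexp
| WAdd of wexp & wexp
| WSub of wexp & wexp
| WHalf of wexp.

Inductive rexp : Type :=
| RWord of wexp
| RGet of nat & wexp
| RAdd of rexp & rexp
| RSub of rexp & rexp
| RMul of rexp & rexp
| RDiv of rexp & rexp.

Inductive bexp : Type :=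
| WLe of wexp & wexp
| RLe of rexp & rexp
| BNot of bexp
| BAnd of bexp & bexp.

Inductive com : Type :=
| Skip
| WSet of nat & wexp & wexp
| RSet of nat & wexp & rexp
| Seq of com & com
| If of bexp & com & com
| While of bexp & com.

Record state (R : realType) : Type := State {
  wmem : nat -> nat -> nat;
  rmem : nat -> nat -> R }.

Definition upd (A : Type) (m : nat -> nat -> A) (a i : nat) (v : A) :
  nat -> nat -> A :=
  fun a' i' => if (a' == a) && (i' == i) then v else m a' i'.

Fixpoint weval (R : realType) (s : state R) (x : wexp) : nat :=
  match x with
  | WConst m => m
  | WGet a i => wmem s a (weval s i)
  | WAdd x1 x2 => (weval s x1 + weval s x2)%N
  | WSub x1 x2 => (weval s x1 - weval s x2)%N
  | WHalf x1 => (weval s x1)./2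
  end.

(* Division by zero returns zero, which a program can also obtain by testing
   the divisor first. *)
Fixpoint reval (R : realType) (s : state R) (x : rexp) : R :=
  match x with
  | RWord w => (weval s w)%:R
  | RGet a i => rmem s a (weval s i)
  | RAdd x1 x2 => reval s x1 + reval s x2
  | RSub x1 x2 => reval s x1 - reval s x2
  | RMul x1 x2 => reval s x1 * reval s x2
  | RDiv x1 x2 => reval s x1 / reval s x2
  end.

Fixpoint beval (R : realType) (s : state R) (b : bexp) : bool :=
  match b with
  | WLe x1 x2 => (weval s x1 <= weval s x2)%N
  | RLe x1 x2 => reval s x1 <= reval s x2
  | BNot b1 => ~~ beval s b1
  | BAnd b1 b2 => beval s b1 && beval s b2
  end.

Fixpoint wcost (x : wexp) : nat :=
  match x with
  | WConst _ => 1
  | WGet _ x1 | WHalf x1 => (wcost x1).+1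
  | WAdd x1 x2 | WSub x1 x2 => (wcost x1 + wcost x2).+1
  end.

Fixpoint rcost (x : rexp) : nat :=
  match x with
  | RWord w | RGet _ w => (wcost w).+1
  | RAdd x1 x2 | RSub x1 x2 | RMul x1 x2 | RDiv x1 x2 =>
      (rcost x1 + rcost x2).+1
  end.

Fixpoint bcost (b : bexp) : nat :=
  match b with
  | WLe x1 x2 => (wcost x1 + wcost x2).+1
  | RLe x1 x2 => (rcost x1 + rcost x2).+1
  | BNot b1 => (bcost b1).+1
  | BAnd b1 b2 => (bcost b1 + bcost b2).+1
  end.

(* [exec p s t s']: started in [s], [p] halts in [s'] after [t] steps. *)
Inductive exec (R : realType) :
  com -> state R -> nat -> state R -> Prop :=
| exec_skip s : exec Skip s 1 s
| exec_wset s a i x :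
    exec (WSet a i x) s (wcost i + wcost x).+1
      (State (upd (wmem s) a (weval s i) (weval s x)) (rmem s))
| exec_rset s a i x :
    exec (RSet a i x) s (wcost i + rcost x).+1
      (State (wmem s) (upd (rmem s) a (weval s i) (reval s x)))
| exec_seq p q s s1 s2 t1 t2 :
    exec p s t1 s1 -> exec q s1 t2 s2 ->
    exec (Seq p q) s (t1 + t2) s2
| exec_if b p q s s1 t :
    exec (if beval s b then p else q) s t s1 ->
    exec (If b p q) s (bcost b + t) s1
| exec_while_false b p s :
    ~~ beval s b -> exec (While b p) s (bcost b) s
| exec_while_true b p s s1 s2 t1 t2 :
    beval s b -> exec p s t1 s1 -> exec (While b p) s1 t2 s2 ->
    exec (While b p) s (bcost b + t1 + t2) s2.

(* Input: [n] and [k] in cell 0 of word arrays 0 and 1; the coordinates of point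
   [i] in cell [i] of real arrays 0 and 1; all other cells are zero. *)
Definition input (R : realType) (n k : nat) (V : 'I_n -> R * R) : state R :=
  let coord i := if insub i is Some v then V v else (0, 0) in
  State
    (fun a i => match a, i with
                | 0%N, 0%N => n
                | 1%N, 0%N => k
                | _, _ => 0%N
                end)
    (fun a i => match a with
                | 0%N => (coord i).1
                | 1%N => (coord i).2
                | _ => 0
                end).

(* Output: the answer bit in cell 0 of word array 0 and, for a positive answer,
   the [i]-th vertex of the [j]-th cycle in cell [j * d + i] of word array 1. *)
Definition output_answer (R : realType) (s : state R) : nat := wmem s 0 0.

Definition output_cycles (R : realType) (d k : nat) (s : state R) :
  seq (seq nat) := mkseq (fun j => mkseq (fun i => wmem s 1 (j * d + i)) d) k.

Definition correct_output (R : realType) (n : nat) (e : rel 'I_n) (d k : nat)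
    (s : state R) : Prop :=
  (output_answer s = 1%N /\
     exists P : seq (seq 'I_n), is_dcycle_packing e d k P /\
       output_cycles d k s = map (map val) P) \/
  (output_answer s = 0%N /\
     ~ exists P : seq (seq 'I_n), is_dcycle_packing e d k P).

(* The time bound 2^(O(sqrt k)) n^(O(1)), all hidden constants being bounded by
   [c]; [maxn n 1] only matters for the empty graph. *)
Definition time_bound (R : realType) (c n k : nat) : R :=
  c%:R * 2 `^ (c%:R * Num.sqrt k%:R) * (maxn n 1)%:R ^+ c.

(* Main.v *)
(** Assign to each point an integer row and column such that points in the same cell are adjacent
    and adjacent points are at most two rows and two columns apart. Call the sequence of the cells
    of a [d]-cycle its pattern. If a packing contains [d] cycles with the same pattern, their
    vertices can be regrouped into [d] cycles inside single cells; hence some optimal packing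
    consists of cycles inside cells and of fewer than [d] other cycles for each pattern. Therefore,
    by exchange, O_d(1) representative cycles for each pattern suffice.

    If a greedy packing has fewer than [k] cycles, its vertices hit all cycles, so only O_d(k)
    cycles matter. They are treated in the following order: first those that start in a sparse
    periodic set of rows of period L, chosen by averaging so that there are at most O_d(k) / L of
    them, then the others strip after strip, column by column. A dynamic programme over this order
    has to know only which vertices are used in the cells that contain vertices of both treated and
    untreated cycles. For L of order sqrt(k), these vertices number O_d(sqrt(k)), which bounds the
    number of states by 2 ^ O_d(sqrt(k)) n. The cycles themselves are found by self-reduction.

    The functions that some program computes in time polynomial in a given bound are closed under
    arithmetic, bounded loops, searches and folds over lists; the algorithm is composed from these
    closure properties. *)

Require Import Defs.
From mathcomp Require Import all_boot all_order all_algebra.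
From mathcomp Require Import reals exp.
From Stdlib Require PeanoNat.
From mathcomp Require Import zify ring lra.

Set Implicit Arguments.
Unset Strict Implicit.
Unset Printing Implicit Defensive.

(** * Functions computable in time polynomial in a growth function *)

(** The machine model shapes the formalization. Words have no multiplication and reals cannot be
    rounded: products are repeated additions, cells come from chains of points, and sets and lists
    are single words taken apart by halving and doubling. Such words may be very long; only the
    lengths of loops have to be bounded, and a loop body must be computable only at states that
    occur. The one loop length that is not polynomial in $n$ for fixed $d$ is the size of a table of
    the dynamic programme.

    The program never computes $\sqrt k$: it tries all periods and shifts up to about $n^d$ and
    keeps a pair of smallest width. Only the analysis balances the $O_d(k)/L$ cycles of the periodic
    rows against the $O_d(L)$ cycles near the current column of a strip.

    The lengths $2d$ and $4d$ arise because an edge spans at most two rows and columns: a cycle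
    stays within $2d$ of its start, and two cycles with a common cell start within $4d$ of each
    other. *)

(** The bound [grow n k] limits both the lengths of loops and, up to a polynomial, the running time. *)
Record growth := Growth {
  grow :> nat -> nat -> nat; grow_gt0 : forall n k, 0 < grow n k;
  grow_size : forall n k, n <= grow n k }.

Section Computability.

Variable R : realType.

Record instance := Instance {
  size_of : nat; param_of : nat; coord_of : nat -> nat -> R }.

Variable B : growth.

(** The values in scope, newest first in [env]. At depth [l], variable [x] lives in cell 0 of word array
    [l - x + 3]; arrays 2 and 3 hold [n] and [k]. *)
Record ctx (T : Type) := Ctx {
  dom : T -> Prop; ins : T -> instance; env : T -> seq nat; depth : nat }.

Definition bound T (c : ctx T) t := B (size_of (ins c t)) (param_of (ins c t)).

Definition Bounded T (c : ctx T) (f : T -> nat) :=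
  exists K D, forall t, dom c t -> f t <= K * bound c t ^ D.

(** The composed programs never write to the real memory, so it must equal the input exactly; of the
    word memory only the cells of [n], [k] and the variables are constrained. *)
Record encodes T (c : ctx T) t (s : state R) : Prop := Encodes {
  encodes_size : size (env c t) = depth c;
  encodes_rmem : rmem s = coord_of (ins c t);
  encodes_n : wmem s 2 0 = size_of (ins c t);
  encodes_k : wmem s 3 0 = param_of (ins c t);
  encodes_env : forall x, x < depth c -> wmem s (depth c - x + 3) 0 = nth 0 (env c t) x }.

(** The result is left where a new variable would be stored, so that it becomes the newest variable. *)
Record outcome (l M : nat) (s s' : state R) (v : nat) : Prop := Outcome {
  out_rmem : rmem s' = rmem s;
  out_frame : forall a i, ~~ ((i == 0) && (l + 4 <= a < M)) -> wmem s' a i = wmem s a i;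
  out_val : wmem s' (l + 4) 0 = v }.

(** Word arrays from [M] on stay untouched by [e]: a larger program stores there what has to survive
    a run of [e]. Cost and behaviour are prescribed only on [dom c]. *)
Definition Computable T (c : ctx T) (f : T -> nat) :=
  exists (e : com) (M : nat) (C : T -> nat), [/\ depth c + 4 < M, Bounded c C &
    forall t s, dom c t -> encodes c t s ->
      exists q s', [/\ exec e s q s', q <= C t & outcome (depth c) M s s' (f t)]].

Definition ComputableB T (c : ctx T) (b : T -> bool) := Computable c (fun t => nat_of_bool (b t)).

(** The coding [cd] admits variables of any type, such as lists and booleans. [Q] carries what is
    known about the new value, from which bounds and other side conditions are proved. *)
Definition extc T U (c : ctx T) (cd : T -> U -> nat) (Q : T -> U -> Prop) : ctx (T * U) :=
  Ctx (fun x => dom c x.1 /\ Q x.1 x.2) (fun x => ins c x.1)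
      (fun x => cd x.1 x.2 :: env c x.1) (depth c).+1.

Definition ext T (c : ctx T) (Q : T -> nat -> Prop) := extc c (fun _ a => a) Q.

Definition sub T (c : ctx T) (P : T -> Prop) : ctx T :=
  Ctx (fun t => dom c t /\ P t) (ins c) (env c) (depth c).

Lemma bound_gt0 T (c : ctx T) t : 0 < bound c t.
Proof. exact: grow_gt0. Qed.

Lemma Bdd_const T (c : ctx T) m : Bounded c (fun _ => m).
Proof. by exists m, 0 => t _; rewrite expn0 muln1. Qed.

Lemma Bdd_add T (c : ctx T) f g : Bounded c f -> Bounded c g -> Bounded c (fun t => f t + g t).
Proof.
move=> [K [D Hf]] [K' [D' Hg]]; exists (K + K'), (D + D') => t Pt.
rewrite mulnDl; apply: leq_add.
  apply: (leq_trans (Hf t Pt)); rewrite leq_mul2l leq_pexp2l ?orbT ?bound_gt0 ?leq_addr //.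
apply: (leq_trans (Hg t Pt)); rewrite leq_mul2l leq_pexp2l ?orbT ?bound_gt0 ?leq_addl //.
Qed.

Lemma Bdd_mul T (c : ctx T) f g : Bounded c f -> Bounded c g -> Bounded c (fun t => f t * g t).
Proof.
move=> [K [D Hf]] [K' [D' Hg]]; exists (K * K'), (D + D') => t Pt.
by rewrite expnD mulnACA; apply: leq_mul; [exact: Hf | exact: Hg].
Qed.

Lemma Bdd_le T (c : ctx T) f g :
  Bounded c g -> (forall t, dom c t -> f t <= g t) -> Bounded c f.
Proof.
by move=> [K [D Hg]] le; exists K, D => t Pt; apply: leq_trans (Hg t Pt); apply: le.
Qed.

Lemma Bdd_weak T U (c : ctx T) (cd : T -> U -> nat) Q f :
  Bounded c f -> Bounded (extc c cd Q) (fun x => f x.1).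
Proof. by move=> [K [D Hf]]; exists K, D => -[t i] /= [Pt _]; apply: Hf. Qed.

Lemma Comp_narrow T (c : ctx T) (P : T -> Prop) f :
  (forall t, P t -> dom c t) -> Computable c f -> Computable (Ctx P (ins c) (env c) (depth c)) f.
Proof.
move=> PQ [e [M [C [lM [K [D HC]] He]]]]; exists e, M, C; split => //.
  by exists K, D => t Pt; apply: HC (PQ _ Pt).
move=> t s /= Pt rs; apply: He; first exact: PQ.
by case: rs => *; split.
Qed.

Lemma Comp_sub T (c : ctx T) (P : T -> Prop) f : Computable c f -> Computable (sub c P) f.
Proof. by apply: Comp_narrow => t []. Qed.

Lemma Comp_eq T (c : ctx T) f g :
  (forall t, dom c t -> f t = g t) -> Computable c f -> Computable c g.
Proof.
move=> fg [e [M [C [lM HC He]]]]; exists e, M, C; split => // t s Pt rs.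
by rewrite -fg //; apply: He.
Qed.

Lemma Comp_wexp T (c : ctx T) f (w : wexp) :
  (forall t s, dom c t -> encodes c t s -> weval s w = f t) -> Computable c f.
Proof.
move=> Hw; exists (WSet (depth c + 4) (WConst 0) w), (depth c + 5), (fun=> (1 + wcost w).+1).
split; [by rewrite ltn_add2l | exact: Bdd_const |].
move=> t s Pt rs; eexists; eexists; split; [exact: exec_wset | by [] |].
split => //= [a i|]; rewrite /upd /=; last by rewrite !eqxx /=; apply: Hw.
by case: ifP => // /andP[/eqP ? /eqP ?]; lia.
Qed.

Lemma Comp_const T (c : ctx T) m : Computable c (fun _ => m).
Proof. exact: (@Comp_wexp _ _ _ (WConst m)). Qed.

Lemma Comp_size T (c : ctx T) : Computable c (fun t => size_of (ins c t)).
Proof. by apply: (@Comp_wexp _ _ _ (WGet 2 (WConst 0))) => t s _ rs /=; apply: (encodes_n rs). Qed.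

Lemma Comp_param T (c : ctx T) : Computable c (fun t => param_of (ins c t)).
Proof. by apply: (@Comp_wexp _ _ _ (WGet 3 (WConst 0))) => t s _ rs /=; apply: (encodes_k rs). Qed.

Lemma Comp_var T U (c : ctx T) (cd : T -> U -> nat) Q :
  Computable (extc c cd Q) (fun x => cd x.1 x.2).
Proof.
apply: (@Comp_wexp _ _ _ (WGet (depth c + 4) (WConst 0))) => t s _ rs /=.
by have /= <- := encodes_env rs (ltn0Sn _); rewrite subn0 addnS.
Qed.

Lemma encodes_frame T (c : ctx T) t M s s' v :
  encodes c t s -> outcome (depth c) M s s' v -> encodes c t s'.
Proof.
move=> [size_of rm n k ev] [rm' fr _]; split => //; first by rewrite rm'.
- by rewrite fr ?n //; lia.
- by rewrite fr ?k //; lia.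
- by move=> x xd; rewrite fr ?ev //; lia.
Qed.

Definition wset (s : state R) a v := State (upd (wmem s) a 0 v) (rmem s).

Lemma wsetE s a v b j : wmem (wset s a v) b j =
  if (b == a) && (j == 0) then v else wmem s b j.
Proof. by []. Qed.

Lemma exec_move (s : state R) a b :
  exec (WSet a (WConst 0) (WGet b (WConst 0))) s 4 (wset s a (wmem s b 0)).
Proof. exact: exec_wset. Qed.

Lemma encodes_wset T (c : ctx T) t s a v :
  encodes c t s -> depth c + 4 <= a -> encodes c t (wset s a v).
Proof.
move=> [size_of rm n k ev] la; split => //; rewrite ?wsetE.
- by case: ifP => // /andP[]; lia.
- by case: ifP => // /andP[]; lia.
- by move=> x xd; rewrite wsetE; case: ifP => [/andP[]|_]; [lia | exact: ev].
Qed.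

Lemma encodes_ext T U (c : ctx T) (cd : T -> U -> nat) Q t s i :
  encodes c t s -> wmem s (depth c + 4) 0 = cd t i -> encodes (extc c cd Q) (t, i) s.
Proof.
move=> [size_of rm n k ev] si; split => //=; first by rewrite size_of.
case=> [_|x]; first by rewrite subn0 addSnnS.
by rewrite ltnS subSS; apply: ev.
Qed.

Lemma Comp_two T (c : ctx T) f g : Computable c f -> Computable c g ->
  exists e x M C, [/\ depth c + 4 < x < M, Bounded c C &
    forall t s, dom c t -> encodes c t s -> exists q s', [/\ exec e s q s', q <= C t,
      outcome (depth c) M s s' (g t) & wmem s' x 0 = f t]].
Proof.
move=> [e [M [C [lM bC He]]]] [e' [M' [C' [lM' bC' He']]]].
(* The second program overwrites the result cell, so the first result is kept in an array that
   neither program touches. *)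
pose x := maxn M M'.
exists (Seq e (Seq (WSet x (WConst 0) (WGet (depth c + 4) (WConst 0))) e')).
exists x, x.+1, (fun t => C t + (4 + C' t)).
split; first by rewrite /x; lia.
  by do ?apply: Bdd_add => //; exact: Bdd_const.
move=> t s Pt rs.
have [q [s1 [ex1 lq o1]]] := He t s Pt rs.
have r1 := encodes_frame rs o1.
have r2 : encodes c t (wset s1 x (wmem s1 (depth c + 4) 0)) by apply: encodes_wset => //; rewrite /x; lia.
have [q' [s2 [ex2 lq' o2]]] := He' t _ Pt r2.
exists (q + (4 + q')), s2; split.
- by apply: exec_seq ex1 _; apply: exec_seq ex2; apply: exec_move.
- by rewrite !leq_add.
- case: o1 o2 => rm1 fr1 v1 [rm2 fr2 v2]; split => //; first by rewrite rm2.
  move=> a i; rewrite /x => Ha; rewrite fr2 ?wsetE /x; last by lia.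
  case: ifP => [|_]; first by lia.
  by apply: fr1; lia.
- case: o1 o2 => rm1 fr1 v1 [rm2 fr2 v2]; rewrite fr2 ?wsetE ?eqxx /=; last by rewrite /x; lia.
  exact: v1.
Qed.

Lemma Comp_bin T (c : ctx T) f g h (w : wexp -> wexp -> wexp) K :
  (forall (s : state R) a b, weval s (w a b) = h (weval s a) (weval s b)) ->
  (forall a b, wcost (w (WGet a (WConst 0)) (WGet b (WConst 0))) <= K) ->
  Computable c f -> Computable c g -> Computable c (fun t => h (f t) (g t)).
Proof.
move=> wE wK cf cg; have [e [x [M [C [lx bC He]]]]] := Comp_two cf cg.
pose l := depth c + 4.
exists (Seq e (WSet l (WConst 0) (w (WGet x (WConst 0)) (WGet l (WConst 0))))).
exists M, (fun t => C t + (K + 2)); split; first by lia.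
  by apply: Bdd_add => //; exact: Bdd_const.
move=> t s Pt rs; have [q [s1 [ex1 lq [rm fr v] vx]]] := He t s Pt rs.
eexists; eexists; split; first by apply: exec_seq ex1 _; exact: exec_wset.
  by have := wK x l; rewrite /=; lia.
split => //= [a i Ha|]; rewrite /upd; last by rewrite /l !eqxx /= wE /= vx v.
by case: ifP => [/andP[/eqP ? /eqP ?]|_]; [lia | exact: fr].
Qed.

Lemma Comp_add T (c : ctx T) f g : Computable c f -> Computable c g -> Computable c (fun t => f t + g t).
Proof. exact: (@Comp_bin _ _ _ _ addn WAdd 10). Qed.

Lemma Comp_subn T (c : ctx T) f g : Computable c f -> Computable c g -> Computable c (fun t => f t - g t).
Proof. exact: (@Comp_bin _ _ _ _ subn WSub 10). Qed.

Lemma Comp_half T (c : ctx T) f : Computable c f -> Computable c (fun t => (f t)./2).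
Proof.
by move=> cf; apply: (@Comp_bin _ _ _ _ (fun a _ => a./2) (fun a _ => WHalf a) 10 _ _ cf cf).
Qed.

Lemma Comp_test T (c : ctx T) f g (h : instance -> nat -> nat -> bool)
    (b : wexp -> wexp -> bexp) K :
  (forall t (s : state R) a a', encodes c t s ->
     beval s (b a a') = h (ins c t) (weval s a) (weval s a')) ->
  (forall a a', bcost (b (WGet a (WConst 0)) (WGet a' (WConst 0))) <= K) ->
  Computable c f -> Computable c g -> ComputableB c (fun t => h (ins c t) (f t) (g t)).
Proof.
move=> bE bK cf cg; have [e [x [M [C [lx bC He]]]]] := Comp_two cf cg.
pose l := depth c + 4.
exists (Seq e (If (b (WGet x (WConst 0)) (WGet l (WConst 0)))
  (WSet l (WConst 0) (WConst 1)) (WSet l (WConst 0) (WConst 0)))).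
exists M, (fun t => C t + (K + 3)); split; first by lia.
  by apply: Bdd_add => //; exact: Bdd_const.
move=> t s Pt rs; have [q [s1 [ex1 lq o1 vx]]] := He t s Pt rs.
have r1 := encodes_frame rs o1; case: o1 => rm fr v.
exists (q + (bcost (b (WGet x (WConst 0)) (WGet l (WConst 0))) + 3)).
exists (wset s1 l (h (ins c t) (f t) (g t))); split.
- apply: exec_seq ex1 _; apply: exec_if; rewrite (bE t) //= vx v.
  by case: (h _ _ _); exact: exec_wset.
- by rewrite leq_add // leq_add2r.
- split => //= [a i Ha|]; rewrite /upd; last by rewrite /l !eqxx.
  by case: ifP => [/andP[/eqP ? /eqP ?]|_]; [lia | exact: fr].
Qed.

Lemma Comp_leq T (c : ctx T) f g : Computable c f -> Computable c g -> ComputableB c (fun t => f t <= g t).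
Proof. exact: (@Comp_test _ _ _ _ (fun _ a b => a <= b) WLe 10). Qed.

(** Squared distances are compared because the language has no square roots. *)
Definition close (I : instance) i j : bool :=
  ((coord_of I 0 i - coord_of I 0 j) * (coord_of I 0 i - coord_of I 0 j) +
   (coord_of I 1 i - coord_of I 1 j) * (coord_of I 1 i - coord_of I 1 j) <= 1)%R.

Lemma Comp_close T (c : ctx T) f g :
  Computable c f -> Computable c g -> ComputableB c (fun t => close (ins c t) (f t) (g t)).
Proof.
pose df a x y := RSub (RGet a x) (RGet a y).
pose b x y := RLe (RAdd (RMul (df 0 x y) (df 0 x y)) (RMul (df 1 x y) (df 1 x y))) (RWord (WConst 1)).
apply: (@Comp_test _ _ _ _ close b 100) => // t s x y rs.
by rewrite /= /close -(encodes_rmem rs).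
Qed.

(** This is the inequality $x_i > x_j + 1/2$ with both sides doubled, which avoids a division. *)
Definition gap (a : nat) (I : instance) j i : bool :=
  ~~ (coord_of I a i + coord_of I a i <= coord_of I a j + coord_of I a j + 1)%R.

Lemma Comp_gap a T (c : ctx T) f g :
  Computable c f -> Computable c g -> ComputableB c (fun t => gap a (ins c t) (f t) (g t)).
Proof.
pose b x y := BNot (RLe (RAdd (RGet a y) (RGet a y))
  (RAdd (RAdd (RGet a x) (RGet a x)) (RWord (WConst 1)))).
apply: (@Comp_test _ _ _ _ (gap a) b 100) => // t s x y rs.
by rewrite /= /gap -(encodes_rmem rs).
Qed.

(** A branch has to be computable, within its bound, only where it is taken. This later confines the
    dynamic programme to inputs for which its tables are small. *)
Lemma Comp_if T (c : ctx T) (b : T -> bool) f g : ComputableB c b ->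
  Computable (sub c b) f -> Computable (sub c (fun t => ~~ b t)) g ->
  Computable c (fun t => if b t then f t else g t).
Proof.
move=> [e [M [C [lM bC He]]]] [e1 [M1 [C1 [lM1 bC1 He1]]]] [e2 [M2 [C2 [lM2 bC2 He2]]]].
pose l := depth c + 4.
exists (Seq e (If (WLe (WConst 1) (WGet l (WConst 0))) e1 e2)).
exists (maxn M (maxn M1 M2)), (fun t => C t + (4 + (if b t then C1 t else C2 t))).
split; first by lia.
  apply: Bdd_add => //; apply: Bdd_add; first exact: Bdd_const.
  case: bC1 bC2 => K1 [D1 H1] [K2 [D2 H2]]; exists (K1 + K2), (D1 + D2) => t Pt.
  have p D D' : bound c t ^ D <= bound c t ^ (D + D') /\ bound c t ^ D' <= bound c t ^ (D + D').
    by rewrite !leq_pexp2l ?bound_gt0 ?leq_addr ?leq_addl.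
  rewrite mulnDl; case: ifP => bt.
    apply: leq_trans (leq_addr _ _); apply: leq_trans (H1 t (conj Pt bt)) _.
    by rewrite leq_mul2l (proj1 (p D1 D2)) orbT.
  apply: leq_trans (leq_addl _ _); apply: leq_trans (H2 t (conj Pt (negbT bt))) _.
  by rewrite leq_mul2l (proj2 (p D1 D2)) orbT.
move=> t s Pt rs; have [q [s1 [ex1 lq o1]]] := He t s Pt rs.
have r1 := encodes_frame rs o1.
have fin M' e' C' v : exec (if b t then e1 else e2) s1 e' C' ->
    M' <= maxn M (maxn M1 M2) -> e' <= (if b t then C1 t else C2 t) ->
    outcome (depth c) M' s1 C' v ->
  exists q s', [/\ exec (Seq e (If (WLe (WConst 1) (WGet l (WConst 0))) e1 e2)) s q s',
   q <= C t + (4 + (if b t then C1 t else C2 t)) & outcome (depth c) (maxn M (maxn M1 M2)) s s' v].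
  move=> ex2 lM' le' [rm2 fr2 v2]; exists (q + (4 + e')), C'; split.
  - apply: exec_seq ex1 _; apply: exec_if => /=.
    by rewrite (out_val o1); case: (b t) ex2.
  - by rewrite !leq_add.
  - split => //; first by rewrite rm2 (out_rmem o1).
    by move=> a i Ha; rewrite fr2 ?(out_frame o1) //; lia.
case bt: (b t) fin => fin.
  have [|q2 [s2 [ex2 lq2 o2]]] := He1 t s1 (conj Pt bt); first by case: r1 => *; split.
  by apply: fin ex2 _ lq2 o2; lia.
have [|q2 [s2 [ex2 lq2 o2]]] := He2 t s1 (conj Pt (negbT bt)); first by case: r1 => *; split.
by apply: fin ex2 _ lq2 o2; lia.
Qed.

(** The newest variable occupies the cell of the result: it is saved in array [M.+1]. *)
Lemma Comp_weak T U (c : ctx T) (cd : T -> U -> nat) Q f :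
  Computable c f -> Computable (extc c cd Q) (fun x => f x.1).
Proof.
move=> [e [M [C [lM bC He]]]].
pose l := depth c + 4.
exists (Seq (WSet M.+1 (WConst 0) (WGet l (WConst 0))) (Seq e
  (Seq (WSet l.+1 (WConst 0) (WGet l (WConst 0))) (WSet l (WConst 0) (WGet M.+1 (WConst 0)))))).
exists M.+2, (fun x => 4 + (C x.1 + (4 + 4))); split; first by rewrite /=; lia.
  by apply: Bdd_add; [exact: Bdd_const | apply: Bdd_add; [exact: Bdd_weak|exact: Bdd_const]].
move=> [t i] s [/= Pt _] rs.
have r1 : encodes c t (wset s M.+1 (wmem s l 0)).
  apply: encodes_wset; last by lia.
  case: rs => /= [[size_of]] rm n k ev; split => // x xd.
  by have := ev x.+1; rewrite /= subSS; apply.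
have [q [s1 [ex1 lq [rm fr v]]]] := He t _ Pt r1.
pose s2 := wset s1 l.+1 (wmem s1 l 0).
exists (4 + (q + (4 + 4))), (wset s2 l (wmem s2 M.+1 0)); split.
- apply: exec_seq; first exact: exec_move.
  apply: exec_seq; first exact: ex1.
  by apply: exec_seq; exact: exec_move.
- by rewrite leq_add2l leq_add2r.
split => //=.
  move=> a j Ha; rewrite /upd.
  have E : wmem s2 M.+1 0 = wmem s l 0.
    rewrite wsetE; case: ifP => [/andP[/eqP ? _]|_]; first by unfold l; lia.
    by rewrite fr ?wsetE ?eqxx //; lia.
  case: ifP => [/andP[/eqP -> /eqP ->]//|Hal].
  case: ifP => [/andP[/eqP ? /eqP ?]|_]; first by lia.
  rewrite fr; last by rewrite /l in Hal; lia.
  by rewrite wsetE; case: ifP => [/andP[/eqP ? /eqP ?]|_//]; lia.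
rewrite /upd; case: ifP => [/andP[/eqP ? _]|_]; first by unfold l; lia.
by rewrite /l addSn !eqxx.
Qed.

Definition ext2 T U (c : ctx T) (m : T -> nat) (cd : T -> U -> nat) (Q : T -> nat -> U -> Prop) :=
  extc (ext c (fun t i => i <= m t)) (fun y a => cd y.1 a) (fun y a => Q y.1 y.2 a).

(** The program evaluates [cond] and never [cnt], so the number of iterations need only be bounded,
    not computed beforehand; this is how the length of a coded list is found. Counter, state and
    value of [cond] occupy three consecutive arrays, exactly where [step] and [cond] expect their
    variables and leave their results. *)
Lemma Comp_loop T U (c : ctx T) (cd : T -> U -> nat) (Q : T -> nat -> U -> Prop)
    (cnt : T -> nat) (init : T -> U) (step : T -> nat -> U -> U) (cond : T -> nat -> U -> bool) :
  Bounded c cnt -> Computable c (fun t => cd t (init t)) ->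
  Computable (ext2 c cnt cd (fun t i a => Q t i a /\ i < cnt t))
    (fun x => cd x.1.1 (step x.1.1 x.1.2 x.2)) ->
  ComputableB (ext2 c cnt cd Q) (fun x => cond x.1.1 x.1.2 x.2) ->
  (forall t i, dom c t -> i <= cnt t -> let a := iteri i (step t) (init t) in
     Q t i a /\ cond t i a = (i < cnt t)) ->
  Computable c (fun t => cd t (iteri (cnt t) (step t) (init t))).
Proof.
move=> bcnt [e0 [M0 [C0 [lM0 bC0 He0]]]] [e1 [M1 [C1 [lM1 bC1 He1]]]]
  [e2 [M2 [C2 [lM2 bC2 He2]]]] HQ.
rewrite /= in lM1 lM2.
pose l := depth c + 4.
pose body := Seq e1 (Seq (WSet l.+1 (WConst 0) (WGet l.+2 (WConst 0)))
  (Seq (WSet l (WConst 0) (WAdd (WGet l (WConst 0)) (WConst 1))) e2)).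
pose wh := While (WLe (WConst 1) (WGet l.+2 (WConst 0))) body.
pose M := maxn M0 (maxn M1 M2).
have [K1 [D1 H1]] := bC1; have [K2 [D2 H2]] := bC2.
pose S1 t := K1 * bound c t ^ D1; pose S2 t := K2 * bound c t ^ D2.
exists (Seq e0 (Seq (WSet l.+1 (WConst 0) (WGet l (WConst 0)))
  (Seq (WSet l (WConst 0) (WConst 0)) (Seq e2 (Seq wh
   (WSet l (WConst 0) (WGet l.+1 (WConst 0)))))))).
exists M, (fun t => C0 t + (4 + (3 + (S2 t + ((4 + cnt t * (14 + S1 t + S2 t)) + 4))))).
have bS1 : Bounded c S1 by exists K1, D1.
have bS2 : Bounded c S2 by exists K2, D2.
split; first by rewrite /M; lia.
  by do ?[apply: Bdd_add => // | apply: Bdd_mul => // | exact: Bdd_const].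
move=> t s Pt rs.
pose I i := iteri i (step t) (init t).
have frM (s1 s2 : state R) v : outcome (depth c).+2 M1 s1 s2 v \/ outcome (depth c).+2 M2 s1 s2 v ->
  forall a i, ~~ ((i == 0) && (l <= a < M)) -> wmem s2 a i = wmem s1 a i.
  by case=> -[_ fr _] a i Ha; apply: fr; rewrite /l /M in Ha; lia.
have rext (s1 : state R) i (a : U) (Q' : T -> nat -> U -> Prop) : encodes c t s1 -> wmem s1 l 0 = i -> wmem s1 l.+1 0 = cd t a ->
    encodes (ext2 c cnt cd Q') (t, i, a) s1.
  by move=> r1 e_i e_a; apply: encodes_ext => //; apply: encodes_ext.
have loop j : forall i (s1 : state R), i + j = cnt t -> encodes c t s1 -> wmem s1 l 0 = i ->
    wmem s1 l.+1 0 = cd t (I i) -> wmem s1 l.+2 0 = (i < cnt t) ->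
    exists q s2, [/\ exec wh s1 q s2, q <= 4 + j * (14 + S1 t + S2 t),
      rmem s2 = rmem s1, forall a i, ~~ ((i == 0) && (l <= a < M)) -> wmem s2 a i = wmem s1 a i
      & wmem s2 l.+1 0 = cd t (I (cnt t))].
  elim: j => [|j IH] i s1.
    rewrite addn0 => -> r1 e_i e_a e_c; exists 4, s1; split => //.
    by apply: exec_while_false; rewrite /= e_c ltnn.
  move=> ij r1 e_i e_a e_c.
  have i_lt : i < cnt t by lia.
  have [Qi _] := HQ t i Pt (ltnW i_lt).
  have [q1 [s2 [ex1 lq1 o1]]] := He1 (t, i, I i) s1 (conj (conj Pt (ltnW i_lt)) (conj Qi i_lt))
    (rext _ _ _ _ r1 e_i e_a).
  pose s3 := wset s2 l.+1 (wmem s2 l.+2 0).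
  pose s4 := wset s3 l (wmem s3 l 0 + 1).
  have r2 : encodes c t s2.
    by apply: (@encodes_frame _ _ _ M s1 _ (wmem s2 l 0)) => //; split; [exact: out_rmem o1 | apply: frM; left; exact: o1|].
  have r4 : encodes c t s4 by apply: encodes_wset; [apply: encodes_wset => //|]; unfold l; lia.
  have v2 : wmem s2 l.+2 0 = cd t (I i.+1) by have := out_val o1; rewrite /= !addSn.
  have l2 : wmem s2 l 0 = i by rewrite (out_frame o1) //=; lia.
  have l4 : wmem s4 l 0 = i.+1.
    by rewrite /s4 /s3 wsetE !eqxx wsetE l2; case: ifP => [/andP[/eqP]|_]; rewrite /=; lia.
  have a4 : wmem s4 l.+1 0 = cd t (I i.+1).
    by rewrite /s4 wsetE; case: ifP => [/andP[/eqP]|_]; [lia | rewrite /s3 wsetE !eqxx].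
  have [Qi1 ci1] := HQ t i.+1 Pt i_lt.
  have [q2 [s5 [ex2 lq2 o2]]] := He2 (t, i.+1, I i.+1) s4 (conj (conj Pt i_lt) Qi1)
    (rext _ _ _ _ r4 l4 a4).
  have r5 : encodes c t s5.
    by apply: (@encodes_frame _ _ _ M s4 _ (wmem s5 l 0)) => //; split; [exact: out_rmem o2 | apply: frM; right; exact: o2|].
  have [|||||q3 [s6 [ex3 lq3 rm3 fr3 v3]]] := IH i.+1 s5 => //.
  - by lia.
  - by rewrite (out_frame o2) ?l4 //=; lia.
  - by rewrite (out_frame o2) ?a4 //=; lia.
  - by have := out_val o2; rewrite /= ci1 !addSn.
  exists (4 + (q1 + (4 + (6 + q2))) + q3), s6; split => //.
  - apply: exec_while_true ex3; first by rewrite /= e_c i_lt.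
    apply: exec_seq ex1 _; apply: exec_seq; first exact: exec_move.
    by apply: exec_seq ex2; exact: exec_wset.
  - have h1 : q1 <= S1 t := leq_trans lq1 (H1 (t, i, I i) (conj (conj Pt (ltnW i_lt)) (conj Qi i_lt))).
    have h2 : q2 <= S2 t := leq_trans lq2 (H2 (t, i.+1, I i.+1) (conj (conj Pt i_lt) Qi1)).
    by rewrite mulSn; lia.
  - by rewrite rm3 (out_rmem o2) /= (out_rmem o1).
  - move=> a i' Ha; rewrite fr3 // (frM s4 s5 _ (or_intror o2)) // /s4 /s3 !wsetE.
    case: ifP => [|_]; first by rewrite /l /M in Ha *; lia.
    case: ifP => [|_]; first by rewrite /l /M in Ha *; lia.
    by rewrite (frM s1 s2 _ (or_introl o1)).
have [q0 [s1 [ex0 lq0 o0]]] := He0 t s Pt rs.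
have r1 := encodes_frame rs o0.
pose s2 := wset s1 l.+1 (wmem s1 l 0).
pose s3 := wset s2 l 0.
have r3 : encodes c t s3 by apply: encodes_wset; [apply: encodes_wset => //|]; unfold l; lia.
have [Q0 c0] := HQ t 0 Pt (leq0n _).
have l3 : wmem s3 l 0 = 0 by rewrite /s3 wsetE !eqxx.
have a3 : wmem s3 l.+1 0 = cd t (I 0).
  rewrite /s3 wsetE; case: ifP => [/andP[/eqP]|_]; first by lia.
  by rewrite /s2 wsetE !eqxx; exact: out_val o0.
have [q2 [s4 [ex2 lq2 o2]]] := He2 (t, 0, I 0) s3 (conj (conj Pt (leq0n _)) Q0)
    (rext _ _ _ _ r3 l3 a3).
have r4 : encodes c t s4.
  by apply: (@encodes_frame _ _ _ M s3 _ (wmem s4 l 0)) => //; split; [exact: out_rmem o2 | apply: frM; right; exact: o2|].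
have [|||||q3 [s5 [ex3 lq3 rm3 fr3 v3]]] := loop (cnt t) 0 s4 => //.
- by rewrite (out_frame o2) ?l3 //=; lia.
- by rewrite (out_frame o2) ?a3 //=; lia.
- by have := out_val o2; rewrite /= c0 !addSn.
exists (q0 + (4 + (3 + (q2 + (q3 + 4))))), (wset s5 l (wmem s5 l.+1 0)); split.
- apply: exec_seq ex0 _; apply: exec_seq; first exact: exec_move.
  apply: exec_seq; first exact: exec_wset.
  by apply: exec_seq ex2 _; apply: exec_seq ex3 _; exact: exec_move.
- have h2 : q2 <= S2 t := leq_trans lq2 (H2 (t, 0, I 0) (conj (conj Pt (leq0n _)) Q0)).
  by lia.
split.
- by rewrite /= rm3 (out_rmem o2) /= (out_rmem o0).
- move=> a i Ha; rewrite wsetE; case: ifP => [|_]; first by rewrite /l /M in Ha *; lia.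
  rewrite fr3 // (frM s3 s4 _ (or_intror o2)) // /s3 /s2 !wsetE.
  case: ifP => [|_]; first by rewrite /l /M in Ha *; lia.
  case: ifP => [|_]; first by rewrite /l /M in Ha *; lia.
  by rewrite (out_frame o0) //; rewrite /l /M in Ha *; lia.
- by rewrite wsetE !eqxx /= v3.
Qed.

End Computability.

(** * Derived operations: conditions, arithmetic and searches *)

Section Derived.

Variables (R : realType) (B : growth).

Local Notation Comp := (@Computable R B _).
Local Notation CompB := (@ComputableB R B _).
Local Notation Bdd := (@Bounded R B _).
Local Notation ctx := (ctx R).

Lemma Comp_let T U (c : ctx T) (cd : T -> U -> nat) (v : T -> U) (h : T -> U -> nat) :
  Comp c (fun t => cd t (v t)) ->
  Comp (extc c cd (fun t a => a = v t)) (fun x => h x.1 x.2) ->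
  Comp c (fun t => h t (v t)).
Proof.
move=> [e [M [C [lM bC He]]]] [e' [M' [C' [/= lM' [K [D bC']] He']]]].
pose l := depth c + 4.
exists (Seq e (Seq e' (WSet l (WConst 0) (WGet l.+1 (WConst 0))))).
exists (maxn M M'), (fun t => C t + (C' (t, v t) + 4)); split; first by lia.
  do 2![apply: Bdd_add => //]; last exact: Bdd_const.
  by exists K, D => t Pt; apply: (bC' (t, v t)).
move=> t s Pt rs.
have [q [s1 [ex1 lq o1]]] := He t s Pt rs.
have r1 := encodes_frame rs o1.
have [|q' [s2 [ex2 lq' o2]]] := He' (t, v t) s1 (conj Pt erefl).
  by apply: encodes_ext => //; exact: out_val o1.
exists (q + (q' + 4)), (wset s2 l (wmem s2 l.+1 0)); split.
- by apply: exec_seq ex1 _; apply: exec_seq ex2 _; exact: exec_move.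
- by rewrite leq_add // leq_add2r.
split => /=.
- by rewrite (out_rmem o2) (out_rmem o1).
- move=> a i Ha; rewrite /upd; case: ifP => [/andP[/eqP ? /eqP ?]|_]; first by unfold l in *; lia.
  by rewrite (out_frame o2) /= ?(out_frame o1) //; lia.
- by rewrite /upd !eqxx; exact: out_val o2.
Qed.

Lemma Comp_succ T (c : ctx T) f : Comp c f -> Comp c (fun t => (f t).+1).
Proof.
move=> cf; apply: (@Comp_eq _ _ _ _ (fun t => f t + 1)) => [t _|]; first exact: addn1.
by apply: Comp_add => //; exact: Comp_const.
Qed.

Lemma Comp_ltn T (c : ctx T) f g : Comp c f -> Comp c g -> CompB c (fun t => f t < g t).
Proof. by move=> cf cg; apply: Comp_leq => //; exact: Comp_succ. Qed.

(** The invariant fixes the state to be the iterate itself. Hence [step] is required to be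
    computable only at states that are reached, whose sizes can be bounded from the iteration. *)
Lemma Comp_iteri T U (c : ctx T) (cd : T -> U -> nat) (cnt : T -> nat)
    (init : T -> U) (step : T -> nat -> U -> U) :
  Bdd c cnt -> Comp c cnt -> Comp c (fun t => cd t (init t)) ->
  Comp (ext2 c cnt cd (fun t i a => a = iteri i (step t) (init t) /\ i < cnt t))
    (fun x => cd x.1.1 (step x.1.1 x.1.2 x.2)) ->
  Comp c (fun t => cd t (iteri (cnt t) (step t) (init t))).
Proof.
move=> bcnt ccnt cinit cstep.
apply: (@Comp_loop _ _ _ _ _ _ (fun t i a => a = iteri i (step t) (init t)) _ _ _
  (fun t i _ => i < cnt t)) => //.
apply: Comp_ltn; first by apply: (@Comp_weak _ _ _ _ _ _ _ (fun y => y.2)); exact: Comp_var.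
by apply: (@Comp_weak _ _ _ _ _ _ _ (fun y => cnt y.1)); apply: Comp_weak.
Qed.

Lemma Comp_ext2 T U (c : ctx T) (cd : T -> U -> nat) (Q : T -> nat -> U -> Prop)
    (k m : T -> nat) f :
  (forall t i a, Q t i a -> i < m t) ->
  Comp (ext c (fun t i => i < m t)) f -> Comp (ext2 c k cd Q) (fun x => f x.1).
Proof.
move=> Qm cf.
apply: (@Comp_narrow _ _ _ (extc (ext c (fun t i => i < m t)) (fun y a => cd y.1 a)
  (fun y a => Q y.1 y.2 a))); last exact: Comp_weak.
by move=> [[t i] a] [[Pt _] q]; split => //; split => //; exact: Qm q.
Qed.

Lemma Comp_if' T (c : ctx T) (b : T -> bool) f g : CompB c b ->
  Comp c f -> Comp c g -> Comp c (fun t => if b t then f t else g t).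
Proof. by move=> cb cf cg; apply: Comp_if => //; apply: Comp_sub. Qed.

Lemma Comp_true T (c : ctx T) : CompB c (fun=> true).
Proof. exact: Comp_const. Qed.

Lemma Comp_negb T (c : ctx T) b : CompB c b -> CompB c (fun t => ~~ b t).
Proof.
move=> cb; apply: (@Comp_eq _ _ _ _ (fun t => 1 - b t)) => [t _|]; first by case: (b t).
by apply: Comp_subn => //; exact: Comp_const.
Qed.

Lemma Comp_andb T (c : ctx T) b1 b2 : CompB c b1 -> CompB (sub c b1) b2 ->
  CompB c (fun t => b1 t && b2 t).
Proof.
move=> c1 c2; apply: (@Comp_eq _ _ _ _ (fun t => if b1 t then nat_of_bool (b2 t) else 0)).
  by move=> t _; case: (b1 t).
by apply: Comp_if => //; exact: Comp_const.
Qed.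

Lemma Comp_orb T (c : ctx T) b1 b2 : CompB c b1 -> CompB (sub c (fun t => ~~ b1 t)) b2 ->
  CompB c (fun t => b1 t || b2 t).
Proof.
move=> c1 c2; apply: (@Comp_eq _ _ _ _ (fun t => if b1 t then 1 else nat_of_bool (b2 t))).
  by move=> t _; case: (b1 t).
by apply: Comp_if => //; exact: Comp_const.
Qed.

Lemma Comp_implb T (c : ctx T) b1 b2 : CompB c b1 -> CompB (sub c b1) b2 ->
  CompB c (fun t => b1 t ==> b2 t).
Proof.
move=> c1 c2; apply: (@Comp_eq _ _ _ _ (fun t => if b1 t then nat_of_bool (b2 t) else 1)).
  by move=> t _; case: (b1 t).
by apply: Comp_if => //; exact: Comp_const.
Qed.

Lemma Comp_eqn T (c : ctx T) f g : Comp c f -> Comp c g -> CompB c (fun t => f t == g t).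
Proof.
move=> cf cg; apply: (@Comp_eq _ _ _ _ (fun t => nat_of_bool ((f t <= g t) && (g t <= f t)))).
  by move=> t _; rewrite eqn_leq.
by apply: Comp_andb; last apply: Comp_sub; apply: Comp_leq.
Qed.

Lemma Comp_maxn T (c : ctx T) f g : Comp c f -> Comp c g -> Comp c (fun t => maxn (f t) (g t)).
Proof.
move=> cf cg; rewrite /maxn; apply: Comp_if' => //; exact: Comp_ltn.
Qed.

Lemma Comp_double T (c : ctx T) f : Comp c f -> Comp c (fun t => (f t).*2).
Proof.
move=> cf; apply: (@Comp_eq _ _ _ _ (fun t => f t + f t)) => [t _|]; first by rewrite addnn.
exact: Comp_add.
Qed.

Lemma Comp_odd T (c : ctx T) f : Comp c f -> CompB c (fun t => odd (f t)).
Proof.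
move=> cf; apply: (@Comp_eq _ _ _ _ (fun t => f t - (f t)./2.*2)) => [t _|].
  by rewrite -{1}(odd_double_half (f t)) addnK.
by apply: Comp_subn => //; apply: Comp_double; apply: Comp_half.
Qed.


Lemma foldl_iota A (f : A -> nat -> A) z m :
  foldl f z (iota 0 m) = iteri m (fun i a => f a i) z.
Proof. by elim: m => // m IH; rewrite -addn1 iotaD foldl_cat IH /= addn1. Qed.

Lemma Comp_foldl_iota T U (c : ctx T) (cd : T -> U -> nat) (m : T -> nat)
    (z : T -> U) (f : T -> U -> nat -> U) :
  Bdd c m -> Comp c m -> Comp c (fun t => cd t (z t)) ->
  Comp (ext2 c m cd (fun t i a => a = foldl (f t) (z t) (iota 0 i) /\ i < m t))
    (fun x => cd x.1.1 (f x.1.1 x.2 x.1.2)) ->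
  Comp c (fun t => cd t (foldl (f t) (z t) (iota 0 (m t)))).
Proof.
move=> bm cm cz cf; apply: (@Comp_eq _ _ _ _
  (fun t => cd t (iteri (m t) (fun i a => f t a i) (z t)))) => [t _|]; first by rewrite foldl_iota.
apply: (@Comp_iteri _ U c cd m z (fun t i a => f t a i)) => //.
apply: Comp_narrow cf => -[[t i] a] /= [Pt [-> lim]]; split => //.
by rewrite foldl_iota.
Qed.

Lemma has_foldl A (p : pred A) b s : foldl (fun a x => a || p x) b s = b || has p s.
Proof. by elim: s b => [|x s IH] b /=; rewrite ?orbF // IH orbA. Qed.

Lemma Comp_has T (c : ctx T) (m : T -> nat) (p : T -> nat -> bool) :
  Bdd c m -> Comp c m -> CompB (ext c (fun t i => i < m t)) (fun x => p x.1 x.2) ->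
  CompB c (fun t => has (p t) (iota 0 (m t))).
Proof.
move=> bm cm cp; apply: (@Comp_eq _ _ _ _
  (fun t => nat_of_bool (foldl (fun a x => a || p t x) false (iota 0 (m t))))) => [t _|].
  by rewrite has_foldl.
apply: (@Comp_foldl_iota _ bool c (fun _ => nat_of_bool) m (fun=> false) (fun t a i => a || p t i)) => //.
  exact: Comp_const.
apply: Comp_orb; first exact: Comp_var.
by apply: Comp_sub; apply: (@Comp_ext2 _ _ _ _ _ m m (fun y => nat_of_bool (p y.1 y.2))) => // t i a [].
Qed.

Lemma Comp_all T (c : ctx T) (m : T -> nat) (p : T -> nat -> bool) :
  Bdd c m -> Comp c m -> CompB (ext c (fun t i => i < m t)) (fun x => p x.1 x.2) ->
  CompB c (fun t => all (p t) (iota 0 (m t))).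
Proof.
move=> bm cm cp; apply: (@Comp_eq _ _ _ _
  (fun t => nat_of_bool (~~ has (fun i => ~~ p t i) (iota 0 (m t))))) => [t _|].
  by rewrite -all_predC /=; congr nat_of_bool; apply: eq_all => i /=; rewrite negbK.
by apply: Comp_negb; apply: Comp_has => //; exact: Comp_negb.
Qed.

Lemma Comp_sum T (c : ctx T) (m : T -> nat) (p : T -> nat -> nat) :
  Bdd c m -> Comp c m -> Comp (ext c (fun t i => i < m t)) (fun x => p x.1 x.2) ->
  Comp c (fun t => \sum_(i <- iota 0 (m t)) p t i).
Proof.
move=> bm cm cp; apply: (@Comp_eq _ _ _ _
  (fun t => foldl (fun a x => a + p t x) 0 (iota 0 (m t)))) => [t _|].
  have H s b : foldl (fun a x => a + p t x) b s = b + \sum_(i <- s) p t i.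
    by elim: s b => [|x s IH] b /=; rewrite ?big_nil ?addn0 // big_cons IH addnA.
  by rewrite H.
apply: (@Comp_foldl_iota _ nat c (fun _ a => a) m (fun=> 0) (fun t a i => a + p t i)) => //.
  exact: Comp_const.
apply: Comp_add; first exact: Comp_var.
by apply: (@Comp_ext2 _ _ _ _ _ m m (fun y => p y.1 y.2)) => // t i a [].
Qed.

Lemma Comp_max T (c : ctx T) (m : T -> nat) (p : T -> nat -> nat) :
  Bdd c m -> Comp c m -> Comp (ext c (fun t i => i < m t)) (fun x => p x.1 x.2) ->
  Comp c (fun t => \max_(i <- iota 0 (m t)) p t i).
Proof.
move=> bm cm cp; apply: (@Comp_eq _ _ _ _
  (fun t => foldl (fun a x => maxn a (p t x)) 0 (iota 0 (m t)))) => [t _|].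
  have H s b : foldl (fun a x => maxn a (p t x)) b s = maxn b (\max_(i <- s) p t i).
    by elim: s b => [|x s IH] b /=; rewrite ?big_nil ?maxn0 // big_cons IH maxnA.
  by rewrite H max0n.
apply: (@Comp_foldl_iota _ nat c (fun _ a => a) m (fun=> 0) (fun t a i => maxn a (p t i))) => //.
  exact: Comp_const.
apply: Comp_maxn; first exact: Comp_var.
by apply: (@Comp_ext2 _ _ _ _ _ m m (fun y => p y.1 y.2)) => // t i a [].
Qed.

Lemma Comp_count T (c : ctx T) (m : T -> nat) (p : T -> nat -> bool) :
  Bdd c m -> Comp c m -> CompB (ext c (fun t i => i < m t)) (fun x => p x.1 x.2) ->
  Comp c (fun t => count (p t) (iota 0 (m t))).
Proof.
move=> bm cm cp; apply: (@Comp_eq _ _ _ _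
  (fun t => \sum_(i <- iota 0 (m t)) (p t i : nat))) => [t _|]; last exact: Comp_sum.
by elim: (iota 0 (m t)) => [|x s IH]; rewrite ?big_nil // big_cons IH.
Qed.

(** The accumulator equals the counter exactly as long as there has been no hit, and it stops moving
    at the first one. *)
Lemma find_iteri (p : pred nat) m :
  find p (iota 0 m) = iteri m (fun i a => a + ((a == i) && ~~ p i)) 0.
Proof.
elim: m => // m IH; have -> : iota 0 m.+1 = iota 0 m ++ [:: m] by rewrite -addn1 iotaD.
rewrite find_cat size_iota /= -IH.
case: ifP => hp; last first.
  have -> : find p (iota 0 m) = m by rewrite hasNfind ?size_iota // hp.
  by rewrite eqxx /=; case: (p m); rewrite /= ?addn0.
have : find p (iota 0 m) < m by rewrite -{2}(size_iota 0 m) -has_find.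
by move=> lt; rewrite (ltn_eqF lt) addn0.
Qed.

Lemma Comp_find T (c : ctx T) (m : T -> nat) (p : T -> nat -> bool) :
  Bdd c m -> Comp c m -> CompB (ext c (fun t i => i < m t)) (fun x => p x.1 x.2) ->
  Comp c (fun t => find (p t) (iota 0 (m t))).
Proof.
move=> bm cm cp; apply: (@Comp_eq _ _ _ _
  (fun t => iteri (m t) (fun i a => a + ((a == i) && ~~ p t i)) 0)) => [t _|].
  by rewrite find_iteri.
apply: (@Comp_iteri _ nat c (fun _ a => a) m (fun=> 0) (fun t i a => a + ((a == i) && ~~ p t i))) => //.
  exact: Comp_const.
apply: Comp_add; first exact: Comp_var.
apply: Comp_andb; first apply: Comp_eqn; first exact: Comp_var.
  by apply: (@Comp_weak _ _ _ _ _ _ _ (fun y => y.2)); exact: Comp_var.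
apply: Comp_sub; apply: Comp_negb.
by apply: (@Comp_ext2 _ _ _ _ _ m m (fun y => nat_of_bool (p y.1 y.2))) => // t i a [].
Qed.

(** Words have no multiplication: [f t] is added [g t] times, hence the bound on [g]. *)
Lemma Comp_mul T (c : ctx T) f g :
  Bdd c g -> Comp c f -> Comp c g -> Comp c (fun t => f t * g t).
Proof.
move=> bg cf cg; apply: (@Comp_eq _ _ _ _ (fun t => \sum_(i <- iota 0 (g t)) f t)) => [t _|].
  by rewrite big_const_seq count_predT size_iota iter_addn_0.
by apply: (@Comp_sum _ c g (fun t _ => f t)) => //; apply: Comp_weak.
Qed.

Lemma count_ltn_iota k m : k <= m -> count (fun i => i < k) (iota 0 m) = k.
Proof.
move=> km; rewrite -(subnKC km) iotaD count_cat add0n.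
have /eqP -> : count (fun i => i < k) (iota 0 k) == k.
  by rewrite -{3}(size_iota 0 k) -all_count; apply/allP => i; rewrite mem_iota.
rewrite -[RHS]addn0; congr addn; apply/eqP; rewrite eqn0Ngt -has_count.
by apply/hasPn => i; rewrite mem_iota => /andP[]; rewrite -leqNgt.
Qed.

(** The quotient is the number of positive multiples of [g t] up to [f t]. The guard [0 < g t]
    reproduces the convention that division by zero gives zero. *)
Lemma Comp_div T (c : ctx T) f g :
  Bdd c f -> Comp c f -> Comp c g -> Comp c (fun t => f t %/ g t).
Proof.
move=> bf cf cg; apply: (@Comp_eq _ _ _ _
  (fun t => count (fun i => (0 < g t) && (g t * i.+1 <= f t)) (iota 0 (f t)))) => [t _|].
  case: (posnP (g t)) => [->|g0]; first by rewrite divn0; elim: (iota _ _) => //.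
  rewrite (@eq_count _ _ (fun i => i < f t %/ g t)) => [|i]; last by rewrite leq_divRL // mulnC.
  by rewrite count_ltn_iota // leq_div.
apply: (@Comp_count _ c f (fun t i => (0 < g t) && (g t * i.+1 <= f t))) => //.
apply: Comp_andb.
  by apply: Comp_ltn; [exact: Comp_const | exact: Comp_weak].
apply: Comp_sub; apply: Comp_leq; last exact: Comp_weak.
apply: Comp_mul; last by apply: Comp_succ; exact: Comp_var.
  apply: (@Bdd_le _ _ _ _ _ (fun x => f x.1)); first exact: Bdd_weak.
  by move=> [t i] /= [_].
exact: Comp_weak.
Qed.

Lemma Comp_mod T (c : ctx T) f g :
  Bdd c f -> Comp c f -> Comp c g -> Comp c (fun t => f t %% g t).
Proof.
move=> bf cf cg; apply: (@Comp_eq _ _ _ _ (fun t => f t - g t * (f t %/ g t))) => [t _|].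
  by rewrite {1}(divn_eq (f t) (g t)) mulnC addKn.
apply: Comp_subn => //; apply: Comp_mul => //; last exact: Comp_div.
by apply: Bdd_le bf _ => t _; exact: leq_div.
Qed.

Lemma Comp_iterc T (c : ctx T) (cnt init : T -> nat) (step : nat -> nat) :
  Bdd c cnt -> Comp c cnt -> Comp c init ->
  (forall T' (c' : ctx T') f, Comp c' f -> Comp c' (fun t => step (f t))) ->
  Comp c (fun t => iter (cnt t) step (init t)).
Proof.
move=> bc cc ci cs; apply: (@Comp_eq _ _ _ _
  (fun t => iteri (cnt t) (fun _ => step) (init t))) => [t _|].
  by elim: (cnt t) => //= m ->.
apply: (@Comp_iteri _ nat c (fun _ a => a) cnt init (fun _ _ => step)) => //.
by apply: cs; exact: Comp_var.
Qed.

(** Only the base and the exponent must be small; the power itself may be as large as masks and list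
    codes require. *)
Lemma Comp_exp T (c : ctx T) f g :
  Bdd c f -> Bdd c g -> Comp c f -> Comp c g -> Comp c (fun t => f t ^ g t).
Proof.
move=> bf bg cf cg; apply: (@Comp_eq _ _ _ _
  (fun t => iteri (g t) (fun _ a => a * f t) 1)) => [t _|].
  by elim: (g t) => //= m ->; rewrite expnSr.
apply: (@Comp_iteri _ nat c (fun _ a => a) g (fun=> 1) (fun t _ a => a * f t)) => //.
  exact: Comp_const.
apply: Comp_mul; last by apply: (@Comp_weak _ _ _ _ _ _ _ (fun y => f y.1)); exact: Comp_weak.
  by apply: (@Bdd_weak _ _ _ _ _ _ _ (fun y => f y.1)); exact: Bdd_weak.
exact: Comp_var.
Qed.

End Derived.

(** * Sets and lists coded as numbers *)

Definition bit (m v : nat) : bool := odd (iter v half m).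

Definition mask (n : nat) (p : pred nat) : nat := \sum_(i <- iota 0 n) p i * 2 ^ i.

Lemma iter_half v m : iter v half m = m %/ 2 ^ v.
Proof. by elim: v => [|v IH]; rewrite ?divn1 //= IH -divn2 -divnMA expnSr. Qed.

Lemma iter_double v m : iter v double m = 2 ^ v * m.
Proof. by elim: v => [|v IH]; rewrite ?mul1n //= IH -mul2n mulnA -expnS. Qed.

Lemma maskS n p : mask n.+1 p = p 0 + (mask n (fun i => p i.+1)).*2.
Proof.
rewrite /mask /= big_cons muln1 (iotaDl 1 0 n) big_map -mul2n big_distrr /=.
by congr addn; apply: eq_bigr => i _; rewrite add1n expnS mulnCA.
Qed.

Lemma bit_mask n p v : bit (mask n p) v = (v < n) && p v.
Proof.
elim: n p v => [|n IH] p v; first by rewrite /mask big_nil /bit iter_half div0n.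
rewrite maskS /bit; case: v => [|v]; first by rewrite /= oddD odd_double addbF; case: (p 0).
by rewrite iterSr half_bit_double -/(bit _ v) IH.
Qed.

Lemma mask_lt n p : mask n p < 2 ^ n.
Proof.
elim: n p => [|n IH] p; first by rewrite /mask big_nil.
rewrite maskS expnS; have := IH (fun i => p i.+1); case: (p 0); lia.
Qed.

Lemma bit0 v : bit 0 v = false.
Proof. by rewrite /bit iter_half div0n. Qed.

(** Base [2 ^ n.+1], least significant digit first, with a leading digit 1 that marks the end. *)
Definition encode (n : nat) (s : seq nat) : nat := foldr (fun x a => x + 2 ^ n.+1 * a) 1 s.

Definition fits (n : nat) (s : seq nat) : bool := all (fun x => x < 2 ^ n.+1) s.

Lemma encode_gt0 n s : 0 < encode n s.
Proof. by elim: s => //= x s IH; rewrite addn_gt0 muln_gt0 expn_gt0 IH orbT. Qed.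

Lemma encode_drop n s i : fits n s -> i <= size s -> encode n s %/ 2 ^ (i * n.+1) = encode n (drop i s).
Proof.
elim: s i => [|x s IH] [|i] //=; rewrite ?divn1 //.
case/andP => hx fs le; rewrite mulSn expnD divnMA [_ * encode _ _]mulnC addnC divnMDl ?expn_gt0 //.
by rewrite (divn_small hx) addn0 IH.
Qed.

Lemma encode_head n s i : fits n s -> i < size s ->
  let e := encode n (drop i s) in e - 2 ^ n.+1 * (e %/ 2 ^ n.+1) = nth 0 s i.
Proof.
move=> fs lt; rewrite (drop_nth 0) //=.
have hx : nth 0 s i < 2 ^ n.+1 by apply: (allP fs); exact: mem_nth.
by rewrite [_ * encode _ _]mulnC addnC divnMDl ?expn_gt0 // (divn_small hx) addn0 mulnC addKn.
Qed.

Lemma encode_cons_ge n x s : 2 ^ n.+1 <= encode n (x :: s).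
Proof. by rewrite /= (leq_trans _ (leq_addl _ _)) // leq_pmulr // encode_gt0. Qed.

(** Removes the newest variable from a goal whose function does not depend on it; unfolding contexts
    and projections makes this visible to matching. *)
Ltac weaken :=
  lazymatch goal with
  | |- ComputableB _ _ _ => unfold ComputableB
  | _ => idtac
  end;
  lazymatch goal with
  | |- @Computable _ _ (?A * ?U)%type _ ?F =>
    let G := eval cbn beta iota delta [fst snd ins ext2 ext extc sub] in (fun (y : A) (u : U) => F (y, u)) in
    lazymatch G with
    | (fun (y : A) (_ : U) => @?H y) => refine (@Comp_weak _ _ _ _ _ _ _ H _)
    end
  | |- @Bounded _ _ (?A * ?U)%type _ ?F =>
    let G := eval cbn beta iota delta [fst snd ins ext2 ext extc sub] in (fun (y : A) (u : U) => F (y, u)) in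
    lazymatch G with
    | (fun (y : A) (_ : U) => @?H y) => refine (@Bdd_weak _ _ _ _ _ _ _ H _)
    end
  end.

(** * Operations on coded lists *)

Section Lists.

Variables (R : realType) (B : growth).

Local Notation Comp := (@Computable R B _).
Local Notation CompB := (@ComputableB R B _).
Local Notation Bdd := (@Bounded R B _).
Local Notation ctx := (ctx R).

Lemma Bdd_size T (c : ctx T) : Bdd c (fun t => size_of (ins c t)).
Proof. by exists 1, 1 => t _; rewrite mul1n expn1; exact: grow_size. Qed.

Lemma Bdd_succ T (c : ctx T) f : Bdd c f -> Bdd c (fun t => (f t).+1).
Proof. by move=> bf; apply: (Bdd_le (Bdd_add bf (Bdd_const _ _ 1))) => t _; rewrite addn1. Qed.

Lemma Bdd_sub T (c : ctx T) P f : Bdd c f -> Bdd (sub c P) f.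
Proof. by move=> [K [D H]]; exists K, D => t [Pt _]; apply: H. Qed.

Lemma Bdd_exp T (c : ctx T) f D : Bdd c f -> Bdd c (fun t => f t ^ D).
Proof.
move=> bf; elim: D => [|D IH]; first exact: Bdd_const.
by apply: (Bdd_le (Bdd_mul bf IH)) => t _; rewrite expnS.
Qed.

Lemma Bdd_div T (c : ctx T) f g : Bdd c f -> Bdd c (fun t => f t %/ g t).
Proof. by move=> bf; apply: (Bdd_le bf) => t _; exact: leq_div. Qed.

Lemma Bdd_mod T (c : ctx T) f g : Bdd c f -> Bdd c (fun t => f t %% g t).
Proof. by move=> bf; apply: (Bdd_le bf) => t _; exact: leq_mod. Qed.

Lemma Bdd_subn T (c : ctx T) f g : Bdd c f -> Bdd c (fun t => f t - g t).
Proof. by move=> bf; apply: (Bdd_le bf) => t _; exact: leq_subr. Qed.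

Lemma Bdd_lt T (c : ctx T) m : Bdd c m -> Bdd (ext c (fun t i => i < m t)) (fun x => x.2).
Proof.
by move=> bm; apply: (@Bdd_le _ _ _ _ _ (fun x => m x.1)); [exact: Bdd_weak | move=> -[t i] [_ /= /ltnW]].
Qed.

Lemma Bdd_leq T (c : ctx T) m : Bdd c m -> Bdd (ext c (fun t i => i <= m t)) (fun x => x.2).
Proof.
by move=> bm; apply: (@Bdd_le _ _ _ _ _ (fun x => m x.1)); [exact: Bdd_weak | move=> -[t i] []].
Qed.

Lemma Comp_eqb T (c : ctx T) b1 b2 :
  CompB c b1 -> CompB c b2 -> CompB c (fun t => b1 t == b2 t).
Proof.
move=> c1 c2; apply: (@Comp_eq _ _ _ _ (fun t => nat_of_bool (nat_of_bool (b1 t) == nat_of_bool (b2 t)))).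
  by move=> t _; case: (b1 t); case: (b2 t).
exact: Comp_eqn.
Qed.

Lemma Comp_bit T (c : ctx T) f g : Bdd c g -> Comp c f -> Comp c g ->
  CompB c (fun t => bit (f t) (g t)).
Proof.
move=> bg cf cg; apply: Comp_odd; apply: Comp_iterc => //.
by move=> T' c' h; exact: Comp_half.
Qed.

Lemma Comp_mask T (c : ctx T) (m : T -> nat) (p : T -> nat -> bool) :
  Bdd c m -> Comp c m -> CompB (ext c (fun t i => i < m t)) (fun x => p x.1 x.2) ->
  Comp c (fun t => mask (m t) (p t)).
Proof.
move=> bm cm cp; apply: (@Comp_sum _ _ _ c m (fun t i => p t i * 2 ^ i)) => //.
apply: (@Comp_eq _ _ _ _ (fun x => 2 ^ x.2 * p x.1 x.2)) => [t _|]; first exact: mulnC.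
apply: Comp_mul => //.
  by apply: (Bdd_le (Bdd_const _ _ 1)) => t _; exact: leq_b1.
apply: Comp_exp; [exact: Bdd_const | exact: Bdd_lt | exact: Comp_const | exact: Comp_var].
Qed.

Definition CompL T (c : ctx T) (s : T -> seq nat) := Comp c (fun t => encode (size_of (ins c t)) (s t)).

Lemma Comp_nil T (c : ctx T) : CompL c (fun=> [::]).
Proof. exact: Comp_const. Qed.

Lemma Comp_cons T (c : ctx T) f s : Comp c f -> CompL c s -> CompL c (fun t => f t :: s t).
Proof.
move=> cf cs; apply: (@Comp_eq _ _ _ _
  (fun t => f t + iter (size_of (ins c t)).+1 double (encode (size_of (ins c t)) (s t)))) => [t _|].
  by rewrite iter_double.
apply: Comp_add => //; apply: Comp_iterc => //.
- by apply: Bdd_succ; exact: Bdd_size.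
- by apply: Comp_succ; exact: Comp_size.
- by move=> T' c' h; exact: Comp_double.
Qed.

Let shift T (c : ctx T) s i :=
  fun t => iter (i t * (size_of (ins c t)).+1) half (encode (size_of (ins c t)) (s t)).

Lemma Comp_shift T (c : ctx T) s i :
  Bdd c i -> CompL c s -> Comp c i -> Comp c (shift c s i).
Proof.
move=> bi cs ci; apply: Comp_iterc => //.
- by apply: Bdd_mul => //; apply: Bdd_succ; exact: Bdd_size.
- apply: Comp_mul => //; last by apply: Comp_succ; exact: Comp_size.
  by apply: Bdd_succ; exact: Bdd_size.
- by move=> T' c' h; exact: Comp_half.
Qed.

Lemma Comp_nth T (c : ctx T) s i : Bdd c i -> CompL c s -> Comp c i ->
  (forall t, dom c t -> fits (size_of (ins c t)) (s t) /\ i t < size (s t)) ->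
  Comp c (fun t => nth 0 (s t) (i t)).
Proof.
move=> bi cs ci fs; apply: (@Comp_eq _ _ _ _ (fun t => shift c s i t -
  iter (size_of (ins c t)).+1 double (iter (size_of (ins c t)).+1 half (shift c s i t)))) => [t Pt|].
  have [ft lt] := fs t Pt.
  rewrite /shift iter_double [iter _ _ (iter _ _ _)]iter_half iter_half.
  by rewrite (encode_drop ft (ltnW lt)) (encode_head ft).
have csh := Comp_shift bi cs ci.
have bn := Bdd_succ (Bdd_size c); have cn := Comp_succ (Comp_size B c).
apply: Comp_subn => //; apply: Comp_iterc => //; last by move=> T' c' h; exact: Comp_double.
by apply: Comp_iterc => //; move=> T' c' h; exact: Comp_half.
Qed.

(** The leading digit 1 makes the end visible: with [i] entries shifted out, the code is at least
    $2^{n+1}$ while entries remain, and it is 1 at the end. This test controls the loop. *)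
Lemma Comp_length T (c : ctx T) s : Bdd c (fun t => size (s t)) -> CompL c s ->
  (forall t, dom c t -> fits (size_of (ins c t)) (s t)) ->
  Comp c (fun t => size (s t)).
Proof.
move=> bs cs fs.
apply: (@Comp_eq _ _ _ _ (fun t => iteri (size (s t)) (fun _ a => a.+1) 0)) => [t _|].
  by elim: (size (s t)) => //= m ->.
apply: (@Comp_loop _ _ _ _ _ (fun _ a => a) (fun t i _ => i <= size (s t)) _ (fun=> 0) (fun _ _ a => a.+1)
  (fun t i _ => iter (size_of (ins c t)).+1 double 1 <= shift c s (fun=> i) t)) => //.
- exact: Comp_const.
- by apply: Comp_succ; exact: Comp_var.
- apply: Comp_leq.
    do 2!weaken.
    apply: Comp_iterc; [exact: Bdd_succ (Bdd_size c)|exact: Comp_succ (Comp_size B c)|exact: Comp_const|].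
    by move=> T' c' h; exact: Comp_double.
  apply: (@Comp_shift _ _ (fun x => s x.1.1) (fun x => x.1.2)).
  + apply: (@Bdd_le _ _ _ _ _ (fun x => size (s x.1.1))).
      by do 2!weaken.
    by move=> [[t i] a] /= [_].
  + by rewrite /CompL; do 2!weaken.
  + by weaken; exact: Comp_var.
- move=> t i Pt le a; split => //; rewrite iter_double muln1 /shift iter_half encode_drop ?fs //.
  move: le; rewrite leq_eqVlt => /orP[/eqP ->|lt].
    by rewrite drop_size ltnn /= leqNgt -{1}(expn0 2) ltn_exp2l.
  by rewrite lt (drop_nth 0) // encode_cons_ge.
Qed.

Lemma Comp_foldl T U (c : ctx T) (cd : T -> U -> nat) (s : T -> seq nat)
    (z : T -> U) (f : T -> U -> nat -> U) :
  CompL c s -> Bdd c (fun t => size (s t)) ->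
  (forall t, dom c t -> fits (size_of (ins c t)) (s t)) ->
  Comp c (fun t => cd t (z t)) ->
  Comp (ext (ext2 c (fun t => size (s t)) cd (fun t i a => a = foldl (f t) (z t) (take i (s t)) /\ i < size (s t)))
        (fun y x => x = nth 0 (s y.1.1) y.1.2))
    (fun y => cd y.1.1.1 (f y.1.1.1 y.1.2 y.2)) ->
  Comp c (fun t => cd t (foldl (f t) (z t) (s t))).
Proof.
move=> cs bs fs cz cf.
have fE t i : i <= size (s t) ->
    iteri i (fun j a => f t a (nth 0 (s t) j)) (z t) = foldl (f t) (z t) (take i (s t)).
  elim: i => [|i IH] le; first by rewrite take0.
  by rewrite (take_nth 0) // -cats1 foldl_cat /= IH // ltnW.
apply: (@Comp_eq _ _ _ _ (fun t => cd t
   (iteri (size (s t)) (fun j a => f t a (nth 0 (s t) j)) (z t)))) => [t _|].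
  by rewrite fE // take_size.
apply: (@Comp_iteri _ _ _ U c cd (fun t => size (s t)) z (fun t j a => f t a (nth 0 (s t) j))) => //.
  exact: Comp_length.
apply: (@Comp_let _ _ _ _ _ (fun _ x => x) (fun y => nth 0 (s y.1.1) y.1.2)
  (fun y x => cd y.1.1 (f y.1.1 y.2 x))).
  apply: Comp_nth.
  - apply: (@Bdd_le _ _ _ _ _ (fun x => size (s x.1.1))).
      by do 2!weaken.
    by move=> [[t i] a] /= [_ [_ /ltnW]].
  - by rewrite /CompL; do 2!weaken.
  - by weaken; exact: Comp_var.
  - by move=> [[t i] a] /= [[Pt _] [_ lt]]; split => //; exact: fs.
apply: Comp_narrow cf => -[[[t i] a] x] /= [[Pt [-> lt]] ->]; split => //; split => //.
by split => //; rewrite fE // ltnW.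
Qed.

Lemma Comp_hasl T (c : ctx T) (s : T -> seq nat) (p : T -> nat -> bool) :
  CompL c s -> Bdd c (fun t => size (s t)) ->
  (forall t, dom c t -> fits (size_of (ins c t)) (s t)) ->
  CompB (ext (ext2 c (fun t => size (s t)) (fun _ => nat_of_bool) (fun t i _ => i < size (s t)))
        (fun y x => x = nth 0 (s y.1.1) y.1.2)) (fun y => p y.1.1.1 y.2) ->
  CompB c (fun t => has (p t) (s t)).
Proof.
move=> cs bs fs cp; apply: (@Comp_eq _ _ _ _
  (fun t => nat_of_bool (foldl (fun a x => a || p t x) false (s t)))) => [t _|].
  by rewrite has_foldl.
apply: (@Comp_foldl _ bool c (fun _ => nat_of_bool) s (fun=> false) (fun t a x => a || p t x)) => //.
  exact: Comp_const.
apply: Comp_orb.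
  by weaken; exact: Comp_var.
apply: Comp_sub; apply: Comp_narrow cp => -[[[t i] a] x] /= [[Pt [_ lt]] ->].
by split.
Qed.

End Lists.

(** The extra tactic [tac] treats the functions of the algorithm that are known to be computable. *)
Ltac comp_with tac :=
  lazymatch goal with
  | |- ComputableB _ _ _ => unfold ComputableB
  | _ => idtac
  end;
  first
  [ assumption
  | lazymatch goal with |- Bounded _ (sub _ _) _ => refine (Bdd_sub _ _) | |- Computable _ (sub _ _) _ => refine (Comp_sub _ _) end
  | weaken
  | refine (Comp_var _ _ _ _)
  | refine (@Bdd_lt _ _ _ _ _ _)
  | refine (@Bdd_leq _ _ _ _ _ _)
  | lazymatch goal with
    | |- Computable _ _ (fun x => addn (@?f x) (@?g x)) => refine (@Comp_add _ _ _ _ f g _ _)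
    | |- Computable _ _ (fun x => subn (@?f x) (@?g x)) => refine (@Comp_subn _ _ _ _ f g _ _)
    | |- Computable _ _ (fun x => muln (@?f x) (@?g x)) => refine (@Comp_mul _ _ _ _ f g _ _ _)
    | |- Computable _ _ (fun x => expn (@?f x) (@?g x)) => refine (@Comp_exp _ _ _ _ f g _ _ _ _)
    | |- Computable _ _ (fun x => divn (@?f x) (@?g x)) => refine (@Comp_div _ _ _ _ f g _ _ _)
    | |- Computable _ _ (fun x => modn (@?f x) (@?g x)) => refine (@Comp_mod _ _ _ _ f g _ _ _)
    | |- Computable _ _ (fun x => S (@?f x)) => refine (@Comp_succ _ _ _ _ f _)
    | |- Computable _ _ (fun x => size_of (@?f x)) => refine (Comp_size _ _)
    | |- Computable _ _ (fun x => param_of (@?f x)) => refine (Comp_param _ _)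
    | |- Computable _ _ (fun x => nat_of_bool (andb (@?f x) (@?g x))) => refine (@Comp_andb _ _ _ _ f g _ _)
    | |- Computable _ _ (fun x => nat_of_bool (orb (@?f x) (@?g x))) => refine (@Comp_orb _ _ _ _ f g _ _)
    | |- Computable _ _ (fun x => nat_of_bool (implb (@?f x) (@?g x))) => refine (@Comp_implb _ _ _ _ f g _ _)
    | |- Computable _ _ (fun x => nat_of_bool (negb (@?f x))) => refine (@Comp_negb _ _ _ _ f _)
    | |- Computable _ _ (fun x => nat_of_bool (leq (S (@?f x)) (@?g x))) => refine (@Comp_ltn _ _ _ _ f g _ _)
    | |- Computable _ _ (fun x => nat_of_bool (leq (@?f x) (@?g x))) => refine (@Comp_leq _ _ _ _ f g _ _)
    | |- Computable _ _ (fun x => nat_of_bool (@eq_op Datatypes_nat__canonical__eqtype_Equality (@?f x) (@?g x))) => refine (@Comp_eqn _ _ _ _ f g _ _)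
    | |- Computable _ _ (fun x => nat_of_bool (@eq_op Datatypes_bool__canonical__eqtype_Equality (@?f x) (@?g x))) => refine (@Comp_eqb _ _ _ _ f g _ _)
    | |- Computable _ _ (fun x => nat_of_bool (bit (@?f x) (@?g x))) => refine (@Comp_bit _ _ _ _ f g _ _ _)
    | |- Computable _ _ (fun x => nat_of_bool (has (@?p x) (iota 0 (@?m x)))) => refine (@Comp_has _ _ _ _ m p _ _ _)
    | |- Computable _ _ (fun x => nat_of_bool (all (@?p x) (iota 0 (@?m x)))) => refine (@Comp_all _ _ _ _ m p _ _ _)
    | |- Computable _ _ (fun x => count (@?p x) (iota 0 (@?m x))) => refine (@Comp_count _ _ _ _ m p _ _ _)
    | |- Computable _ _ (fun x => find (@?p x) (iota 0 (@?m x))) => refine (@Comp_find _ _ _ _ m p _ _ _)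
    | |- Computable _ _ (fun x => mask (@?m x) (@?p x)) => refine (@Comp_mask _ _ _ _ m p _ _ _)
    | |- Computable _ _ (fun x => if @?b x then _ else _) => apply: Comp_if
    | |- Bounded _ _ (fun x => addn (@?f x) (@?g x)) => apply: Bdd_add
    | |- Bounded _ _ (fun x => muln (@?f x) (@?g x)) => apply: Bdd_mul
    | |- Bounded _ _ (fun x => subn (@?f x) (@?g x)) => apply: Bdd_subn
    | |- Bounded _ _ (fun x => divn (@?f x) (@?g x)) => apply: Bdd_div
    | |- Bounded _ _ (fun x => modn (@?f x) (@?g x)) => apply: Bdd_mod
    | |- Bounded _ _ (fun x => S (@?f x)) => apply: Bdd_succ
    | |- Bounded _ _ (fun x => expn (@?f x) _) => apply: Bdd_exp
    | |- Bounded _ _ (fun x => size_of (@?f x)) => refine (Bdd_size _ _)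
    | |- Bounded _ _ (fun x => ?a) => refine (Bdd_const _ _ a)
    | |- Computable _ _ (fun x => ?a) => refine (Comp_const _ _ a)
    end
  | tac ()]; cbn beta.

(** * The algorithm *)

(** [d]-tuples of vertices are coded by their base-[n] value, sets of vertices by bit masks;
    [am] is the mask of the vertices that may be used. *)
Section Algorithm.

Variables (R : realType) (d : nat).
Implicit Types I : instance R.

Definition adj I i j : bool := (i != j) && close I i j.

(** The points that end a chain of points in which coordinate [a] increases [r] times by more
    than 1/2. *)
Definition layer a I r :=
  iter r (fun m => mask (size_of I) (fun i => has (fun j => bit m j && gap a I j i) (iota 0 (size_of I))))
    (mask (size_of I) xpredT).

(** This plays the role of the row or column in a grid of mesh 1/2; it needs no rounding. *)
Definition level a I i := count (fun r => bit (layer a I r.+1) i) (iota 0 (size_of I)).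

Definition digit b t j := (t %/ b ^ j) %% b.

Definition same_cell I u v := (level 0 I u == level 0 I v) && (level 1 I u == level 1 I v).

Definition cycle_code I am t :=
  all (fun i => [&& bit am (digit (size_of I) t i),
      adj I (digit (size_of I) t i) (digit (size_of I) t (i.+1 %% d)) &
      all (fun j => (i < j) ==> (digit (size_of I) t i != digit (size_of I) t j)) (iota 0 d)]) (iota 0 d).

Definition on I t v := has (fun j => digit (size_of I) t j == v) (iota 0 d).

Definition meets I t m := has (fun j => bit m (digit (size_of I) t j)) (iota 0 d).

Definition add_tuple I t m := mask (size_of I) (fun v => bit m v || on I t v).

Definition greedy I am :=
  foldl (fun g t => if cycle_code I am t && ~~ meets I t g then add_tuple I t g else g) 0
    (iota 0 (size_of I ^ d)).

Definition same_pattern I t t' :=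
  all (fun j => same_cell I (digit (size_of I) t j) (digit (size_of I) t' j)) (iota 0 d).

(** A cycle that shares a cell with a given one has all its cells within $4d + 2d$ of the start of
    the given one, in a window of $(12d+1)^2$ cells. With at most [d] cycles for each of the
    [d]-letter patterns over this window, and [d] vertices on each, this bounds the number of
    vertices that a substitute for the given cycle must avoid. *)
Definition capacity := ((12 * d).+1 ^ 2) ^ d * d * d.

(** [y] codes a set of at most [capacity] vertices in base [n.+1], the digit [n] standing for no vertex. *)
Definition hits I y t :=
  has (fun i => has (fun j => digit (size_of I) t i == digit (size_of I).+1 y j) (iota 0 capacity)) (iota 0 d).

(** Only cycles that are first, among those with their pattern, to avoid some small set matter. *)
Definition marked I am t :=
  cycle_code I am t && has (fun y => ~~ hits I y t &&
    all (fun t' => cycle_code I am t' && same_pattern I t' t ==> hits I y t') (iota 0 t))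
    (iota 0 ((size_of I).+1 ^ capacity)).

(** It exceeds the number of tuples, so a period of this length has a shift that selects no marked
    cycle at all; longer periods would gain nothing. *)
Definition radix I := (size_of I ^ d).+1.

(** The configuration [c] codes a period [l] and a shift. Cycles that start in a block of [4 * d] rows
    selected by them have key 0; the others are ordered by strip, then by column. *)
Definition key I c t :=
  let s := level 1 I (digit (size_of I) t 0) %/ (4 * d) + c %% radix I in
  let l := (c %/ radix I).+1 in
  if s %% l == 0 then 0 else (s %/ l) * (size_of I).+1 + (level 0 I (digit (size_of I) t 0)).+1.

(** The position [key * n ^ d + t] of a cycle [t] refines the order given by its key. *)
Definition code_of I p := p %% size_of I ^ d.

Definition good I am c p :=
  marked I am (code_of I p) && (key I c (code_of I p) == p %/ size_of I ^ d).

Definition npos I := (size_of I + radix I + 2) * (size_of I).+1 * size_of I ^ d.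

Definition touch I t v := has (fun j => same_cell I (digit (size_of I) t j) v) (iota 0 d).

(** A later cycle lowers the number of free vertices in every cell that it meets, and this number
    decides how many cycles still fit into the cell. Hence whole cells count as pending, not just
    the vertices of later cycles. *)
Definition pending I am c p v :=
  has (fun p' => [&& p < p', good I am c p' & touch I (code_of I p') v]) (iota 0 (npos I)).

Definition covered I am c p v :=
  has (fun p' => [&& p' <= p, good I am c p' & on I (code_of I p') v]) (iota 0 (npos I)).

(** A state contains only covered vertices, and only the pending ones enter its key; so this bounds
    the number of bits in which keys at the same position can differ. *)
Definition width I am c :=
  \max_(p <- iota 0 (npos I)) count (fun v => covered I am c p v && pending I am c p v) (iota 0 (size_of I)).

Definition best I am :=
  foldl (fun b c => if width I am c < width I am b then c else b) 0 (iota 0 (radix I * radix I)).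

Definition free_in I am m a b v := [&& bit am v, ~~ bit m v, level 0 I v == a & level 1 I v == b].

Definition fval I am m :=
  count (bit m) (iota 0 (size_of I)) %/ d +
  \sum_(a <- iota 0 (size_of I).+1) \sum_(b <- iota 0 (size_of I).+1)
    count (free_in I am m a b) (iota 0 (size_of I)) %/ d.

(** Two states with the same key can be completed in the same ways, with the same gain. *)
Definition same_key I am c p m m' :=
  (fval I am m == fval I am m') &&
  all (fun v => pending I am c p v ==> (bit m v == bit m' v)) (iota 0 (size_of I)).

Definition insert I am c p m acc :=
  if has (same_key I am c p m) acc then acc else m :: acc.

Definition absorb I am c p acc m :=
  let acc1 := insert I am c p m acc in
  if meets I (code_of I p) m then acc1
  else insert I am c p (add_tuple I (code_of I p) m) acc1.

Definition dp_step I am c p T := foldl (absorb I am c p) [::] T.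

Definition dp_table I am c i :=
  foldl (fun T p => if good I am c p then dp_step I am c p T else T) [:: 0] (iota 0 i).

(** The first disjunct is more than a shortcut: the tables are known to be small only if the greedy
    packing has fewer than [k] cycles. *)
Definition decide I am k :=
  (d * k <= count (bit (greedy I am)) (iota 0 (size_of I))) ||
  has (fun m => k <= fval I am m) (dp_table I am (best I am) (npos I)).

Definition vertices I t := mkseq (digit (size_of I) t) d.

Definition remaining I (acc : seq nat) := mask (size_of I) (fun v => v \notin acc).

Definition pick_cycle I k acc :=
  find (fun t => cycle_code I (remaining I acc) t && decide I (remaining I (vertices I t ++ acc)) k)
    (iota 0 (size_of I ^ d)).

Definition solution I :=
  iteri (param_of I) (fun i acc => vertices I (pick_cycle I (param_of I - i.+1) acc) ++ acc) [::].

(** * Computability of the algorithm *)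

Variable B : growth.

Local Notation Comp := (@Computable R B _).
Local Notation CompB := (@ComputableB R B _).
Local Notation Bdd := (@Bounded R B _).
Local Notation ctx := (ctx R).

Ltac comp := do ?[progress (comp_with ltac:(fun _ => fail))].

Lemma Comp_adj T (c : ctx T) f g : Comp c f -> Comp c g ->
  CompB c (fun t => adj (ins c t) (f t) (g t)).
Proof.
move=> cf cg; rewrite /adj; apply: Comp_andb; first by comp.
by apply: Comp_sub; apply: Comp_close.
Qed.

Lemma Comp_layer a T (c : ctx T) r : Bdd c r -> Comp c r ->
  Comp c (fun t => layer a (ins c t) (r t)).
Proof.
move=> br cr; apply: (@Comp_eq _ _ _ _ (fun t => iteri (r t) (fun _ m => mask (size_of (ins c t))
   (fun i => has (fun j => bit m j && gap a (ins c t) j i) (iota 0 (size_of (ins c t)))))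
    (mask (size_of (ins c t)) xpredT))) => [t _|].
  by rewrite /layer; elim: (r t) => //= m ->.
apply: (@Comp_iteri _ _ _ nat c (fun _ a => a) r (fun t => mask (size_of (ins c t)) xpredT)
 (fun t _ m => mask (size_of (ins c t))
   (fun i => has (fun j => bit m j && gap a (ins c t) j i) (iota 0 (size_of (ins c t)))))) => //.
  by comp.
comp.
by apply: Comp_gap; comp.
Qed.

Lemma Comp_level a T (c : ctx T) f : Bdd c f -> Comp c f ->
  Comp c (fun t => level a (ins c t) (f t)).
Proof. by move=> bf cf; rewrite /level; comp; apply: Comp_layer; comp. Qed.

Lemma Bdd_level a T (c : ctx T) f : Bdd c (fun t => level a (ins c t) (f t)).
Proof.
apply: (Bdd_le (Bdd_size B c)) => t _.
by rewrite /level -[leqRHS](size_iota 0) count_size.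
Qed.

Lemma Comp_digit T (c : ctx T) b f j : Bdd c b -> Bdd c f -> Bdd c j -> Comp c b -> Comp c f ->
  Comp c j -> Comp c (fun t => digit (b t) (f t) (j t)).
Proof. by move=> *; rewrite /digit; comp. Qed.

Lemma Bdd_digit T (c : ctx T) b f j : Bdd c f -> Bdd c (fun t => digit (b t) (f t) (j t)).
Proof. by move=> *; rewrite /digit; comp. Qed.


Ltac tac1 _ :=
  lazymatch goal with
  | |- Bounded _ _ (fun x => level _ (@?f x) (@?g x)) => refine (Bdd_level _ _ _)
  | |- Bounded _ _ (fun x => digit (@?f x) (@?g x) (@?h x)) => refine (@Bdd_digit _ _ f g h _)
  | |- Computable _ _ (fun x => level _ (@?f x) (@?g x)) => refine (@Comp_level _ _ _ g _ _)
  | |- Computable _ _ (fun x => digit (@?f x) (@?g x) (@?h x)) => refine (@Comp_digit _ _ f g h _ _ _ _ _ _)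
  | |- Computable _ _ (fun x => nat_of_bool (adj (@?f x) (@?g x) (@?h x))) => refine (@Comp_adj _ _ g h _ _)
  end.
Ltac comp1 := do ?[progress (comp_with tac1)].

Lemma Comp_same_cell T (c : ctx T) f g : Bdd c f -> Comp c f -> Bdd c g -> Comp c g ->
  CompB c (fun t => same_cell (ins c t) (f t) (g t)).
Proof. by move=> *; rewrite /same_cell; comp1. Qed.

Lemma Comp_cycle_code T (c : ctx T) am f : Comp c am -> Bdd c f -> Comp c f ->
  CompB c (fun t => cycle_code (ins c t) (am t) (f t)).
Proof. by move=> *; rewrite /cycle_code; comp1. Qed.

Lemma Comp_on T (c : ctx T) f g : Bdd c f -> Comp c f -> Comp c g ->
  CompB c (fun t => on (ins c t) (f t) (g t)).
Proof. by move=> *; rewrite /on; comp1. Qed.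

Lemma Comp_meets T (c : ctx T) f g : Bdd c f -> Comp c f -> Comp c g ->
  CompB c (fun t => meets (ins c t) (f t) (g t)).
Proof. by move=> *; rewrite /meets; comp1. Qed.

Lemma Comp_hits T (c : ctx T) f g : Bdd c f -> Comp c f -> Bdd c g -> Comp c g ->
  CompB c (fun t => hits (ins c t) (f t) (g t)).
Proof. by move=> *; rewrite /hits; comp1. Qed.

Ltac tac2 u :=
  lazymatch goal with
  | |- Computable _ _ (fun x => nat_of_bool (same_cell (@?f x) (@?g x) (@?h x))) =>
    refine (@Comp_same_cell _ _ g h _ _ _ _)
  | |- Computable _ _ (fun x => nat_of_bool (cycle_code (@?f x) (@?g x) (@?h x))) =>
    refine (@Comp_cycle_code _ _ g h _ _ _)
  | |- Computable _ _ (fun x => nat_of_bool (on (@?f x) (@?g x) (@?h x))) =>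
    refine (@Comp_on _ _ g h _ _ _)
  | |- Computable _ _ (fun x => nat_of_bool (meets (@?f x) (@?g x) (@?h x))) =>
    refine (@Comp_meets _ _ g h _ _ _)
  | |- Computable _ _ (fun x => nat_of_bool (hits (@?f x) (@?g x) (@?h x))) =>
    refine (@Comp_hits _ _ g h _ _ _ _)
  | _ => tac1 u
  end.
Ltac comp2 := do ?[progress (comp_with tac2)].

Lemma Comp_add_tuple T (c : ctx T) f g : Bdd c f -> Comp c f -> Comp c g ->
  Comp c (fun t => add_tuple (ins c t) (f t) (g t)).
Proof. by move=> *; rewrite /add_tuple; comp2. Qed.

Lemma Comp_same_pattern T (c : ctx T) f g : Bdd c f -> Comp c f -> Bdd c g -> Comp c g ->
  CompB c (fun t => same_pattern (ins c t) (f t) (g t)).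
Proof. by move=> *; rewrite /same_pattern; comp2. Qed.

Lemma Comp_touch T (c : ctx T) f g : Bdd c f -> Comp c f -> Bdd c g -> Comp c g ->
  CompB c (fun t => touch (ins c t) (f t) (g t)).
Proof. by move=> *; rewrite /touch; comp2. Qed.

Ltac tac3 u :=
  lazymatch goal with
  | |- Computable _ _ (fun x => nat_of_bool (same_pattern (@?f x) (@?g x) (@?h x))) =>
    refine (@Comp_same_pattern _ _ g h _ _ _ _)
  | |- Computable _ _ (fun x => nat_of_bool (touch (@?f x) (@?g x) (@?h x))) =>
    refine (@Comp_touch _ _ g h _ _ _ _)
  | |- Computable _ _ (fun x => add_tuple (@?f x) (@?g x) (@?h x)) =>
    refine (@Comp_add_tuple _ _ g h _ _ _)
  | _ => tac2 u
  end.
Ltac comp3 := do ?[progress (comp_with tac3)].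

Lemma Comp_greedy T (c : ctx T) am : Comp c am ->
  Comp c (fun t => greedy (ins c t) (am t)).
Proof.
move=> ca; rewrite /greedy.
apply: (@Comp_foldl_iota _ _ _ nat c (fun _ a => a) (fun t => size_of (ins c t) ^ d) (fun=> 0)
  (fun t g p => if cycle_code (ins c t) (am t) p && ~~ meets (ins c t) p g then add_tuple (ins c t) p g else g)).
- by comp3.
- by comp3.
- by comp3.
by apply: Comp_if'; comp3.
Qed.

Lemma Comp_marked T (c : ctx T) am f : Comp c am -> Bdd c f -> Comp c f ->
  CompB c (fun t => marked (ins c t) (am t) (f t)).
Proof. by move=> *; rewrite /marked; comp3. Qed.

Lemma Comp_key T (c : ctx T) g f : Bdd c g -> Comp c g -> Bdd c f -> Comp c f ->
  Comp c (fun t => key (ins c t) (g t) (f t)).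
Proof. by move=> *; rewrite /key /radix /=; comp3. Qed.

Lemma Comp_good T (c : ctx T) am g f : Comp c am -> Bdd c g -> Comp c g -> Bdd c f -> Comp c f ->
  CompB c (fun t => good (ins c t) (am t) (g t) (f t)).
Proof.
move=> *; rewrite /good /code_of; apply: Comp_andb; first by apply: Comp_marked; comp3.
by apply: Comp_sub; apply: Comp_eqn; first apply: Comp_key; comp3.
Qed.

Ltac tac4 u :=
  lazymatch goal with
  | |- Computable _ _ (fun x => nat_of_bool (marked (@?f x) (@?g x) (@?h x))) =>
    refine (@Comp_marked _ _ g h _ _ _)
  | |- Computable _ _ (fun x => nat_of_bool (good (@?f x) (@?g x) (@?h x) (@?k x))) =>
    refine (@Comp_good _ _ g h k _ _ _ _ _)
  | _ => tac3 u
  end.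
Ltac comp4 := do ?[progress (comp_with tac4)].

Lemma Comp_pending T (c : ctx T) am g p f : Comp c am -> Bdd c g -> Comp c g -> Bdd c p -> Comp c p ->
  Bdd c f -> Comp c f ->
  CompB c (fun t => pending (ins c t) (am t) (g t) (p t) (f t)).
Proof. by move=> *; rewrite /pending /npos /radix /code_of; comp4. Qed.

Lemma Comp_covered T (c : ctx T) am g p f : Comp c am -> Bdd c g -> Comp c g -> Bdd c p -> Comp c p ->
  Bdd c f -> Comp c f ->
  CompB c (fun t => covered (ins c t) (am t) (g t) (p t) (f t)).
Proof. by move=> *; rewrite /covered /npos /radix /code_of; comp4. Qed.

Ltac tac5 u :=
  lazymatch goal with
  | |- Computable _ _ (fun x => nat_of_bool (pending (@?f x) (@?g x) (@?h x) (@?k x) (@?l x))) =>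
    refine (@Comp_pending _ _ g h k l _ _ _ _ _ _ _)
  | |- Computable _ _ (fun x => nat_of_bool (covered (@?f x) (@?g x) (@?h x) (@?k x) (@?l x))) =>
    refine (@Comp_covered _ _ g h k l _ _ _ _ _ _ _)
  | |- Bounded _ _ (fun x => npos _) => rewrite /npos /radix
  | |- Computable _ _ (fun x => npos _) => rewrite /npos /radix
  | _ => tac4 u
  end.
Ltac comp5 := do ?[progress (comp_with tac5)].

Lemma Bdd_npos T (c : ctx T) : Bdd c (fun t => npos (ins c t)).
Proof. by rewrite /npos /radix; comp4. Qed.

Lemma Comp_npos T (c : ctx T) : Comp c (fun t => npos (ins c t)).
Proof. by rewrite /npos /radix; comp4. Qed.

Lemma Comp_width T (c : ctx T) am g : Comp c am -> Bdd c g -> Comp c g ->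
  Comp c (fun t => width (ins c t) (am t) (g t)).
Proof.
move=> *; rewrite /width.
apply: (@Comp_max _ _ _ c (fun t => npos (ins c t)) (fun t p =>
  count (fun v => covered (ins c t) (am t) (g t) p v && pending (ins c t) (am t) (g t) p v)
    (iota 0 (size_of (ins c t))))); [exact: Bdd_npos | exact: Comp_npos | by comp5].
Qed.

Lemma best_lt I am : best I am <= radix I * radix I.
Proof.
rewrite /best; set f := fun b c => _.
suff H s b : b <= radix I * radix I -> {subset s <= iota 0 (radix I * radix I)} ->
    foldl f b s <= radix I * radix I by exact: H.
elim: s b => //= x s IH b hb hs; apply: IH => [|y ys]; last by apply: hs; rewrite inE ys orbT.
have : x \in iota 0 (radix I * radix I) by apply: hs; rewrite inE eqxx.
by rewrite mem_iota add0n => /ltnW; rewrite /f; case: ifP.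
Qed.

Lemma Bdd_best T (c : ctx T) am : Bdd c (fun t => best (ins c t) (am t)).
Proof.
apply: (@Bdd_le _ _ _ _ _ (fun t => radix (ins c t) * radix (ins c t))).
  by rewrite /radix; comp4.
by move=> t _; exact: best_lt.
Qed.

Lemma Comp_best T (c : ctx T) am : Comp c am -> Comp c (fun t => best (ins c t) (am t)).
Proof.
move=> ca; rewrite /best.
have br : Bdd c (fun t => radix (ins c t) * radix (ins c t)) by rewrite /radix; comp4.
apply: (@Comp_foldl_iota _ _ _ nat c (fun _ a => a) (fun t => radix (ins c t) * radix (ins c t))
  (fun=> 0) (fun t b g => if width (ins c t) (am t) g < width (ins c t) (am t) b then g else b)) => //.
- by rewrite /radix; comp4.
- by comp4.
match goal with |- Computable _ ?c2 _ => have bb : Bdd c2 (fun x => x.2) end.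
  apply: (@Bdd_le _ _ _ _ _ (fun x => x.1.2)); first by comp5.
  move=> -[[t i] a] /= [_ [-> _]].
  set f := fun b c => _.
  suff H m : foldl f 0 (iota 0 m) <= m by exact: H.
  elim: m => // m IH; rewrite -addn1 iotaD foldl_cat /= {1}/f; case: ifP => _; first by lia.
  by rewrite (leq_trans IH) ?leq_addr.
apply: Comp_if'; [|by comp5|by comp5].
by apply: Comp_ltn; apply: Comp_width; comp5.
Qed.

Lemma Comp_fval T (c : ctx T) am m : Comp c am -> Comp c m ->
  Comp c (fun t => fval (ins c t) (am t) (m t)).
Proof.
move=> *; rewrite /fval; apply: Comp_add.
  apply: Comp_div; [|by comp5|by comp5].
  by apply: (Bdd_le (Bdd_size B c)) => t _; rewrite -[leqRHS](size_iota 0) count_size.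
apply: (@Comp_sum _ _ _ c (fun t => (size_of (ins c t)).+1) (fun t a =>
  \sum_(b <- iota 0 (size_of (ins c t)).+1)
    count (free_in (ins c t) (am t) (m t) a b) (iota 0 (size_of (ins c t))) %/ d)); [by comp5|by comp5|].
set c1 := ext _ _.
apply: (@Comp_sum _ _ _ c1 (fun x => (size_of (ins c1 x)).+1) (fun x b =>
    count (free_in (ins c1 x) (am x.1) (m x.1) x.2 b) (iota 0 (size_of (ins c1 x))) %/ d)); [by comp5|by comp5|].
rewrite /free_in /c1; apply: Comp_div; [|by comp5|by comp5].
by apply: (Bdd_le (Bdd_size B _)) => t _ /=; rewrite -[leqRHS](size_iota 0) count_size.
Qed.

Ltac tac6 u :=
  lazymatch goal with
  | |- Computable _ _ (fun x => fval (@?f x) (@?g x) (@?h x)) => refine (@Comp_fval _ _ g h _ _)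
  | |- Computable _ _ (fun x => best (@?f x) (@?g x)) => refine (@Comp_best _ _ g _)
  | |- Bounded _ _ (fun x => best (@?f x) (@?g x)) => refine (@Bdd_best _ _ g)
  | |- Computable _ _ (fun x => npos _) => refine (@Comp_npos _ _)
  | |- Bounded _ _ (fun x => npos _) => refine (@Bdd_npos _ _)
  | _ => tac5 u
  end.
Ltac comp6 := do ?[progress (comp_with tac6)].

Lemma Comp_same_key T (c : ctx T) am g p m m' : Comp c am -> Bdd c g -> Comp c g ->
  Bdd c p -> Comp c p -> Comp c m -> Comp c m' ->
  CompB c (fun t => same_key (ins c t) (am t) (g t) (p t) (m t) (m' t)).
Proof. by move=> *; rewrite /same_key; comp6. Qed.


Ltac tac7 u :=
  lazymatch goal with
  | |- Computable _ _ (fun x => nat_of_bool (same_key (@?f x) (@?g x) (@?h x) (@?k x) (@?l x) (@?m x))) =>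
    refine (@Comp_same_key _ _ g h k l m _ _ _ _ _ _ _)
  | _ => tac6 u
  end.
Ltac comp7 := do ?[progress (comp_with tac7)].

Lemma size_insert I am g p m acc : size (insert I am g p m acc) <= (size acc).+1.
Proof. by rewrite /insert; case: ifP. Qed.

Lemma fits_mask I f s : fits (size_of I) s -> fits (size_of I) (mask (size_of I) f :: s).
Proof. by move=> fs; rewrite /= fs andbT (ltn_trans (mask_lt _ _)) // ltn_exp2l. Qed.

Lemma fits_insert I am g p m acc : fits (size_of I) (m :: acc) -> fits (size_of I) (insert I am g p m acc).
Proof. by rewrite /insert; case: ifP => // _ /andP[]. Qed.

(** A state contributes itself and at most one extension. This crude bound serves for the time
    within one step; over many steps the growth is limited by the number of keys. *)
Lemma size_absorb I am g p acc s :
  size (foldl (absorb I am g p) acc s) <= size acc + 2 * size s.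
Proof.
elim: s acc => [|m s IH] acc /=; first by rewrite addn0.
apply: leq_trans (IH _) _; rewrite mulnS addnA leq_add2r.
have h1 := size_insert I am g p m acc.
have h2 := size_insert I am g p (add_tuple I (code_of I p) m) (insert I am g p m acc).
by rewrite /absorb; case: ifP; lia.
Qed.

Lemma fits_absorb I am g p acc s : fits (size_of I) s -> fits (size_of I) acc ->
  fits (size_of I) (foldl (absorb I am g p) acc s).
Proof.
elim: s acc => //= m s IH acc /andP[hm fs] fa; apply: IH => //.
have f1 : fits (size_of I) (insert I am g p m acc) by apply: fits_insert; rewrite /= hm.
by rewrite /absorb; case: ifP => // _; apply: fits_insert; apply: fits_mask.
Qed.

Lemma fits_dp I am g i : fits (size_of I) (dp_table I am g i).
Proof.
rewrite /dp_table; have : fits (size_of I) [:: 0] by rewrite /= expn_gt0.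
elim: (iota 0 i) [:: 0] => //= p s IH T fT; apply: IH; case: ifP => // _.
exact: fits_absorb.
Qed.

Lemma Comp_insert T (c : ctx T) am g p m acc : Comp c am -> Bdd c g -> Comp c g ->
  Bdd c p -> Comp c p -> Comp c m -> CompL B c acc -> Bdd c (fun t => size (acc t)) ->
  (forall t, dom c t -> fits (size_of (ins c t)) (acc t)) ->
  CompL B c (fun t => insert (ins c t) (am t) (g t) (p t) (m t) (acc t)).
Proof.
move=> *; apply: (@Comp_eq _ _ _ _ (fun t =>
  if has (same_key (ins c t) (am t) (g t) (p t) (m t)) (acc t)
  then encode (size_of (ins c t)) (acc t) else encode (size_of (ins c t)) (m t :: acc t))) => [t _|].
  by rewrite /insert; case: ifP.
apply: Comp_if' => //; last exact: Comp_cons.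
by apply: (@Comp_hasl _ _ _ c acc (fun t => same_key (ins c t) (am t) (g t) (p t) (m t))) => //; comp7.
Qed.

Lemma Comp_dp_step T (c : ctx T) am g p tb : Comp c am -> Bdd c g -> Comp c g ->
  Bdd c p -> Comp c p -> CompL B c tb -> Bdd c (fun t => size (tb t)) ->
  (forall t, dom c t -> fits (size_of (ins c t)) (tb t)) ->
  CompL B c (fun t => dp_step (ins c t) (am t) (g t) (p t) (tb t)).
Proof.
move=> cam bg cg bp cp ct bt ft.
apply: (@Comp_foldl _ _ _ (seq nat) c (fun t s => encode (size_of (ins c t)) s) tb (fun=> [::])
  (fun t => absorb (ins c t) (am t) (g t) (p t))) => //; first exact: Comp_nil.
match goal with |- Computable _ ?c2 _ => pose c' := c2; have bs : Bdd c' (fun x => size x.1.2) end.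
  apply: (@Bdd_le _ _ _ _ _ (fun x => 2 * size (tb x.1.1.1))); first by rewrite /c'; comp7.
  move=> [[[t i] a] x] /= [[_ [-> lt]] _]; apply: leq_trans (size_absorb _ _ _ _ _ _) _.
  by rewrite /= add0n leq_mul2l /= size_take_min geq_minr.
have fa x : dom c' x -> fits (size_of (ins c x.1.1.1)) x.1.2.
  case: x => [[[t i] a] x] /= [[[Pt _] [-> lt]] _]; apply: fits_absorb => //.
  by apply/allP => y /mem_take yin; apply: (allP (ft t Pt)).
have fm x : dom c' x -> x.2 < 2 ^ (size_of (ins c x.1.1.1)).+1.
  case: x => [[[t i] a] x] /= [[[Pt _] [_ lt]] ->].
  by apply: (allP (ft t Pt)); exact: mem_nth.
have ca : CompL B c' (fun x => x.1.2).
  by rewrite /CompL /c'; weaken; exact: Comp_var.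
have ci : CompL B c' (fun x =>
    insert (ins c x.1.1.1) (am x.1.1.1) (g x.1.1.1) (p x.1.1.1) x.2 x.1.2).
  apply: (@Comp_insert _ c' (fun x => am x.1.1.1) (fun x => g x.1.1.1) (fun x => p x.1.1.1)
    (fun x => x.2) (fun x => x.1.2)) => //; rewrite /c'; comp7.
apply: (@Comp_eq _ _ _ _ (fun x =>
  if meets (ins c x.1.1.1) (code_of (ins c x.1.1.1) (p x.1.1.1)) x.2
  then encode (size_of (ins c x.1.1.1)) (insert (ins c x.1.1.1) (am x.1.1.1) (g x.1.1.1) (p x.1.1.1) x.2 x.1.2)
  else encode (size_of (ins c x.1.1.1)) (insert (ins c x.1.1.1) (am x.1.1.1) (g x.1.1.1) (p x.1.1.1)
     (add_tuple (ins c x.1.1.1) (code_of (ins c x.1.1.1) (p x.1.1.1)) x.2)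
     (insert (ins c x.1.1.1) (am x.1.1.1) (g x.1.1.1) (p x.1.1.1) x.2 x.1.2)))).
  by move=> x _; rewrite /absorb; case: ifP.
apply: Comp_if'; [by rewrite /code_of; comp7 | exact: ci |].
apply: (@Comp_insert _ c' (fun x => am x.1.1.1) (fun x => g x.1.1.1) (fun x => p x.1.1.1)
    (fun x => add_tuple (ins c x.1.1.1) (code_of (ins c x.1.1.1) (p x.1.1.1)) x.2)
    (fun x => insert (ins c x.1.1.1) (am x.1.1.1) (g x.1.1.1) (p x.1.1.1) x.2 x.1.2)) => //.
- by rewrite /c'; comp7.
- by rewrite /c'; comp7.
- by rewrite /c'; comp7.
- by rewrite /c'; comp7.
- by rewrite /c'; comp7.
- by rewrite /c' /code_of; comp7.
- by apply: (Bdd_le (Bdd_succ bs)) => x _; exact: size_insert.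
- by move=> x Px; apply: fits_insert; rewrite /= (fm x Px); exact: fa.
Qed.

(** The size is bounded for all prefixes of the sweep because each intermediate table is
    traversed. *)
Lemma Comp_dp T (c : ctx T) am g i : Comp c am -> Bdd c g -> Comp c g ->
  Bdd c i -> Comp c i ->
  Bdd (ext c (fun t j => j <= i t)) (fun x => size (dp_table (ins c x.1) (am x.1) (g x.1) x.2)) ->
  CompL B c (fun t => dp_table (ins c t) (am t) (g t) (i t)).
Proof.
move=> cam bg cg bi ci bs.
apply: (@Comp_foldl_iota _ _ _ (seq nat) c (fun t s => encode (size_of (ins c t)) s) i (fun=> [:: 0])
  (fun t T p => if good (ins c t) (am t) (g t) p then dp_step (ins c t) (am t) (g t) p T else T)) => //.
  by apply: (@Comp_cons _ _ _ c (fun=> 0) (fun=> [::])); [exact: Comp_const | exact: Comp_nil].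
match goal with |- Computable _ ?c2 _ => pose c' := c2; have bs' : Bdd c' (fun x => size x.2) end.
  case: bs => K [D H]; exists K, D => -[[t j] a] /= [[Pt le] [-> lt]].
  exact: (H (t, j) (conj Pt le)).
apply: (@Comp_eq _ _ _ _ (fun x => if good (ins c x.1.1) (am x.1.1) (g x.1.1) x.1.2
  then encode (size_of (ins c x.1.1)) (dp_step (ins c x.1.1) (am x.1.1) (g x.1.1) x.1.2 x.2)
  else encode (size_of (ins c x.1.1)) x.2)) => [x _|]; first by case: ifP.
apply: Comp_if'; [by comp7 | | exact: Comp_var].
apply: (@Comp_dp_step _ c' (fun x => am x.1.1) (fun x => g x.1.1) (fun x => x.1.2) (fun x => x.2)).
- by rewrite /c'; comp7.
- by rewrite /c'; comp7.
- by rewrite /c'; comp7.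
- by rewrite /c'; comp7.
- by rewrite /c'; comp7.
- exact: Comp_var.
- by [].
- by move=> [[t j] a] /= [_ [-> _]]; exact: fits_dp.
Qed.

(** This isolates the only quantity that is exponential in $\sqrt k$. The self-reduction asks for
    fewer cycles on fewer vertices than the input does, hence the range of [k] and the arbitrary
    mask [am], while the bound refers to the input parameter. *)
Definition tractable := forall I am k i, k <= param_of I ->
  count (bit (greedy I am)) (iota 0 (size_of I)) < d * k -> i <= npos I ->
  size (dp_table I am (best I am) i) <= B (size_of I) (param_of I).

Hypothesis tract : tractable.

Lemma Comp_decide T (c : ctx T) am k : Comp c am -> Comp c k ->
  (forall t, dom c t -> k t <= param_of (ins c t)) ->
  CompB c (fun t => decide (ins c t) (am t) (k t)).
Proof.
move=> ca ck lek; rewrite /decide; apply: Comp_orb.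
  apply: Comp_leq.
    apply: (@Comp_eq _ _ _ _ (fun t => k t * d)) => [t _|]; first exact: mulnC.
    by comp7.
  apply: Comp_count; [by comp7 | by comp7 |].
  apply: Comp_bit; [by comp7| |by comp7].
  by weaken; apply: Comp_greedy.
(* This context records that the greedy packing is too small, which is the premise of [tract]. *)
match goal with |- ComputableB _ ?c2 _ => pose c' := c2 end.
have bsz : Bdd (ext c' (fun t j => j <= npos (ins c' t)))
   (fun x => size (dp_table (ins c' x.1) (am x.1) (best (ins c' x.1) (am x.1)) x.2)).
  exists 1, 1 => -[t j] /= [[Pt]]; rewrite -ltnNge => lt le; rewrite mul1n expn1.
  by apply: tract lt _ => //; exact: lek.
apply: (@Comp_hasl _ _ _ c' (fun t => dp_table (ins c t) (am t) (best (ins c t) (am t)) (npos (ins c t)))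
  (fun t m => k t <= fval (ins c t) (am t) m)).
- by apply: (@Comp_dp _ c' am (fun t => best (ins c t) (am t)) (fun t => npos (ins c t))); rewrite /c' //; comp7.
- by case: bsz => K [D H]; exists K, D => t Pt; apply: (H (t, _)) => /=.
- by move=> t _; exact: fits_dp.
- by rewrite /c'; comp7.
Qed.


(** As [d] is fixed, the program contains [d] nested list constructions instead of a loop. *)
Lemma Comp_vertices_cat T (c : ctx T) f acc : Bdd c f -> Comp c f -> CompL B c acc ->
  CompL B c (fun t => vertices (ins c t) (f t) ++ acc t).
Proof.
move=> bf cf ca; rewrite /vertices /mkseq.
elim: d 0 => [|m IH] j //=.
apply: (@Comp_cons _ _ _ c (fun t => digit (size_of (ins c t)) (f t) j)
  (fun t => map (digit (size_of (ins c t)) (f t)) (iota j.+1 m) ++ acc t)); first by comp7.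
exact: IH.
Qed.

Lemma Comp_remaining T (c : ctx T) acc : CompL B c acc -> Bdd c (fun t => size (acc t)) ->
  (forall t, dom c t -> fits (size_of (ins c t)) (acc t)) ->
  Comp c (fun t => remaining (ins c t) (acc t)).
Proof.
move=> ca ba fa; apply: (@Comp_mask _ _ _ c (fun t => size_of (ins c t)) (fun t v => v \notin acc t));
  [by comp7 | by comp7 |].
apply: Comp_negb.
match goal with |- ComputableB _ ?c2 _ => pose c' := c2 end.
apply: (@Comp_eq _ _ _ _ (fun x => nat_of_bool (has (fun u => u == x.2) (acc x.1)))).
  by move=> x _; rewrite -has_pred1.
apply: (@Comp_hasl _ _ _ c' (fun x => acc x.1) (fun x u => u == x.2)); rewrite /c'.
- by rewrite /CompL; weaken.
- by weaken.
- by move=> [t i] /= [Pt _]; exact: fa.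
- by comp7.
Qed.

Lemma Comp_pick_cycle T (c : ctx T) k acc : Comp c k -> CompL B c acc ->
  Bdd c (fun t => size (acc t)) ->
  (forall t, dom c t -> fits (size_of (ins c t)) (acc t) /\ 0 < size_of (ins c t)) ->
  (forall t, dom c t -> k t <= param_of (ins c t)) ->
  Comp c (fun t => pick_cycle (ins c t) (k t) (acc t)).
Proof.
move=> ck ca ba fa lek.
have fit0 t : dom c t -> fits (size_of (ins c t)) (acc t) by move/fa => [].
apply: (@Comp_find _ _ _ c (fun t => size_of (ins c t) ^ d) (fun t p =>
   cycle_code (ins c t) (remaining (ins c t) (acc t)) p &&
   decide (ins c t) (remaining (ins c t) (vertices (ins c t) p ++ acc t)) (k t)));
  [by comp7|by comp7|].
apply: Comp_andb.
  apply: Comp_cycle_code; [|by comp7|by comp7].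
  by weaken; exact: Comp_remaining.
apply: Comp_sub; apply: Comp_decide; [|by comp7|by move=> [t i] [Pt _]; exact: lek].
apply: Comp_remaining.
- by apply: Comp_vertices_cat; [by comp7|by comp7|rewrite /CompL; weaken].
- apply: (@Bdd_le _ _ _ _ _ (fun x => d + size (acc x.1))); first by comp7.
  by move=> x _; rewrite size_cat size_mkseq.
- move=> [t i] /= [Pt _]; rewrite /fits all_cat; have [fat n0] := fa t Pt.
  rewrite [X in _ && X]fat andbT; apply/allP => v /mapP[j _ ->].
  by apply: (ltn_trans (ltn_pmod _ n0)); apply: (ltn_trans (ltn_expl _ (ltnSn 1))); rewrite ltn_exp2l.
Qed.

Definition partial_solution I i :=
  iteri i (fun i acc => vertices I (pick_cycle I (param_of I - i.+1) acc) ++ acc) [::].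

Lemma size_partial I i : size (partial_solution I i) = d * i.
Proof.
by elim: i => [|i IH]; rewrite ?muln0 //= size_cat size_mkseq IH mulnS.
Qed.

Lemma fits_partial I i : param_of I <= size_of I -> i <= param_of I ->
  fits (size_of I) (partial_solution I i).
Proof.
move=> kn; elim: i => // i IH ik; rewrite /fits /= all_cat; apply/andP; split; last exact: (IH (ltnW ik)).
apply/allP => v /mapP[j _ ->]; have n0 : 0 < size_of I by apply: leq_trans kn; exact: leq_ltn_trans ik.
by apply: (ltn_trans (ltn_pmod _ n0)); apply: (ltn_trans (ltn_expl _ (ltnSn 1))); rewrite ltn_exp2l.
Qed.

Lemma Comp_solution T (c : ctx T) : (forall t, dom c t -> param_of (ins c t) <= size_of (ins c t)) ->
  CompL B c (fun t => solution (ins c t)).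
Proof.
move=> kn.
have bk : Bdd c (fun t => param_of (ins c t)) by apply: (Bdd_le (Bdd_size B c)).
apply: (@Comp_iteri _ _ _ (seq nat) c (fun t s => encode (size_of (ins c t)) s)
  (fun t => param_of (ins c t)) (fun=> [::]) (fun t i acc =>
   vertices (ins c t) (pick_cycle (ins c t) (param_of (ins c t) - i.+1) acc) ++ acc)) => //.
- by comp7.
- exact: Comp_nil.
match goal with |- Computable _ ?c2 _ => pose c' := c2 end.
apply: (@Comp_vertices_cat _ c' (fun x => pick_cycle (ins c x.1.1) (param_of (ins c x.1.1) - x.1.2.+1) x.2)
  (fun x => x.2)); last exact: Comp_var.
  apply: (@Bdd_le _ _ _ _ _ (fun x => size_of (ins c x.1.1) ^ d)); first by rewrite /c'; comp7.
  by move=> x _; rewrite /pick_cycle -[leqRHS](size_iota 0) find_size.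
apply: (@Comp_pick_cycle _ c' (fun x => param_of (ins c x.1.1) - x.1.2.+1) (fun x => x.2)).
- by rewrite /c'; comp7.
- exact: Comp_var.
- apply: (@Bdd_le _ _ _ _ _ (fun x => d * x.1.2)); first by rewrite /c'; comp7.
  by move=> [[t i] a] /= [_ [-> _]]; rewrite -/(partial_solution _ _) size_partial.
- move=> [[t i] a] /= [[Pt _] [-> lt]]; split; last by have := kn t Pt; lia.
  by apply: fits_partial; [exact: kn | exact: ltnW].
- by move=> x _; exact: leq_subr.
Qed.

Lemma Comp_output T (c : ctx T) i : (forall t, dom c t -> param_of (ins c t) <= size_of (ins c t)) ->
  Bdd c i -> Comp c i -> (forall t, dom c t -> i t < d * param_of (ins c t)) ->
  Comp c (fun t => nth 0 (solution (ins c t)) (i t)).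
Proof.
move=> kn bi ci il; apply: Comp_nth => //; first exact: Comp_solution.
by move=> t Pt; rewrite -/(partial_solution _ _) size_partial il // fits_partial // kn.
Qed.

End Algorithm.

(** * Packings in a graph whose cells are cliques *)



Lemma count_mem_iota (n : nat) (s : seq nat) (p : pred nat) :
  uniq s -> {subset s <= iota 0 n} ->
  count (fun v => (v \in s) && p v) (iota 0 n) = count p s.
Proof.
move=> us sub.
have /permP <- : perm_eq (filter [in s] (iota 0 n)) s.
  apply: uniq_perm => //; first by rewrite filter_uniq // iota_uniq.
  by move=> v; rewrite mem_filter; case: (boolP (v \in s)) => //= /sub ->.
by rewrite count_filter; apply: eq_count => v /=; rewrite andbC.
Qed.

Lemma size_flatten_const (A : Type) d (P : seq (seq A)) :
  all (fun c => size c == d) P -> size (flatten P) = d * size P.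
Proof.
elim: P => [|c P IH] /=; first by rewrite muln0.
by case/andP => /eqP sc /IH; rewrite size_cat sc mulnS => ->.
Qed.

Lemma chunks (A : eqType) d (s : seq A) : 0 < d -> exists Q : seq (seq A),
  [/\ size Q = size s %/ d, all (fun c => size c == d) Q & subseq (flatten Q) s].
Proof.
move=> d0; have [m] := ubnP (size s); elim: m s => // m IH s; rewrite ltnS => sm.
have [lt|ge] := ltnP (size s) d.
  by exists [::]; rewrite divn_small // sub0seq.
have [|Q [sQ aQ subQ]] := IH (drop d s); first by rewrite size_drop; lia.
exists (take d s :: Q); split => /=.
- have -> : size s = 1 * d + size (drop d s) by rewrite mul1n size_drop subnKC.
  by rewrite divnMDl // sQ.
- by rewrite size_takel // eqxx.
- by rewrite -{2}(cat_take_drop d s) cat_subseq.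
Qed.

Fixpoint words (A : eqType) (L : seq A) j : seq (seq A) :=
  if j is j'.+1 then [seq x :: w | x <- L, w <- words L j'] else [:: [::]].

Lemma size_words (A : eqType) (L : seq A) j : size (words L j) = size L ^ j.
Proof. by elim: j => // j IH; rewrite /= size_allpairs IH expnS. Qed.

Lemma mem_words (A : eqType) (L : seq A) (w : seq A) :
  all [in L] w -> w \in words L (size w).
Proof.
elim: w => // x w IH /= /andP[xL /IH wL].
exact: allpairs_f.
Qed.

Lemma count_cover (A B : eqType) (f : A -> B) (L : seq B) (s : seq A) :
  (forall c, c \in s -> f c \in L) ->
  size s <= \sum_(x <- L) count (fun c => f c == x) s.
Proof.
elim: s => [|c s IH] sub; first by [].
rewrite /= (eq_bigr (fun x => (f c == x : nat) + count (fun c => f c == x) s)) //.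
rewrite big_split /= -add1n leq_add //; last by apply: IH => y ys; apply: sub; rewrite inE ys orbT.
have : f c \in L by apply: sub; rewrite inE eqxx.
elim: L {sub IH} => //= x L IH; rewrite inE big_cons => /orP[/eqP->|/IH]; first by rewrite eqxx.
by move=> h; rewrite (leq_trans h) // leq_addl.
Qed.

Lemma sum_const_le (A : eqType) (L : seq A) (F : A -> nat) m :
  (forall x, x \in L -> F x <= m) -> \sum_(x <- L) F x <= size L * m.
Proof.
elim: L => [|x L IH] h; first by rewrite big_nil.
rewrite big_cons mulSn leq_add //; first by apply: h; rewrite inE eqxx.
by apply: IH => y yL; apply: h; rewrite inE yL orbT.
Qed.

Definition near m (x y : nat * nat) :=
  [&& x.1 <= y.1 + m, y.1 <= x.1 + m, x.2 <= y.2 + m & y.2 <= x.2 + m].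

Lemma near_trans m m' y x z : near m x y -> near m' y z -> near (m + m') x z.
Proof. by rewrite /near; case: x y z => ? ? [? ?] [? ?] /= /and4P[? ? ? ?] /and4P[? ? ? ?]; lia. Qed.

Lemma near_sym m x y : near m x y = near m y x.
Proof. by rewrite /near; case: x y => ? ? [? ?] /=; lia. Qed.

Lemma near_le m m' x y : m <= m' -> near m x y -> near m' x y.
Proof. by rewrite /near; case: x y => ? ? [? ?] /= ? /and4P[? ? ? ?]; lia. Qed.

(** Truncated subtraction may repeat cells at the border; this is harmless, since only the length
    and the presence of all near cells are used. *)
Definition window m (x : nat * nat) :=
  [seq (x.1 + i - m, x.2 + j - m) | i <- iota 0 (2 * m).+1, j <- iota 0 (2 * m).+1].

Lemma size_window m x : size (window m x) = (2 * m).+1 ^ 2.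
Proof. by rewrite size_allpairs !size_iota expnS expn1. Qed.

Lemma mem_window m x y : near m x y -> y \in window m x.
Proof.
case: x y => a b [a' b']; rewrite /near /= => /and4P[h1 h2 h3 h4].
apply/allpairsP; exists (a' + m - a, b' + m - b); rewrite !mem_iota /=; split; try lia.
by congr (_, _); lia.
Qed.

Section Packing.

Variables (n d : nat) (e : rel nat) (cell : nat -> nat * nat).
Hypothesis d_gt2 : 2 < d.
Hypothesis cell_clique : forall u v, u < n -> v < n -> u != v -> cell u = cell v -> e u v.
Hypothesis cell_le : forall v, v < n -> (cell v).1 <= n /\ (cell v).2 <= n.

Let d_gt0 : 0 < d. Proof. by lia. Qed.

Definition d_cycle (al : pred nat) (c : seq nat) :=
  [&& size c == d, all (fun v => (v < n) && al v) c, uniq c & cycle e c].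

Definition d_packing (al : pred nat) (P : seq (seq nat)) :=
  all (d_cycle al) P && uniq (flatten P).

Definition cells := [seq (a, b) | a <- iota 0 n.+1, b <- iota 0 n.+1].

(** The number of cycles when disjoint cycles with vertex set [u] are extended by as many cycles
    inside single cells as possible. *)
Definition packing_value (al u : pred nat) :=
  count u (iota 0 n) %/ d +
  \sum_(x <- cells) count (fun v => [&& al v, ~~ u v & cell v == x]) (iota 0 n) %/ d.

Lemma eq_packing_value al u u' : (forall v, v < n -> u v = u' v) -> packing_value al u = packing_value al u'.
Proof.
move=> uu; rewrite /packing_value; congr (_ + _).
  by congr (_ %/ _); apply: eq_in_count => v; rewrite mem_iota => /andP[_ /uu].
apply: eq_bigr => x _; congr (_ %/ _); apply: eq_in_count => v.
by rewrite mem_iota => /andP[_ /uu ->].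
Qed.

Lemma cells_uniq : uniq cells.
Proof. by apply: allpairs_uniq; rewrite ?iota_uniq // => -[a b] [a' b']. Qed.

Lemma mem_cells v : v < n -> cell v \in cells.
Proof.
move=> /cell_le; case: (cell v) => a b /= [an bn].
by apply: (@allpairs_f _ _ _ pair); rewrite mem_iota.
Qed.

Lemma dcyc_lt al c v : d_cycle al c -> v \in c -> v < n /\ al v.
Proof. by case/and4P => _ /allP h _ _ /h /andP. Qed.

Lemma packing_lt al P v : d_packing al P -> v \in flatten P -> v < n /\ al v.
Proof. by case/andP => /allP aP _ /flattenP[c /aP]; exact: dcyc_lt. Qed.

Lemma packing_size al P : d_packing al P -> size (flatten P) = d * size P.
Proof.
case/andP => aP _; apply: size_flatten_const; apply: sub_all aP => c.
by case/and4P.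
Qed.

Lemma packing_count al P (p : pred nat) : d_packing al P ->
  count (fun v => (v \in flatten P) && p v) (iota 0 n) = count p (flatten P).
Proof.
move=> pP; apply: count_mem_iota; first by case/andP: pP.
by move=> v /(packing_lt pP)[vn _]; rewrite mem_iota.
Qed.

Lemma packing_count1 al P : d_packing al P ->
  count [in flatten P] (iota 0 n) = d * size P.
Proof.
move=> pP; rewrite -(packing_size pP) -(count_predT (flatten P)).
by rewrite -(packing_count predT pP); apply: eq_count => v /=; rewrite andbT.
Qed.

Lemma clique_cycle (s : seq nat) : 1 < size s -> uniq s ->
  (forall u v, u \in s -> v \in s -> u != v -> e u v) -> cycle e s.
Proof.
case: s => // x p; rewrite /= ltnS => p0 /andP[xp up] H; rewrite rcons_path.
have -> : path e x p.
  elim: p x {p0} xp up H => //= y p IH x; rewrite inE negb_or => /andP[xy xp] /andP[yp up] H.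
  rewrite H ?inE ?eqxx ?orbT //=; apply: IH => // u v us vs.
  by apply: H; rewrite inE ?us ?vs orbT.
have lp : last x p \in p by case: p p0 {xp up H} => // y p _; exact: mem_last.
apply: H; rewrite ?inE ?lp ?eqxx ?orbT //.
by apply: contraNneq xp => <-.
Qed.

(** The free vertices of each cell are cut into groups of [d]. A group is a cycle because cells are
    cliques, and groups from different cells are disjoint. *)
Lemma packing_value_attained al P (u : pred nat) : d_packing al P ->
  (forall v, v < n -> u v = (v \in flatten P)) ->
  exists Q, d_packing al Q /\ size Q = packing_value al u.
Proof.
move=> pP uP; rewrite (eq_packing_value al (u' := [in flatten P])) // {uP}.
suff [Q [sQ aQ uQ frQ]] : exists Q, [/\ size Q = \sum_(x <- cells)
    count (fun v => [&& al v, v \notin flatten P & cell v == x]) (iota 0 n) %/ d,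
    all (d_cycle al) Q, uniq (flatten Q) &
    {in flatten Q, forall v, v \notin flatten P /\ cell v \in cells}].
  exists (P ++ Q); split; last by rewrite size_cat /packing_value (packing_count1 pP) mulKn // sQ.
  case/andP: pP => aP uP; apply/andP; rewrite all_cat aP; split => //.
  rewrite flatten_cat cat_uniq uP uQ andbT /=.
  by apply/hasPn => v /frQ[].
elim: cells cells_uniq => [|x cs IH] /=; first by exists [::]; rewrite big_nil.
case/andP => xcs /IH[Q [sQ aQ uQ frQ]].
pose s := [seq v <- iota 0 n | [&& al v, v \notin flatten P & cell v == x]].
have us : uniq s by rewrite filter_uniq // iota_uniq.
have [Q' [sQ' aQ' subQ']] := chunks s d_gt0.
have inQ' v : v \in flatten Q' -> [/\ v < n, al v, v \notin flatten P & cell v = x].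
  move=> /(mem_subseq subQ'); rewrite mem_filter mem_iota => /andP[/and3P[-> -> /eqP ->]].
  by move=> /andP[_ ->].
have uQ' := subseq_uniq subQ' us.
exists (Q' ++ Q); split.
- by rewrite size_cat big_cons sQ sQ' size_filter.
- rewrite all_cat aQ andbT; apply/allP => c cQ'.
  have cin v : v \in c -> v \in flatten Q' by move=> vc; apply/flattenP; exists c.
  have uc : uniq c.
    by case/splitPr: cQ' uQ' => p1 p2; rewrite flatten_cat /= !cat_uniq => /and3P[_ _ /and3P[]].
  have sc : size c == d by exact: (allP aQ').
  apply/and4P; split => //.
    by apply/allP => v /cin /inQ'[-> ->].
  apply: clique_cycle => //; first by rewrite (eqP sc) ltnW.
  move=> a b /cin/inQ'[an _ _ ca] /cin/inQ'[bn _ _ cb] ab.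
  by apply: cell_clique; rewrite ?ca ?cb.
- rewrite flatten_cat cat_uniq uQ' uQ andbT /=.
  apply/hasPn => v /frQ[_ vc]; apply: contra xcs => /inQ'[_ _ _ <-] //.
- move=> v; rewrite flatten_cat mem_cat => /orP[/inQ'[_ _ ? ->]|/frQ[? vc]]; split => //.
    by rewrite inE eqxx.
  by rewrite inE vc orbT.
Qed.

Lemma packing_perm al P P' : perm_eq P P' -> d_packing al P = d_packing al P'.
Proof.
by move=> pp; rewrite /d_packing (perm_all _ pp) (perm_uniq (perm_flatten pp)).
Qed.

Lemma packing_cat al P P' : d_packing al (P ++ P') ->
  [/\ d_packing al P, d_packing al P' & forall v, v \in flatten P -> v \notin flatten P'].
Proof.
rewrite /d_packing all_cat flatten_cat cat_uniq => /andP[/andP[-> ->] /and3P[-> h ->]].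
split => // v vP; apply/negP => vP'; move/hasPn: h => /(_ v vP').
by rewrite /= vP.
Qed.

Definition cell_pattern (c : seq nat) := map cell c.

(** [d] cycles with the same pattern free, in each cell, a multiple of [d] vertices. *)
Lemma packing_value_drop al P D P' pi : d_packing al P -> perm_eq P (D ++ P') -> size D = d ->
  all (fun c => cell_pattern c == pi) D -> packing_value al [in flatten P] <= packing_value al [in flatten P'].
Proof.
move=> pP pp sD aD; have pDP : d_packing al (D ++ P') by rewrite -(packing_perm _ pp).
have [pD pP' dis] := packing_cat pDP.
have mP v : (v \in flatten P) = (v \in flatten D) || (v \in flatten P').
  by rewrite (perm_mem (perm_flatten pp)) flatten_cat mem_cat.
rewrite /packing_value (packing_count1 pP) (packing_count1 pP') !mulKn // (perm_size pp) size_cat sD.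
have Dn : exists2 c, c \in D & cell_pattern c = pi.
  by case: (D) sD aD d_gt0 => [<-|c D'] // _ /= /andP[/eqP ? _]; exists c; rewrite ?inE ?eqxx.
have spi : size pi = d.
  case: Dn => c cD <-; rewrite size_map; case/andP: pD => /allP/(_ c cD) /and4P[/eqP-> //].
have picells x : x \in pi -> x \in cells.
  case: Dn => c cD <- /mapP[v vc ->]; apply: mem_cells.
  by case/andP: pD => /allP/(_ c cD) /dcyc_lt /(_ vc)[].
rewrite [d + size P']addnC -addnA leq_add2l.
(* The cell [x] regains [d] vertices, and thus one cycle, for each of its occurrences in [pi]. The
   [d] entries of [pi] together make up for the [d] dropped cycles. *)
have key x : x \in cells ->
  count (fun v => [&& al v, v \notin flatten P' & cell v == x]) (iota 0 n) %/ d =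
  count_mem x pi + count (fun v => [&& al v, v \notin flatten P & cell v == x]) (iota 0 n) %/ d.
  move=> _; rewrite -divnMDl //; congr (_ %/ d).
  have -> : count_mem x pi * d = count (fun v => (v \in flatten D) && (cell v == x)) (iota 0 n).
    rewrite (packing_count _ pD) -sD.
    elim: D aD {sD pp pDP pD dis mP Dn} => [|c D IH] /=; first by rewrite muln0.
    by case/andP => /eqP pc /IH ih; rewrite mulnS count_cat -ih -pc count_map.
  rewrite -count_predUI; rewrite [X in _ + X](_ : _ = 0) ?addn0; last first.
    apply/eqP; rewrite eqn0Ngt -has_count; apply/hasPn => v _ /=; rewrite mP.
    by case: (v \in flatten D); rewrite ?andbF.
  apply: eq_in_count => v; rewrite mem_iota => /andP[_ vn] /=; rewrite mP.
  case: (boolP (v \in flatten D)) => [vD|_] /=; last by [].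
  have [_ ->] := packing_lt pD vD; by rewrite (dis v vD) /=; case: (cell v == x).
rewrite [leqRHS](eq_big_seq _ key) big_split /= leq_add2r.
rewrite -spi; elim: pi picells {aD spi Dn key} => //= x pi IH sub.
rewrite big_split /= -add1n leq_add //; last by apply: IH => y yp; apply: sub; rewrite inE yp orbT.
have : x \in cells by apply: sub; rewrite inE eqxx.
by elim: cells => // y cs IHc; rewrite inE big_cons => /orP[/eqP->|/IHc h]; rewrite ?eqxx // (leq_trans h) ?leq_addl.
Qed.

Lemma packing_value_size al P : d_packing al P -> size P <= packing_value al [in flatten P].
Proof. by move=> pP; rewrite /packing_value (packing_count1 pP) mulKn // leq_addr. Qed.

Lemma few_per_pattern al P : d_packing al P -> exists P',
  [/\ d_packing al P', packing_value al [in flatten P] <= packing_value al [in flatten P'] &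
      forall pi, count (fun c => cell_pattern c == pi) P' < d].
Proof.
have [m] := ubnP (size P); elim: m P => // m IH P; rewrite ltnS => sm pP.
have [/hasP[c cP le]|/hasPn no] :=
  boolP (has (fun c => d <= count (fun c' => cell_pattern c' == cell_pattern c) P) P); last first.
  exists P; split => // pi.
  have [/hasP[c cP /eqP <-]|] := boolP (has (fun c => cell_pattern c == pi) P).
    by rewrite ltnNge; exact: no.
  by rewrite has_count -eqn0Ngt => /eqP ->.
pose F := filter (fun c' => cell_pattern c' == cell_pattern c) P.
pose P' := drop d F ++ filter (predC (fun c' => cell_pattern c' == cell_pattern c)) P.
have pp : perm_eq P (take d F ++ P').
  by rewrite /P' catA cat_take_drop perm_sym; apply/permPl; exact: perm_filterC.
have sD : size (take d F) = d by rewrite size_takel // size_filter.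
have pDP : d_packing al (take d F ++ P') by rewrite -(packing_perm _ pp).
have [_ pP' _] := packing_cat pDP.
have [|P2 [pP2 le2 h2]] := IH P' _ pP'.
  apply: leq_trans sm; move: (perm_size pp); rewrite size_cat sD => ->.
  by rewrite -[X in X < _]add0n ltn_add2r; exact: d_gt0.
exists P2; split => //; apply: leq_trans le2; apply: (packing_value_drop (D := take d F) (pi := cell_pattern c)) => //.
by apply/allP => c' /mem_take; rewrite mem_filter => /andP[].
Qed.


(** The value depends only on how many vertices are used in each cell: used and free vertices add up
    to the allowed ones. *)
Lemma packing_value_pattern al P P2 : d_packing al P -> d_packing al P2 ->
  perm_eq (map cell (flatten P)) (map cell (flatten P2)) ->
  packing_value al [in flatten P] = packing_value al [in flatten P2].
Proof.
move=> pP pP2 pp; rewrite /packing_value; congr (_ %/ d + _).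
  rewrite !(packing_count1 (al := al)) // -!(packing_size (al := al)) //.
  by have := perm_size pp; rewrite !size_map.
apply: eq_bigr => x _; congr (_ %/ d).
have key P' : d_packing al P' ->
    count (fun v => (v \in flatten P') && (cell v == x)) (iota 0 n) +
    count (fun v => [&& al v, v \notin flatten P' & cell v == x]) (iota 0 n) =
    count (fun v => al v && (cell v == x)) (iota 0 n).
  move=> pP'; rewrite -count_predUI [X in _ + X](_ : _ = 0) ?addn0.
    apply: eq_in_count => v; rewrite mem_iota => /andP[_ vn] /=.
    case: (boolP (v \in flatten P')) => [vP|_] /=; last by [].
    by have [_ ->] := packing_lt pP' vP; rewrite /= orbF.
  apply/eqP; rewrite eqn0Ngt -has_count; apply/hasPn => v _ /=.
  by case: (v \in flatten P'); rewrite ?andbF.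
apply: (@addnI (count (fun v => (v \in flatten P) && (cell v == x)) (iota 0 n))).
rewrite (key _ pP) -(key _ pP2); congr (_ + _).
rewrite !(packing_count (al := al)) //.
by have /permP/(_ (pred1 x)) := pp; rewrite !count_map => ->.
Qed.

Hypothesis edge_local : forall u v, u < n -> v < n -> e u v -> near 2 (cell u) (cell v).

Lemma path_near x p y : all (fun v => v < n) (x :: p) -> path e x p -> y \in x :: p ->
  near (2 * size p) (cell x) (cell y).
Proof.
elim: p x => [|z p IH] x /=.
  by move=> _ _; rewrite inE => /eqP ->; rewrite /near; lia.
move=> /and3P[xn zn pn] /andP[xz zp]; rewrite inE => /orP[/eqP ->|yp].
  by rewrite /near; lia.
have h1 := edge_local xn zn xz.
have := near_trans h1 (IH z _ zp yp); rewrite mulnS; apply.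
by rewrite /= zn.
Qed.

Lemma dcyc_near al c v : d_cycle al c -> v \in c -> near (2 * d) (cell (head 0 c)) (cell v).
Proof.
case/and4P => /eqP sc /allP cn _; case: c sc cn => // x p sc cn.
rewrite /= rcons_path => /andP[xp _] vp.
apply: near_le (path_near _ xp vp); first by rewrite -sc /=; lia.
by apply/allP => u /cn /andP[].
Qed.

Lemma dcyc_words al m x c : d_cycle al c -> near m x (cell (head 0 c)) ->
  cell_pattern c \in words (window (m + 2 * d) x) d.
Proof.
move=> dc nx; have /and4P[/eqP sc _ _ _] := dc; rewrite -{2}sc -(size_map cell).
apply: mem_words; apply/allP => y /mapP[v vc ->].
by apply: mem_window; apply: near_trans nx _; exact: dcyc_near dc vc.
Qed.

Definition touching (pi : seq (nat * nat)) (c : seq nat) := has (fun v => cell v \in pi) c.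

Lemma few_touching al c P : d_cycle al c -> all (d_cycle al) P ->
  (forall pi, count (fun c' => cell_pattern c' == pi) P < d) ->
  size (filter (touching (cell_pattern c)) P) <= ((12 * d).+1 ^ 2) ^ d * d.
Proof.
move=> dc aP few; set S := filter _ P.
have : forall c', c' \in S -> cell_pattern c' \in words (window (4 * d + 2 * d) (cell (head 0 c))) d.
  move=> c'; rewrite mem_filter => /andP[/hasP[v vc' /mapP[u uc cuv]] c'P].
  have dc' := allP aP _ c'P; apply: (dcyc_words dc').
  have h1 := dcyc_near dc uc; have := dcyc_near dc' vc'; rewrite cuv near_sym => h2.
  by apply: near_le (near_trans h1 h2); lia.
move/count_cover => h; apply: leq_trans h _.
apply: leq_trans (sum_const_le (m := d) _) _.
  move=> pi _; apply: leq_trans (ltnW (few pi)); rewrite count_filter.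
  by apply: sub_count => x /andP[].
by rewrite size_words size_window -mulnDl mulnA.
Qed.

(** An unmarked cycle [c] is exchanged for a marked one with the same pattern that avoids [Y], the
    vertices of the other cycles in the cells of [c]. The substitute stays in these cells, so
    avoiding [Y] makes it disjoint from the other cycles; the equal pattern preserves the value and
    the number of cycles for each pattern. *)
Lemma marked_packing al (mkd : pred (seq nat)) P :
  (forall c Y, d_cycle al c -> size Y <= capacity d -> {in c, forall v, v \notin Y} ->
     exists c', [/\ d_cycle al c', mkd c', cell_pattern c' = cell_pattern c & {in c', forall v, v \notin Y}]) ->
  d_packing al P -> (forall pi, count (fun c => cell_pattern c == pi) P < d) ->
  exists P', [/\ d_packing al P', all mkd P' & packing_value al [in flatten P] = packing_value al [in flatten P']].
Proof.
move=> rep; have [m] := ubnP (count (predC mkd) P); elim: m P => // m IH P.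
rewrite ltnS => cm pP few.
have [aP|] := boolP (all mkd P); first by exists P.
rewrite -has_predC => /hasP[c cP /= nc].
pose P1 := rem c P; have pp : perm_eq P (c :: P1) by exact: perm_to_rem.
have pc1 : d_packing al (c :: P1) by rewrite -(packing_perm _ pp).
have [] := @packing_cat al [:: c] P1 pc1; rewrite /= cats0 => pc p1 dis.
have dc : d_cycle al c by case/andP: pc => /= /andP[].
pose Y := filter (fun v => cell v \in cell_pattern c) (flatten P1).
have few1 pi : count (fun c' => cell_pattern c' == pi) P1 < d.
  by apply: leq_ltn_trans (few pi); rewrite (permP pp) /= leq_addl.
have a1 : all (d_cycle al) P1 by case/andP: p1.
have sY : size Y <= capacity d.
  have sub : {subset Y <= flatten (filter (touching (cell_pattern c)) P1)}.
    move=> v; rewrite mem_filter => /andP[vc /flattenP[c' c'P vc']].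
    by apply/flattenP; exists c' => //; rewrite mem_filter c'P andbT; apply/hasP; exists v.
  have uY : uniq Y by rewrite filter_uniq //; case/andP: p1.
  apply: leq_trans (uniq_leq_size uY sub) _.
  rewrite (size_flatten_const (d := d)) /capacity; last first.
    by apply/allP => c'; rewrite mem_filter => /andP[_ /(allP a1)/and4P[]].
  by rewrite mulnC leq_mul2r (few_touching dc a1 few1) orbT.
have [|c' [dc' mc' cell_pattern' dis']] := rep c Y dc sY.
  by move=> v vc; rewrite mem_filter negb_and dis ?orbT.
have p2 : d_packing al (c' :: P1).
  rewrite /d_packing /= dc' a1 /= cat_uniq; case/andP: p1 => _ ->; rewrite andbT.
  have -> : uniq c' by case/and4P: dc'.
  apply/hasPn => v vP1; apply/negP => /= vc'; have := dis' v vc'.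
  by rewrite mem_filter vP1 andbT -cell_pattern' => /negP; apply; apply: map_f.
have [||P' [pP' mP' eP']] := IH (c' :: P1) _ p2.
- have := permP pp (predC mkd); rewrite /= nc mc' /= add0n.
  by move: cm; rewrite (permP pp) /= nc add1n.
- move=> pi; rewrite /= cell_pattern'; apply: leq_ltn_trans (few pi).
  by rewrite (permP pp).
exists P'; split => //; rewrite -eP'; apply: packing_value_pattern => //.
apply: (@perm_trans _ (map cell (flatten (c :: P1)))).
  by apply: perm_map; exact: perm_flatten.
by rewrite /= !map_cat -!/(cell_pattern _) cell_pattern'.
Qed.

(** The gain from adding a cycle depends only on the free vertices in the cells that it meets. It is
    stated with sums because it can be negative: one cycle may destroy a group of [d] free vertices
    in several cells. *)
Lemma packing_value_add al (s : seq nat) (u u' : pred nat) :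
  uniq s -> size s = d -> {in s, forall v, v < n} ->
  {in s, forall v, ~~ u v} -> {in s, forall v, ~~ u' v} ->
  (forall v, v < n -> cell v \in map cell s -> u v = u' v) ->
  packing_value al (fun v => u v || (v \in s)) + packing_value al u' = packing_value al (fun v => u' v || (v \in s)) + packing_value al u.
Proof.
move=> us ss sn hu hu' agree; rewrite /packing_value.
have cnt (w : pred nat) : {in s, forall v, ~~ w v} ->
    count (fun v => w v || (v \in s)) (iota 0 n) %/ d = count w (iota 0 n) %/ d + 1.
  move=> hw; have -> : count (fun v => w v || (v \in s)) (iota 0 n) =
      count w (iota 0 n) + d.
    rewrite -ss -(count_predT s) -(@count_mem_iota n s predT) //; last first.
      by move=> v /sn vn; rewrite mem_iota.
    rewrite -count_predUI [X in _ = _ + X](_ : _ = 0) ?addn0.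
      by apply: eq_count => v /=; rewrite andbT.
    apply/eqP; rewrite eqn0Ngt -has_count; apply/hasPn => v _ /=; rewrite andbT.
    by apply/negP => /andP[wv vs]; have := hw v vs; rewrite wv.
  by rewrite divnDr ?dvdnn // divnn d_gt0.
rewrite !cnt //.
suff : \sum_(x <- cells) count (fun v => [&& al v, ~~ (u v || (v \in s)) & cell v == x]) (iota 0 n) %/ d
    + \sum_(x <- cells) count (fun v => [&& al v, ~~ u' v & cell v == x]) (iota 0 n) %/ d
  = \sum_(x <- cells) count (fun v => [&& al v, ~~ (u' v || (v \in s)) & cell v == x]) (iota 0 n) %/ d
    + \sum_(x <- cells) count (fun v => [&& al v, ~~ u v & cell v == x]) (iota 0 n) %/ d.
  move: (\sum_(_ <- _) _) (\sum_(_ <- _) _) (\sum_(_ <- _) _) (\sum_(_ <- _) _).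
  by move=> A1 A2 A3 A4; lia.
rewrite -!big_split; apply: eq_bigr => x _ /=.
have [xs|xs] := boolP (x \in map cell s).
  congr (_ %/ d + _ %/ d); apply: eq_in_count => v; rewrite mem_iota => /andP[_ vn] /=.
    by case: eqP => [clv|]; rewrite ?andbF // agree ?clv.
  by case: eqP => [clv|]; rewrite ?andbF // agree ?clv.
rewrite addnC; congr (_ %/ d + _ %/ d); apply: eq_in_count => v _ /=.
  case: eqP => [clv|]; rewrite ?andbF // (_ : v \in s = false) ?orbF //.
  by apply: contraNF xs => vs; rewrite -clv map_f.
case: eqP => [clv|]; rewrite ?andbF // (_ : v \in s = false) ?orbF //.
by apply: contraNF xs => vs; rewrite -clv map_f.
Qed.

End Packing.

(** * Cells of a unit disk graph *)

Import Order.TTheory GRing.Theory Num.Theory.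

Lemma count_strict (A : eqType) (p q : pred A) s j : subpred p q -> j \in s -> q j -> ~~ p j ->
  count p s < count q s.
Proof.
move=> pq; elim: s => //= x s IH; rewrite inE => /orP[/eqP <- qj npj|js qj npj].
  by rewrite qj (negbTE npj) add0n add1n ltnS sub_count.
have := IH js qj npj; case px: (p x); first by rewrite (pq _ px) !add1n ltnS.
by rewrite add0n => h; apply: leq_trans h (leq_addl _ _).
Qed.

(** Such a predicate holds on an initial segment, whose length is both the first failure and the
    number of hits. *)
Lemma count_antitone (p : pred nat) m : (forall r, p r.+1 -> p r) ->
  (forall r, p r -> r < m) -> forall r, p r = (r < count p (iota 0 m)).
Proof.
move=> anti bnd.
have anti' r r' : r <= r' -> p r' -> p r.
  by move/subnKC <-; elim: (r' - r) => [|k IH]; rewrite ?addn0 // addnS => /anti /IH.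
pose k := find (predC p) (iota 0 m).
have pk r : p r = (r < k).
  have [rm|mr] := ltnP r m; last first.
    have km : k <= m by rewrite -(size_iota 0 m) find_size.
    by rewrite ltnNge (leq_trans km mr); apply/negP => /bnd; rewrite ltnNge mr.
  apply/idP/idP => [pr|rk].
    rewrite ltnNge; apply/negP => kr.
    have km : k < m by exact: leq_ltn_trans kr rm.
    have : has (predC p) (iota 0 m) by rewrite has_find size_iota.
    by move/(nth_find 0); rewrite nth_iota // add0n -/k /= (anti' _ _ kr pr).
  by have := before_find 0 rk; rewrite nth_iota // add0n /= => /negbFE.
move=> r; rewrite (eq_count pk) count_ltn_iota //.
by rewrite -(size_iota 0 m) find_size.
Qed.

(** This is $(1-2x)(1+2x) \ge 0$, in a form that can be added over two coordinates. *)
Lemma sqr_le_half (R : realFieldType) (x : R) :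
  (-1 <= x + x -> x + x <= 1 -> x * x + x * x <= 1)%R.
Proof.
move=> h h2; have h3 : (0 <= 1 - (x + x))%R by lra.
have h4 : (0 <= 1 + (x + x))%R by lra.
have := mulr_ge0 h3 h4; rewrite (_ : _ * _ = 1 - x * x * 4)%R; last by ring.
by move: (x * x)%R => t; lra.
Qed.

Lemma sum_sqr_le1 (R : realFieldType) (x z : R) : (x * x + z * z <= 1 -> x <= 1)%R.
Proof.
move=> h; rewrite leNgt; apply/negP => lt.
have h1 := sqr_ge0 z; have : (0 < (x - 1) * (x - 1))%R by apply: mulr_gt0; lra.
rewrite expr2 in h1; rewrite (_ : _ * _ = x * x - x - x + 1)%R; last by ring.
by move: (x * x)%R (z * z)%R h h1 => t u; lra.
Qed.

Section Geometry.

Variable R : realType.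
Implicit Types I : instance R.

Lemma gapE a I j i :
  gap a I j i = (coord_of I a j + coord_of I a j + 1 < coord_of I a i + coord_of I a i)%R.
Proof. by rewrite /gap -ltNge. Qed.

Lemma bit_layer0 a I i : bit (layer a I 0) i = (i < size_of I).
Proof. by rewrite bit_mask andbT. Qed.

Lemma bit_layerS a I r i : bit (layer a I r.+1) i =
  (i < size_of I) && has (fun j => bit (layer a I r) j && gap a I j i) (iota 0 (size_of I)).
Proof. by rewrite bit_mask. Qed.

Lemma layer_lt a I r i : bit (layer a I r) i -> i < size_of I.
Proof. by case: r => [|r]; rewrite ?bit_layer0 // bit_layerS => /andP[]. Qed.

Lemma layer_anti a I r i : bit (layer a I r.+1) i -> bit (layer a I r) i.
Proof.
elim: r i => [|r IH] i; first by rewrite bit_layerS bit_layer0 => /andP[].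
rewrite bit_layerS => /andP[ilt /hasP[j jn /andP[/IH bj g]]].
by rewrite bit_layerS ilt; apply/hasP; exists j => //; rewrite bj.
Qed.

(** The coordinate increases strictly along a chain, so at least [r] points lie below the end of a
    chain of [r] steps. *)
Lemma layer_bound a I r i : bit (layer a I r) i -> r < size_of I.
Proof.
pose below i := count (fun j => (coord_of I a j < coord_of I a i)%R) (iota 0 (size_of I)).
have mono i' j : j < size_of I -> (coord_of I a j < coord_of I a i')%R -> below j < below i'.
  move=> jn lt; apply: (@count_strict _ _ _ _ j) => [x h||//|].
  - exact: lt_trans h lt.
  - by rewrite mem_iota.
  - by rewrite ltxx.
have hr : forall i', bit (layer a I r) i' -> r <= below i'.
  elim: r => // r IH i'; rewrite bit_layerS => /andP[_ /hasP[j]].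
  rewrite mem_iota => /andP[_ jn] /andP[/IH h]; rewrite gapE => g.
  by apply: leq_ltn_trans h _; apply: mono => //; lra.
move=> bi; apply: leq_ltn_trans (hr i bi) _; rewrite -[ltnRHS](size_iota 0) -(count_predT (iota 0 _)).
apply: (@count_strict _ _ _ _ i) => //; last by rewrite ltxx.
by rewrite mem_iota (layer_lt bi).
Qed.

Lemma level_layer a I r i : i < size_of I -> bit (layer a I r) i = (r <= level a I i).
Proof.
move=> il; case: r => [|r]; first by rewrite bit_layer0 il.
rewrite /level -(@count_antitone (fun r => bit (layer a I r.+1) i)) //.
  by move=> k; exact: layer_anti.
by move=> k /layer_bound; exact: ltnW.
Qed.

Lemma level_le a I i : level a I i <= size_of I.
Proof. by rewrite /level -[leqRHS](size_iota 0) count_size. Qed.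

Lemma level_gap a I i j : i < size_of I -> j < size_of I -> gap a I j i -> level a I j < level a I i.
Proof.
move=> il jl g; rewrite -level_layer // bit_layerS il; apply/hasP; exists j.
  by rewrite mem_iota.
by rewrite level_layer // leqnn.
Qed.

(** Otherwise three steps back along a chain ending at [i] would lead to a point of level at least
    that of [j] whose coordinate is less than $x_i - 3/2 \le x_j - 1/2$. The gap from this point to
    [j] would make its level smaller than that of [j]. *)
Lemma level_close a I i j : i < size_of I -> j < size_of I ->
  (coord_of I a i <= coord_of I a j + 1)%R -> level a I i <= level a I j + 2.
Proof.
move=> il jl le; rewrite leqNgt; apply/negP => lt.
have step r k : k < size_of I -> r.+1 <= level a I k -> exists k',
    [/\ k' < size_of I, r <= level a I k' & gap a I k' k].
  move=> kl; rewrite -level_layer // bit_layerS => /andP[_ /hasP[k']].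
  rewrite mem_iota => /andP[_ k'l] /andP[]; rewrite level_layer // => h g.
  by exists k'.
have [|k1 [k1l h1 g1]] := step (level a I j).+2 i il; first by lia.
have [k2 [k2l h2 g2]] := step _ k1 k1l h1.
have [k3 [k3l h3 g3]] := step _ k2 k2l h2.
have : gap a I k3 j by rewrite !gapE in g1 g2 g3 *; lra.
by move/(level_gap jl k3l); rewrite ltnNge h3.
Qed.

Definition cell I v := (level 0 I v, level 1 I v).

Lemma same_cellE I u v : same_cell I u v = (cell I u == cell I v).
Proof. by rewrite /same_cell /cell xpair_eqE. Qed.

(** Equal levels exclude a gap in either direction, so both coordinates differ by at most $1/2$ and
    the distance is at most $1/\sqrt2$. *)
Lemma cell_adj I u v : u < size_of I -> v < size_of I -> u != v -> cell I u = cell I v -> adj I u v.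
Proof.
move=> ul vl uv [e0 e1]; rewrite /adj uv /close.
have n0 i j a : i < size_of I -> j < size_of I -> level a I i = level a I j ->
    (coord_of I a i + coord_of I a i <= coord_of I a j + coord_of I a j + 1)%R.
  move=> il jl e; rewrite leNgt -gapE; apply/negP => /(level_gap il jl).
  by rewrite e ltnn.
have := n0 _ _ _ ul vl e0; have := n0 _ _ _ vl ul (esym e0).
have := n0 _ _ _ ul vl e1; have := n0 _ _ _ vl ul (esym e1).
move: (coord_of I 0 u) (coord_of I 0 v) (coord_of I 1 u) (coord_of I 1 v) => a b a' b' h1 h2 h3 h4.
have sq (x y : R) : (y + y <= x + x + 1 -> x + x <= y + y + 1 ->
    (x - y) * (x - y) + (x - y) * (x - y) <= 1)%R.
  by move=> k1 k2; apply: sqr_le_half; lra.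
have := sq _ _ h3 h4; have := sq _ _ h1 h2.
by move: ((a - b) * (a - b))%R ((a' - b') * (a' - b'))%R => s t; lra.
Qed.

Lemma adj_near I u v : u < size_of I -> v < size_of I -> adj I u v -> near 2 (cell I u) (cell I v).
Proof.
move=> ul vl /andP[_ c]; rewrite /near /=.
have sq (x y z t : R) : ((x - y) * (x - y) + (z - t) * (z - t) <= 1 -> x <= y + 1)%R.
  by move=> /sum_sqr_le1; lra.
have sym (x y : R) : ((x - y) * (x - y) = (y - x) * (y - x))%R by ring.
move: c; rewrite /close => c; have c' := c; rewrite sym [X in (_ + X)%R]sym in c'.
have c2 := c; have c2' := c'; rewrite addrC in c2; rewrite addrC in c2'.
by apply/and4P; split; apply: level_close => //; [exact: sq c | exact: sq c' | exact: sq c2 | exact: sq c2'].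
Qed.

Lemma cell_bound I v : v < size_of I -> (cell I v).1 <= size_of I /\ (cell I v).2 <= size_of I.
Proof. by move=> _; split; exact: level_le. Qed.

End Geometry.

(** * Codes of tuples *)

Lemma digit_surj b (c : seq nat) : all (fun v => v < b) c ->
  exists2 t, t < b ^ size c & mkseq (digit b t) (size c) = c.
Proof.
elim: c => [|x c IH] /=; first by exists 0.
case/andP => xb /IH[t tlt tc]; exists (x + t * b).
  rewrite expnS [b * _]mulnC; apply: (@leq_trans (b + t * b)); first by rewrite ltn_add2r.
  by rewrite -mulSn leq_mul2r tlt orbT.
rewrite /mkseq /= {1}/digit expn0 divn1 addnC modnMDl modn_small //; congr (_ :: _).
rewrite -{2}tc /mkseq (iotaDl 1 0 (size c)) -map_comp; apply: eq_map => j /=.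
rewrite /digit add1n expnS divnMA [t * b + x]addnC -[x + t * b]addnC divnMDl ?(leq_ltn_trans _ xb) //.
by rewrite (divn_small xb) addn0.
Qed.

Lemma cycle_mkseq (e : rel nat) f m : 0 < m ->
  cycle e (mkseq f m) = all (fun i => e (f i) (f (i.+1 %% m))) (iota 0 m).
Proof.
case: m => // m _; rewrite [LHS]/=.
have size_of : size (rcons (map f (iota 1 m)) (f 0)) = m.+1 by rewrite size_rcons size_map size_iota.
have n1 i : i < m.+1 -> nth 0 (f 0 :: rcons (map f (iota 1 m)) (f 0)) i = f i.
  case: i => //= i; rewrite ltnS => im; rewrite nth_rcons size_map size_iota im.
  by rewrite (nth_map 0) ?size_iota // nth_iota.
have n2 i : i < m.+1 -> nth 0 (rcons (map f (iota 1 m)) (f 0)) i = f (i.+1 %% m.+1).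
  rewrite ltnS leq_eqVlt => /orP[/eqP ->|im].
    by rewrite nth_rcons size_map size_iota ltnn eqxx modnn.
  by have := n1 i.+1 im; rewrite /= modn_small.
apply/idP/idP => [/(pathP 0) h|/allP h]; [apply/allP => i | apply/(pathP 0) => i].
  rewrite mem_iota => /andP[_ im].
  by have := h i; rewrite size_of n1 // n2 //; apply.
rewrite size_of => im; rewrite n1 // n2 //; apply: h.
by rewrite mem_iota.
Qed.

(** * Correctness *)

Section Correctness.

Variables (R : realType) (d : nat).
Hypothesis d_gt2 : 2 < d.
Variable I : instance R.
Local Notation n := (size_of I).
Local Notation vx t := (vertices d I t).
Local Notation pos p := (vx (code_of d I p)).
Local Notation dcyc := (d_cycle n d (adj I)).
Local Notation packing := (d_packing n d (adj I)).
Local Notation fv := (packing_value n d (cell I)).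
Local Notation pat := (cell_pattern (cell I)).

Let d_gt0 : 0 < d. Proof. by lia. Qed.

Lemma expd_gt0 t : t < n ^ d -> 0 < n.
Proof. by case: (n) => //; rewrite exp0n. Qed.

Lemma onE t v : on d I t v = (v \in vx t).
Proof. by rewrite /on -has_pred1 /vertices has_map. Qed.

Lemma meetsE t m : meets d I t m = has (bit m) (vx t).
Proof. by rewrite /meets /vertices has_map. Qed.

Lemma bit_add_tuple t m v : bit (add_tuple d I t m) v = (v < n) && (bit m v || (v \in vx t)).
Proof. by rewrite bit_mask onE. Qed.

Lemma touchE t v : touch d I t v = (cell I v \in pat (vx t)).
Proof.
rewrite /touch /cell_pattern /vertices -map_comp; elim: (iota 0 d) => //= j s IH.
by rewrite inE IH same_cellE [cell I v == _]eq_sym.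
Qed.

Lemma same_patternE t t' : same_pattern d I t t' = (pat (vx t) == pat (vx t')).
Proof.
rewrite /same_pattern /cell_pattern /vertices -!map_comp; elim: (iota 0 d) => //= j s IH.
by rewrite eqseq_cons IH same_cellE.
Qed.

Lemma vertices_lt t v : 0 < n -> v \in vx t -> v < n.
Proof. by move=> n0 /mapP[j _ ->]; rewrite ltn_mod. Qed.

Lemma cycle_codeE am t : 0 < n -> cycle_code d I am t = dcyc (bit am) (vx t).
Proof.
move=> n0; rewrite /cycle_code /d_cycle size_mkseq eqxx /= cycle_mkseq //.
rewrite (_ : all (fun v => (v < n) && bit am v) (vx t) =
  all (fun i => bit am (digit n t i)) (iota 0 d)); last first.
  by rewrite all_map; apply: eq_all => i /=; rewrite ltn_mod n0.
have -> : uniq (vx t) =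
    all (fun i => all (fun j => (i < j) ==> (digit n t i != digit n t j)) (iota 0 d)) (iota 0 d).
  apply/(mkseq_uniqP _ d)/allP => [inj i|h i j id jd e].
    rewrite mem_iota => /andP[_ id]; apply/allP => j; rewrite mem_iota => /andP[_ jd].
    by apply/implyP => ij; apply: contraTneq ij => /(inj _ _ id jd) ->; rewrite ltnn.
  have wl i' j' : i' < d -> j' < d -> digit n t i' = digit n t j' -> i' < j' -> false.
    move=> id' jd' e' ij'; have /h/allP/(_ j') : i' \in iota 0 d by rewrite mem_iota.
    by rewrite mem_iota jd' ij' e' eqxx => /(_ isT).
  case: (ltngtP i j) => // [/(wl _ _ id jd e)//|/(wl _ _ jd id (esym e))//].
have sp (p q : pred nat) s : all (fun i => p i && q i) s = all p s && all q s by exact: all_predI.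
by rewrite !sp [X in _ && X]andbC.
Qed.

Lemma vertices_surj c : size c = d -> all (fun v => v < n) c ->
  exists2 t, t < n ^ d & vx t = c.
Proof. by move=> sc /digit_surj[t]; rewrite sc => tl tc; exists t. Qed.

Lemma hitsE y t : 0 < n ->
  hits d I y t = has (fun v => v \in mkseq (digit n.+1 y) (capacity d)) (vx t).
Proof.
move=> n0; rewrite /hits /vertices has_map; apply: eq_has => i /=.
rewrite -[RHS]has_pred1 /mkseq has_map; apply: eq_has => j /=; exact: eq_sym.
Qed.

Lemma fvalE am m : fval d I am m = fv (bit am) (bit m).
Proof.
by rewrite /fval /packing_value big_allpairs_dep.
Qed.

Definition is_marked am (c : seq nat) :=
  has (fun t => marked d I am t && (vx t == c)) (iota 0 (n ^ d)).

(** Among all cycles with the pattern of [c] that avoid [Y], the one with the least code is marked: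
    the code [y] of [Y] is the witness. *)
Lemma marked_rep am c Y : dcyc (bit am) c -> size Y <= capacity d ->
  {in c, forall v, v \notin Y} ->
  exists c', [/\ dcyc (bit am) c', is_marked am c', pat c' = pat c & {in c', forall v, v \notin Y}].
Proof.
move=> dc sY dis; have /and4P[/eqP sc /allP cn _ _] := dc.
have [|t0 t0l t0c] := vertices_surj sc; first by apply/allP => v /cn /andP[].
have n0 := expd_gt0 t0l.
(* Elements of [Y] that are not vertices are dropped, and padding with the non-vertex [n] gives the
   fixed length required by the code. *)
pose Y' := [seq v <- Y | v < n]; pose Y2 := Y' ++ nseq (capacity d - size Y') n.
have sY' : size Y' <= capacity d by apply: leq_trans sY; rewrite size_filter count_size.
have sY2 : size Y2 = capacity d by rewrite size_cat size_nseq subnKC.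
have [|y ylt yY] := @digit_surj n.+1 Y2.
  apply/allP => v; rewrite mem_cat mem_filter => /orP[/andP[vn _]|/nseqP[-> _]] //.
  by rewrite ltnW.
rewrite sY2 in ylt yY.
have hitsY t : hits d I y t = has (fun v => v \in Y) (vx t).
  rewrite hitsE // yY; apply: eq_in_has => v /(vertices_lt n0) vn.
  rewrite mem_cat mem_filter vn /=; case: (v \in Y) => //=.
  by apply/negP => /nseqP[e _]; rewrite e ltnn in vn.
pose ok t := [&& cycle_code d I am t, same_pattern d I t t0 & ~~ hits d I y t].
have ok0 : ok t0.
  rewrite /ok cycle_codeE // t0c dc same_patternE eqxx hitsY t0c /=.
  by apply/hasPn => v /dis.
have exok : exists t, ok t by exists t0.
case: (ex_minnP exok) => t /and3P[ct pt ht] mint.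
have tl : t < n ^ d by apply: leq_ltn_trans (mint _ ok0) t0l.
exists (vx t); split.
- by rewrite -cycle_codeE.
- apply/hasP; exists t; first by rewrite mem_iota.
  rewrite eqxx andbT /marked ct; apply/hasP; exists y; first by rewrite mem_iota.
  rewrite ht; apply/allP => t'; rewrite mem_iota => /andP[_ t'l]; apply/implyP => /andP[ct' pt'].
  rewrite -[hits _ _ _ _]negbK; apply/negP => nh; have := mint t'.
  rewrite leqNgt t'l => /(_ _)/negP; case=> //; apply/and3P; split => //.
  by rewrite same_patternE (eqP (etrans (esym (same_patternE _ _)) pt')) -same_patternE.
- by rewrite same_patternE in pt; rewrite (eqP pt) t0c.
- by move=> v vt; apply: contra ht => vY; rewrite hitsY; apply/hasP; exists v.
Qed.

(** * Soundness and completeness of the dynamic programme *)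

Section DP.

Variables am g : nat.
Local Notation good := (good d I am g).
Local Notation dp := (dp_table d I am g).
Local Notation items S := (map (fun p => pos p) S).

Definition represents m (P : seq (seq nat)) := forall v, v < n -> bit m v = (v \in flatten P).

Lemma same_key_refl p m : same_key d I am g p m m.
Proof. by rewrite /same_key eqxx; apply/allP => v _; rewrite eqxx implybT. Qed.

Lemma insert_has p m acc : has (same_key d I am g p m) (insert d I am g p m acc).
Proof. by rewrite /insert; case: ifP => //= _; rewrite same_key_refl. Qed.

Lemma insert_sub p m acc : {subset acc <= insert d I am g p m acc}.
Proof. by move=> x; rewrite /insert; case: ifP => // _; rewrite inE => ->; rewrite orbT. Qed.

Lemma insert_mem p m acc x : x \in insert d I am g p m acc -> x = m \/ x \in acc.
Proof. by rewrite /insert; case: ifP => [_|_]; [right | rewrite inE => /orP[/eqP|]; [left | right]]. Qed.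

Lemma absorb_sub p acc T : {subset acc <= foldl (absorb d I am g p) acc T}.
Proof.
elim: T acc => [|m T IH] acc x xa //=; apply: IH; rewrite /absorb.
by case: ifP => _; do ?apply: insert_sub.
Qed.

Lemma absorb_mem p acc T x : x \in foldl (absorb d I am g p) acc T ->
  x \in acc \/ exists2 m, m \in T & x = m \/ ~~ has (bit m) (pos p) /\ x = add_tuple d I (code_of d I p) m.
Proof.
elim: T acc => [|m T IH] acc /=; first by left.
case/IH => [|[m' m'T h]]; last by right; exists m' => //; rewrite inE m'T orbT.
rewrite /absorb meetsE; case: ifP => hm /insert_mem[xm|].
- by right; exists m; [rewrite inE eqxx | left].
- by left.
- by right; exists m; [rewrite inE eqxx | right; rewrite hm].
- by case/insert_mem => [xm|]; [right; exists m; [rewrite inE eqxx | left] | left].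
Qed.

Lemma absorb_has p acc T m : m \in T ->
  has (same_key d I am g p m) (foldl (absorb d I am g p) acc T) /\
  (~~ has (bit m) (pos p) ->
   has (same_key d I am g p (add_tuple d I (code_of d I p) m)) (foldl (absorb d I am g p) acc T)).
Proof.
elim: T acc => // m' T IH acc; rewrite inE => /orP[/eqP <-|mT]; last exact: IH.
rewrite /=; split.
  have /hasP[x xin kx] := insert_has p m acc; apply/hasP; exists x => //.
  by apply: absorb_sub; rewrite /absorb; case: ifP => // _; apply: insert_sub.
move=> nm; have /hasP[x xin kx] :=
  insert_has p (add_tuple d I (code_of d I p) m) (insert d I am g p m acc).
by apply/hasP; exists x => //; apply: absorb_sub; rewrite /absorb meetsE (negbTE nm).
Qed.

Lemma dpS i : dp i.+1 = if good i then dp_step d I am g i (dp i) else dp i.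
Proof. by rewrite /dp_table -addn1 iotaD foldl_cat. Qed.

Lemma good_dcyc p : good p -> 0 < n -> dcyc (bit am) (pos p).
Proof. by case/andP => /andP[cp _] _ n0; rewrite -cycle_codeE. Qed.

Lemma represents_add m p P : represents m P ->
  represents (add_tuple d I (code_of d I p) m) (pos p :: P).
Proof. by move=> r v vn; rewrite bit_add_tuple vn r //= mem_cat orbC. Qed.

(** Merging states only discards some of them, so each remaining state is still the vertex set of an
    actual packing. *)
Lemma dp_sound i m : 0 < n -> m \in dp i -> exists2 P, packing (bit am) P & represents m P.
Proof.
move=> n0; elim: i m => [|i IH] m.
  by rewrite inE => /eqP ->; exists [::] => // v _; rewrite bit0.
rewrite dpS; case: ifP => [gi|_]; last exact: IH.
case/absorb_mem => // -[m' /IH[P pP rP] [->|[nm ->]]]; first by exists P.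
exists (pos i :: P); last exact: represents_add.
have dci := good_dcyc gi n0; case/andP: pP => aP uP.
rewrite /d_packing /= dci aP cat_uniq uP andbT /=.
have -> : uniq (pos i) by case/and4P: dci.
rewrite /= andbT; apply/hasPn => v vP /=; apply: contra nm => vi; apply/hasP; exists v => //.
by rewrite rP // (vertices_lt n0 vi).
Qed.

(** [live i.+1] corresponds to [pending] at [i]: the table [dp i] belongs to the moment before
    position [i] is treated. *)
Definition live i v := exists p, [/\ i <= p, p < npos d I, good p & touch d I (code_of d I p) v].

(** The vertex set of [S] itself may have been merged away. What persists is a state with the same
    value that agrees with it in all cells still to be met; by [packing_value_add] both then gain
    the same from the next cycle. *)
Lemma dp_complete i S : 0 < n -> i <= npos d I -> all (fun p => (p < i) && good p) S ->
  uniq S -> packing (bit am) (items S) ->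
  exists m, [/\ m \in dp i, fval d I am m = fv (bit am) [in flatten (items S)] &
    forall v, v < n -> live i v -> bit m v = (v \in flatten (items S))].
Proof.
move=> n0; elim: i S => [|i IH] S il aS uS pS.
  case: S aS uS pS => // _ _ _; exists 0; split; first by rewrite inE.
  - by rewrite fvalE; apply: eq_packing_value => v _; rewrite bit0.
  - by move=> v _ _; rewrite bit0.
have liveS v : live i.+1 v -> live i v.
  by move=> [p [h1 h2 h3 h4]]; exists p; split => //; exact: ltnW.
have [gi|ngi] := boolP (good i); last first.
  have [|m [mT fm am_]] := IH S (ltnW il) _ uS pS.
    apply/allP => p /(allP aS) /andP[]; rewrite ltnS leq_eqVlt => /orP[/eqP ->|-> -> //].
    by rewrite (negbTE ngi).
  exists m; split => //; first by rewrite dpS (negbTE ngi).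
  by move=> v vn /liveS; exact: am_.
have key m x : same_key d I am g i m x -> fval d I am x = fval d I am m /\
    forall v, v < n -> live i.+1 v -> bit x v = bit m v.
  case/andP => /eqP -> /allP h; split => // v vn [p [h1 h2 h3 h4]].
  have := h v; rewrite mem_iota vn => /(_ isT) /implyP; rewrite eq_sym => /(_ _)/eqP; apply.
  by apply/hasP; exists p; [rewrite mem_iota | rewrite h1 h3 h4].
have [iS|niS] := boolP (i \in S); last first.
  have [|m [mT fm am_]] := IH S (ltnW il) _ uS pS.
    apply/allP => p pS'; have := allP aS p pS'; rewrite ltnS leq_eqVlt => /andP[/orP[/eqP pi|->] ->] //.
    by rewrite -pi pS' in niS.
  have [/hasP[x xT /key[fx bx]] _] := absorb_has i [::] mT.
  exists x; split; [by rewrite dpS gi | by rewrite fx |].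
  by move=> v vn lv; rewrite bx // am_ //; exact: liveS.
pose S0 := rem i S; have pp : perm_eq S (i :: S0) by exact: perm_to_rem.
have p0 : packing (bit am) (pos i :: items S0).
  by rewrite -(packing_perm _ _ _ _ (perm_map (fun p => pos p) pp)).
have [_ pS0 dis] := @packing_cat _ _ _ _ [:: pos i] (items S0) p0.
have uS0 : uniq S0 by exact: rem_uniq.
have [|m [mT fm am_]] := IH S0 (ltnW il) _ uS0 pS0.
  apply/allP => p; rewrite mem_rem_uniq // inE => /andP[pi /(allP aS)].
  by rewrite ltnS leq_eqVlt (negbTE pi).
have dci := good_dcyc gi n0.
(* Position [i] still counts as untreated, so the state [m] agrees with [S0] in the cells of the
   cycle to be added. *)
have livei v : cell I v \in pat (pos i) -> live i v.
  by move=> h; exists i; split => //; rewrite touchE.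
have ni v : v \in pos i -> v \notin flatten (items S0).
  by move=> vi; apply: dis; rewrite /= cats0.
have nm : {in pos i, forall v, ~~ bit m v}.
  move=> v vi; rewrite am_ ?(vertices_lt n0 vi) ?ni //.
  by apply: livei; apply: map_f.
have [_ /(_ _)/hasP[|x xT /key[fx bx]]] := absorb_has i [::] mT.
  by apply/hasPn.
have mS v : (v \in flatten (items S)) = (v \in flatten (items S0)) || (v \in pos i).
  by rewrite (perm_mem (perm_flatten (perm_map (fun p => pos p) pp))) /= mem_cat orbC.
exists x; split; first by rewrite dpS gi.
  rewrite fx fvalE.
  rewrite (eq_packing_value _ _ _ (u' := fun v => bit m v || (v \in pos i))); last first.
    by move=> v vn; rewrite bit_add_tuple vn.
  rewrite [RHS](eq_packing_value _ _ _ (u' := fun v => (v \in flatten (items S0)) || (v \in pos i))) //.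
  have /and4P[/eqP size_of _ ui _] := dci.
  have := @packing_value_add n d (cell I) d_gt2 (bit am) (pos i) (bit m) [in flatten (items S0)] ui size_of.
  rewrite -fvalE fm => h; apply/eqP; rewrite -(eqn_add2r (fv (bit am) [in flatten (items S0)])).
  apply/eqP; apply: h => //.
  - by move=> v; exact: vertices_lt.
  - by move=> v vn /livei; exact: am_.
move=> v vn lv; rewrite bx // bit_add_tuple vn mS am_ //; exact: liveS.
Qed.

End DP.

(** * Correctness of the decision and of the self-reduction *)

Lemma packing_take am P k : packing am P -> k <= size P ->
  exists2 Q, packing am Q & size Q = k.
Proof.
move=> pP kP; exists (take k P); last by rewrite size_takel.
by move: pP; rewrite -{1}(cat_take_drop k P) => /packing_cat[].
Qed.

Lemma represents_count am m P : packing am P -> represents m P ->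
  count (bit m) (iota 0 n) = d * size P.
Proof.
move=> pP r; rewrite -(packing_count1 pP); apply: eq_in_count => v.
by rewrite mem_iota => /andP[_ /r].
Qed.

Lemma greedy_spec am : 0 < n ->
  (exists2 P, packing (bit am) P & represents (greedy d I am) P) /\
  (forall t, t < n ^ d -> cycle_code d I am t -> has (bit (greedy d I am)) (vx t)).
Proof.
move=> n0; rewrite /greedy; elim: (n ^ d) => [|m [[P pP rP] IH]].
  by split => //; exists [::] => // v _; rewrite bit0.
rewrite -addn1 iotaD foldl_cat add0n /=.
move: (foldl _ _ _) rP IH => g0 rP IH.
have [/andP[cm]|no] := boolP (cycle_code d I am m && ~~ meets d I m g0).
  rewrite meetsE => nm; split.
    exists (vx m :: P); last by move=> v vn; rewrite bit_add_tuple vn rP //= mem_cat orbC.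
    have dcm : dcyc (bit am) (vx m) by rewrite -cycle_codeE.
    case/andP: pP => aP uP; rewrite /d_packing [all _ _]/= dcm aP /= cat_uniq uP andbT.
    have -> : uniq (vx m) by case/and4P: dcm.
    rewrite andTb; apply/hasPn => v vP; apply: contra nm => vi; apply/hasP; exists v => //.
    by rewrite rP // (vertices_lt n0 vi).
  move=> t; rewrite addn1 ltnS leq_eqVlt => /orP[/eqP -> _|tm ct]; apply/hasP.
    have vm : digit n m 0 \in vx m by apply: map_f; rewrite mem_iota.
    by exists (digit n m 0) => //; rewrite bit_add_tuple vm orbT (vertices_lt n0 vm).
  have /hasP[v vt bv] := IH t tm ct.
  by exists v => //; rewrite bit_add_tuple bv (vertices_lt n0 vt).
split; first by exists P.
move=> t; rewrite addn1 ltnS leq_eqVlt => /orP[/eqP -> ct|tm ct]; last exact: IH.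
by move: no; rewrite ct negbK meetsE.
Qed.

Lemma key_lt c t : key d I c t < (n + radix d I + 2) * n.+1.
Proof.
rewrite /key; case: ifP => // _; first by rewrite muln_gt0 addn2.
set s := (_ %/ (4 * d) + _)%N; have hs : s <= n + radix d I.
  rewrite leq_add //; first by apply: leq_trans (leq_div _ _) (level_le _ _ _).
  by rewrite ltnW // ltn_mod.
have h0 := level_le 0 I (digit n t 0).
apply: (@leq_ltn_trans ((n + radix d I) * n.+1 + n.+1)).
  by rewrite leq_add // leq_mul2r (leq_trans (leq_div _ _) hs) orbT.
by rewrite addn2 !mulSn; lia.
Qed.

Definition position c t := key d I c t * n ^ d + t.

Lemma position_spec c t : t < n ^ d ->
  [/\ position c t < npos d I, code_of d I (position c t) = t & position c t %/ n ^ d = key d I c t].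
Proof.
move=> tl; rewrite /position; split.
- apply: (@leq_trans ((key d I c t).+1 * n ^ d)); first by rewrite mulSn addnC ltn_add2r.
  by rewrite /npos leq_mul2r key_lt orbT.
- by rewrite /code_of modnMDl modn_small.
- by rewrite divnMDl ?divn_small ?addn0 // (leq_ltn_trans _ tl).
Qed.

(** Normalizing a packing may lower its number of cycles but not its value. The table therefore
    optimizes the value, and [packing_value_attained] turns a value back into cycles. *)
Lemma decideP am k : 0 < n ->
  decide d I am k <-> exists2 P, packing (bit am) P & size P = k.
Proof.
move=> n0; have [[G pG rG] _] := greedy_spec am n0.
rewrite /decide (represents_count pG rG) leq_pmul2l //; split.
  case/orP => [|/hasP[m /(dp_sound n0)[P pP rP] km]]; first exact: packing_take.
  have [Q [pQ sQ]] := packing_value_attained d_gt2 (@cell_adj R I) pP rP.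
  by apply: (packing_take pQ); rewrite sQ -fvalE.
case=> P pP sP; apply/orP; right.
have [P1 [pP1 le1 few1]] := few_per_pattern d_gt2 (@cell_bound R I) pP.
have [P2 [pP2 mP2 eP2]] := marked_packing d_gt2 (@adj_near R I) (@marked_rep am) pP1 few1.
set g := best d I am.
have [S [aS iS]] : exists S, all (fun p => (p < npos d I) && good d I am g p) S /\
    map (fun p => pos p) S = P2.
  elim: P2 mP2 {pP2 eP2} => [|c P2 IH] /=; first by exists [::].
  case/andP => /hasP[t]; rewrite mem_iota => /andP[_ tl] /andP[mt /eqP tc] /IH[S [aS <-]].
  have [h1 h2 h3] := position_spec g tl.
  by exists (position g t :: S); rewrite /= aS h1 /good h2 mt h3 eqxx tc.
have uS : uniq S.
  have : uniq (flatten (map (fun p => pos p) S)) by rewrite iS; case/andP: pP2.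
  elim: S {aS iS} => //= p S IH; rewrite cat_uniq => /and3P[_ h /IH ->]; rewrite andbT.
  apply: contra h => pS; apply/hasP; exists (digit n (code_of d I p) 0).
    by apply/flattenP; exists (pos p); [exact: map_f | apply: map_f; rewrite mem_iota].
  by apply: map_f; rewrite mem_iota.
rewrite -iS in pP2; have [m [mT fm _]] := dp_complete n0 (leqnn _) aS uS pP2.
apply/hasP; exists m => //; rewrite fm iS -eP2 -sP; apply: leq_trans le1.
exact: (packing_value_size _ d_gt2 pP).
Qed.

Lemma bit_remaining (acc : seq nat) v : bit (remaining I acc) v = (v < n) && (v \notin acc).
Proof. exact: bit_mask. Qed.

Lemma sub_packing (al al' : pred nat) P : (forall v, v < n -> al v -> al' v) ->
  packing al P -> packing al' P.
Proof.
move=> sub /andP[aP uP]; rewrite /d_packing uP andbT; apply: sub_all aP => c.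
case/and4P => h1 h2 h3 h4; apply/and4P; split => //.
by apply: sub_all h2 => v /andP[vn av]; rewrite vn sub.
Qed.

Lemma solution_spec : 0 < n -> decide d I (mask n xpredT) (param_of I) ->
  exists2 P, packing xpredT P & size P = param_of I /\ flatten P = solution d I.
Proof.
move=> n0 /(decideP _ _ n0)[P0 pP0 sP0].
(* Invariant: the vertices left by the [i] chosen cycles still contain a packing [Q] with all
   missing cycles. Its first cycle shows that the search succeeds, and the test by [decide] restores
   the invariant. *)
suff H i : i <= param_of I -> exists2 P, packing xpredT P & [/\ size P = i,
    flatten P = partial_solution d I i &
    exists2 Q, packing (bit (remaining I (flatten P))) Q & size Q = param_of I - i].
  by have [P pP [sP fP _]] := H _ (leqnn _); exists P.
elim: i => [_|i IH ik].
  exists [::] => //; split => //; exists P0; last by rewrite subn0.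
  by apply: sub_packing pP0 => v vn _; rewrite bit_remaining vn.
have [P pP [sP fP [Q pQ sQ]]] := IH (ltnW ik).
set acc := flatten P in fP pQ.
pose ok t := cycle_code d I (remaining I acc) t &&
  decide d I (remaining I (vx t ++ acc)) (param_of I - i.+1).
have remP c Q' : packing (bit (remaining I acc)) (c :: Q') -> forall v, v < n ->
    v \in flatten Q' -> bit (remaining I (c ++ acc)) v.
  move=> pcQ v vn vQ; rewrite bit_remaining vn mem_cat negb_or.
  have [_ pQ' dis] := @packing_cat _ _ _ _ [:: c] Q' pcQ.
  have [_] := packing_lt pQ' vQ; rewrite bit_remaining => /andP[_ ->]; rewrite andbT.
  by apply/negP => vc; have := dis v; rewrite /= cats0 vc vQ => /(_ isT).
have hok : has ok (iota 0 (n ^ d)).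
  case: Q pQ sQ => [|c Q] pQ sQ; first by move: sQ; rewrite /=; lia.
  have /andP[/= /andP[dc aQ] uQ] := pQ; have /and4P[/eqP sc /allP cn _ _] := dc.
  have [|t tl tc] := vertices_surj sc; first by apply/allP => v /cn /andP[].
  apply/hasP; exists t; first by rewrite mem_iota.
  rewrite /ok cycle_codeE // tc dc; apply/(decideP _ _ n0); exists Q; last first.
    by move: sQ; rewrite /= subnS => <-.
  have [_ pQ' _] := @packing_cat _ _ _ _ [:: c] Q pQ.
  case/andP: pQ' => aQ' uQ'; rewrite /d_packing uQ' andbT; apply/allP => c' c'Q.
  have /and4P[h1 h2 h3 h4] := allP aQ' c' c'Q; apply/and4P; split => //.
  apply/allP => v vc'; have /andP[vn _] := allP h2 v vc'; rewrite vn.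
  by apply: (remP c Q pQ) => //; apply/flattenP; exists c'.
have := nth_find 0 hok; have : find ok (iota 0 (n ^ d)) < n ^ d.
  by rewrite -[ltnRHS](size_iota 0) -has_find.
move=> fl; rewrite nth_iota // add0n.
have pS : partial_solution d I i.+1 =
  vx (pick_cycle d I (param_of I - i.+1) (partial_solution d I i)) ++ partial_solution d I i by [].
rewrite -fP in pS.
have tE : find ok (iota 0 (n ^ d)) = pick_cycle d I (param_of I - i.+1) acc by [].
rewrite tE in fl *; move: (pick_cycle _ _ _ _) pS fl {tE} => t pS tl.
rewrite /ok => /andP[ct /(decideP _ _ n0) [Q' pQ' sQ']].
rewrite cycle_codeE // in ct.
exists (vx t :: P); last first.
  split; [by rewrite /= sP | by rewrite pS | by exists Q'].
case/andP: pP => aP uP; rewrite /d_packing [all _ _]/= aP /= cat_uniq uP andbT.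
have /and4P[h1 h2 h3 h4] := ct.
rewrite h3; apply/andP; split; last first.
  rewrite andTb andbT; apply/hasPn => v vP; apply/negP => vt; have /andP[_] := allP h2 v vt.
  by rewrite bit_remaining vP andbF.
by apply/and4P; split => //; apply/allP => v /(allP h2) /andP[->].
Qed.

End Correctness.

(** * Combinatorics of representatives, strips and shifts *)

Fixpoint Phi d q := if q is q'.+1 then (d * Phi d q').+1 else 1.

(** If [t] is first in [F] to avoid [Y0 ++ Z t] and [t1] is first to avoid [Y0], then either [t = t1]
    or [Z t] meets [t1], and a common element can be moved from [Z t] to [Y0]. *)
Lemma representatives_bound (A : eqType) (vs : nat -> seq A) d (F : pred nat) q
    (Y0 : seq A) (s : seq nat) (Z : nat -> seq A) :
  (forall t, size (vs t) = d) -> uniq s ->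
  (forall t, t \in s -> [/\ F t, size (Z t) <= q, ~~ has [in Y0 ++ Z t] (vs t) &
     forall t', t' < t -> F t' -> has [in Y0 ++ Z t] (vs t')]) ->
  size s <= Phi d q.
Proof.
move=> svs; elim: q Y0 s Z => [|q IH] Y0 s Z us H.
  case: s us H => [|t [|t' s]] //= /andP[]; rewrite inE negb_or => /andP[tt' _] _ H.
  have [Ft Zt at_ mt] := H t (mem_head _ _).
  have [|Ft' Zt' at' mt'] := H t'; first by rewrite !inE eqxx orbT.
  move: Zt Zt' at_ at' mt mt'; rewrite !leqn0 => /nilP -> /nilP -> at_ at' mt mt'.
  case: (ltngtP t t') tt' => // [lt|gt] _.
    by have := mt' t lt Ft; rewrite (negbTE at_).
  by have := mt t' gt Ft'; rewrite (negbTE at').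
case: (posnP (size s)) => [->//|s0].
have [t0 t0s] : exists t0, t0 \in s by exists (nth 0 s 0); exact: mem_nth.
pose ok t := F t && ~~ has [in Y0] (vs t).
have mono Z' t : ~~ has [in Y0 ++ Z'] (vs t) -> ~~ has [in Y0] (vs t).
  by apply: contra => /hasP[v vt vY]; apply/hasP; exists v => //=; rewrite mem_cat; apply/orP; left.
have exok : exists t, ok t.
  by exists t0; have [Ft _ at_ _] := H t0 t0s; rewrite /ok Ft (mono _ _ at_).
case: (ex_minnP exok) => t1 /andP[F1 a1] min1.
have sub : size s <= size [seq t <- s | t == t1] +
    \sum_(v <- vs t1) size [seq t <- s | v \in Z t].
  rewrite size_filter -[size s](count_predC (pred1 t1)) leq_add2l.
  rewrite -size_filter; set s' := filter _ s.
  have : forall t, t \in s' -> has (fun v => v \in Z t) (vs t1).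
    move=> t; rewrite mem_filter => /andP[/= tt1 ts]; have [Ft Zt at_ mt] := H t ts.
    have le : t1 <= t by apply: min1; rewrite /ok Ft (mono _ _ at_).
    have lt : t1 < t by rewrite ltn_neqAle eq_sym tt1.
    have /hasP[v v1] := mt t1 lt F1; rewrite /= mem_cat => /orP[vY|vZ].
      by case/hasP: a1; exists v.
    by apply/hasP; exists v.
  have ss' (p : pred nat) : size [seq t <- s' | p t] <= size [seq t <- s | p t].
    by rewrite !size_filter /s' count_filter; apply: sub_count => t /andP[].
  move=> covered; apply: (@leq_trans (\sum_(v <- vs t1) size [seq t <- s' | v \in Z t])); last first.
    by apply: leq_sum => v _; exact: ss'.
  elim: s' covered {ss'} => //= t s' IHs covered.
  rewrite (eq_bigr (fun v => (v \in Z t) + size [seq t <- s' | v \in Z t])); last first.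
    by move=> v _; case: ifP.
  rewrite big_split /= -add1n leq_add //; last by apply: IHs => t' h; apply: covered; rewrite inE h orbT.
  have /hasP[v v1 vZ] := covered t (mem_head _ _).
  by rewrite (big_rem v) //= vZ.
(* The tuple [t1] accounts for the summand 1 of [Phi]; each of its [d] vertices opens one branch, in
   which [q] has decreased. *)
apply: leq_trans sub _; rewrite /= -add1n leq_add //.
  by rewrite size_filter count_uniq_mem // leq_b1.
apply: (@leq_trans (size (vs t1) * Phi d q)); last by rewrite svs.
apply: sum_const_le => v vt1.
apply: (IH (v :: Y0) _ (fun t => rem v (Z t))); first exact: filter_uniq.
move=> t; rewrite mem_filter => /andP[vZ ts]; have [Ft Zt at_ mt] := H t ts.
have eqm x : (x \in (v :: Y0) ++ rem v (Z t)) = (x \in Y0 ++ Z t).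
  rewrite /= inE !mem_cat (perm_mem (perm_to_rem vZ) x) inE.
  by case: (x == v); rewrite ?orbT.
split => //.
- by rewrite size_rem //; case: (size (Z t)) Zt => //.
- by rewrite (eq_has eqm).
- by move=> t' lt Ft'; rewrite (eq_has eqm); exact: mt.
Qed.

(** Between different strips lies a multiple of [l], and numbers at distance at most 1 that both
    avoid the multiples cannot lie on opposite sides of one. *)
Lemma strip_unique l s s' : 0 < l -> s %% l != 0 -> s' %% l != 0 -> s <= s'.+1 -> s' <= s.+1 ->
  s %/ l = s' %/ l.
Proof.
move=> l0 h h' le le'.
have := divn_eq s l; have := divn_eq s' l.
have := ltn_pmod s l0; have := ltn_pmod s' l0; move: h h'.
move: (s %% l) (s' %% l) (s %/ l) (s' %/ l) => a a' q q' h h' al al' e' e.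
case: (ltngtP q q') => // lt.
  have : q.+1 * l <= q' * l by rewrite leq_mul2r lt orbT.
  by rewrite mulSn; lia.
have : q'.+1 * l <= q * l by rewrite leq_mul2r lt orbT.
by rewrite mulSn; lia.
Qed.

(** A key squeezed between two keys of the same strip determines that strip, and a column within [w]
    of the smaller one. The predecessor undoes the shift by 1 that reserves key 0. *)
Lemma interval_digits m q kp a1 a2 w : a1 <= m -> a2 <= m ->
  q * m.+1 + a1.+1 <= kp -> kp <= q * m.+1 + a2.+1 -> a2 <= a1 + w ->
  kp.-1 %/ m.+1 = q /\ a1 <= kp.-1 %% m.+1 <= a1 + w.
Proof.
move=> h1 h2 le1 le2 le3.
have e1 : kp.-1 = q * m.+1 + (kp.-1 - q * m.+1) by lia.
have lt1 : kp.-1 - q * m.+1 < m.+1 by lia.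
rewrite e1 divnMDl // modnMDl divn_small // modn_small // addn0; split => //.
by lia.
Qed.

Lemma one_shift l b : 0 < l -> count (fun r => (b + r) %% l == 0) (iota 0 l) <= 1.
Proof.
move=> l0; pose r0 := if b %% l == 0 then 0 else l - b %% l.
rewrite (@eq_in_count _ _ (pred1 r0)); first by rewrite count_uniq_mem ?iota_uniq // leq_b1.
move=> r; rewrite mem_iota => /andP[_ rl] /=; rewrite -modnDml /r0.
have := ltn_pmod b l0; move: (b %% l) => a al.
have [lt|ge] := ltnP (a + r) l.
  by rewrite modn_small //; case: (posnP a) lt => [->|a0] lt; rewrite ?eqxx ?(gtn_eqF a0); apply/eqP/eqP; lia.
rewrite -(subnKC ge) modnDl modn_small; last by lia.
by case: (posnP a) ge => [->|a0] ge; rewrite ?eqxx ?(gtn_eqF a0); apply/eqP/eqP; lia.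
Qed.

(** Averaging: each element is selected by at most one of the [l] shifts, so the counts add up to at
    most [size M]. *)
Lemma good_shift (A : eqType) (M : seq A) (f : A -> nat) l : 0 < l ->
  exists2 r, r < l & count (fun t => (f t + r) %% l == 0) M * l <= size M.
Proof.
move=> l0; pose cnt r := count (fun t => (f t + r) %% l == 0) M.
have tot : \sum_(r <- iota 0 l) cnt r <= size M.
  rewrite /cnt; elim: M {cnt} => [|t M IH] /=; first by rewrite big1.
  rewrite big_split /= -add1n leq_add // (leq_trans _ (one_shift (f t) l0)) //.
  by elim: (iota 0 l) => [|r s IHs]; rewrite ?big_nil // big_cons /= leq_add2l.
have [/hasP[r]|/hasPn h] := boolP (has (fun r => cnt r * l <= size M) (iota 0 l)).
  by rewrite mem_iota => /andP[_ rl] le; exists r.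
have : l * (size M).+1 <= (\sum_(r <- iota 0 l) cnt r) * l.
  rewrite big_distrl /= -{1}(size_iota 0 l).
  elim: (iota 0 l) h => [|r s IHs] h; first by rewrite big_nil.
  rewrite big_cons mulSn leq_add ?IHs // => [|r' r's]; last by apply: h; rewrite inE r's orbT.
  by rewrite ltnNge; apply: h; rewrite inE eqxx.
move=> le; have := leq_trans le (leq_mul tot (leqnn l)).
by rewrite mulnC leq_pmul2r // ltnn.
Qed.

(** * Width of the sweep *)

Section Width.

Variables (R : realType) (d : nat).
Hypothesis d_gt2 : 2 < d.
Variables (I : instance R) (am : nat).
Local Notation n := (size_of I).
Hypothesis n_gt0 : 0 < n.
Local Notation vx t := (vertices d I t).
Local Notation dcyc := (d_cycle n d (adj I)).
Local Notation pat := (cell_pattern (cell I)).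
Local Notation reps := (Phi d (capacity d)).
Local Notation hd t := (digit n t 0).

Let d_gt0 : 0 < d. Proof. by lia. Qed.

Definition marks := [seq t <- iota 0 (n ^ d) | marked d I am t].

Lemma marksP t : t \in marks -> [/\ t < n ^ d, marked d I am t & dcyc (bit am) (vx t)].
Proof.
rewrite mem_filter mem_iota => /andP[mt /andP[_ tl]]; split => //.
by case/andP: mt => ct _; rewrite -cycle_codeE.
Qed.

Lemma head_vertices t : head 0 (vx t) = hd t.
Proof. by rewrite -nth0 nth_mkseq. Qed.

Lemma marks_per_pattern pi : count (fun t => pat (vx t) == pi) marks <= reps.
Proof.
(* Choosing the least witness gives each marked cycle one definite set that it is first to avoid, as
   [representatives_bound] requires. *)
pose wit t := find (fun y => ~~ hits d I y t &&
    all (fun t' => cycle_code d I am t' && same_pattern d I t' t ==> hits d I y t') (iota 0 t))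
    (iota 0 (n.+1 ^ capacity d)).
rewrite -size_filter.
apply: (@representatives_bound _ (fun t => vx t) d (fun t => cycle_code d I am t && (pat (vx t) == pi))
  _ [::] _ (fun t => mkseq (digit n.+1 (wit t)) (capacity d))).
- by move=> t; rewrite size_mkseq.
- by rewrite !filter_uniq // iota_uniq.
move=> t; rewrite mem_filter => /andP[pt tm]; have [tl mt _] := marksP tm.
case/andP: mt => ct hy; have := nth_find 0 hy.
rewrite nth_iota ?add0n -/(wit t); last by move: hy; rewrite has_find size_iota.
move: (wit t) => y /andP[hit ha]; split.
- by rewrite ct pt.
- by rewrite size_mkseq.
- by rewrite -hitsE.
- move=> t' lt /andP[ct' pt']; rewrite -hitsE //.
  have := allP ha t'; rewrite mem_iota lt => /(_ isT) /implyP; apply.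
  by rewrite ct' same_patternE (eqP pt) (eqP pt') eqxx.
Qed.

Lemma count_marks (f : pred nat) (L : seq (seq (nat * nat))) :
  (forall t, t \in marks -> f t -> pat (vx t) \in L) -> count f marks <= size L * reps.
Proof.
move=> h; rewrite -size_filter.
have : forall t, t \in filter f marks -> pat (vx t) \in L.
  by move=> t; rewrite mem_filter => /andP[ft tm]; apply: h.
move/count_cover => le; apply: leq_trans le _; apply: sum_const_le => x _.
apply: leq_trans (marks_per_pattern x); rewrite count_filter.
by apply: sub_count => t /andP[].
Qed.

Lemma marks_words m x t : t \in marks -> near m x (cell I (hd t)) ->
  pat (vx t) \in words (window (m + 2 * d) x) d.
Proof.
move=> /marksP[_ _ dct] h; apply: (dcyc_words d_gt2 (@adj_near R I) dct).
by rewrite head_vertices.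
Qed.

(** The number of patterns over a window of radius [m]. *)
Definition npat m := ((2 * m).+1 ^ 2) ^ d.

(** The greedy packing is maximal, so each marked cycle passes through one of its fewer than [d * k]
    vertices, and all its cells lie within $2d + 2d$ of the cell of that vertex. *)
Lemma size_marks k : count (bit (greedy d I am)) (iota 0 n) < d * k ->
  size marks <= d * k * npat (4 * d) * reps.
Proof.
move=> lt; have [_ gmax] := greedy_spec d_gt2 am n_gt0.
pose L := [seq w | v <- filter (bit (greedy d I am)) (iota 0 n),
                   w <- words (window (2 * d + 2 * d) (cell I v)) d].
rewrite -count_predT; apply: (@leq_trans (size L * reps)).
  apply: count_marks => t tm _; have [tl mt dct] := marksP tm.
  case/andP: mt => ct _; have /hasP[v vt bv] := gmax t tl ct.
  apply/allpairsPdep; exists v, (pat (vx t)); split => //.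
    by rewrite mem_filter bv mem_iota (vertices_lt n_gt0 vt).
  apply: marks_words => //; rewrite near_sym -head_vertices.
  exact: (dcyc_near d_gt2 (@adj_near R I) dct vt).
rewrite leq_mul2r; apply/orP; right; rewrite size_allpairs_dep.
apply: (@leq_trans (count (bit (greedy d I am)) (iota 0 n) * npat (4 * d))); last first.
  by rewrite leq_mul2r ltnW ?orbT.
rewrite -size_filter; elim: (filter _ _) => //= v s IH.
have e4 : 2 * d + 2 * d = 4 * d by rewrite -mulnDl.
by rewrite mulSn leq_add // size_words size_window e4.
Qed.

Variable c : nat.
Local Notation key := (key d I c).
Local Notation good := (good d I am c).
Local Notation l := (c %/ radix d I).+1.
Local Notation shift := (c %% radix d I).

(** The height [4 * d] ensures that cycles with a common cell start in equal or adjacent blocks, so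
    that a single selected block separates two strips. *)
Definition block t := level 1 I (hd t) %/ (4 * d).
Definition separator t := (block t + shift) %% l == 0.

Lemma keyE t : key t = if separator t then 0
  else (block t + shift) %/ l * n.+1 + (level 0 I (hd t)).+1.
Proof. by []. Qed.

Lemma goodP p : good p -> code_of d I p \in marks /\ key (code_of d I p) = p %/ n ^ d.
Proof.
case/andP => mp /eqP kp; split => //; rewrite mem_filter mp mem_iota ltn_mod.
by rewrite expn_gt0 n_gt0.
Qed.

(** These are the cells in columns $a - 4d, \dots, a$ of strip [q]. Here [j.1] is the block within
    the strip and [j.2] the row within the block; the shift is undone at the end. *)
Definition strip_cells a q : seq (nat * nat) :=
  [seq (a + i - 4 * d, (q * l + j.1) * (4 * d) + j.2 - shift * (4 * d)) |
     i <- iota 0 (4 * d).+1, j <- [seq (j1, j2) | j1 <- iota 0 l, j2 <- iota 0 (4 * d)]].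

(** Comparing keys instead of positions includes all treated cycles, and the key alone already
    locates the current strip and column. *)
Definition active p t :=
  (key t <= p %/ n ^ d) && has (fun v => pending d I am c p v) (vx t).

Lemma near_block x y : near (4 * d) x y -> x.2 %/ (4 * d) <= (y.2 %/ (4 * d)).+1.
Proof.
move=> /and4P[_ _ h _]; have w0 : 0 < 4 * d by rewrite muln_gt0.
apply: leq_trans (leq_div2r _ h) _.
by rewrite divnDr ?dvdnn // divnn w0 addn1.
Qed.


(** Let [t] share a cell with an untreated cycle [t2]. The current key lies between their keys, so
    [t2] is no separator either and both are in the same strip. Their columns differ by at most
    [4 * d], and the current column lies between them. *)
Lemma active_cell p t : t \in marks -> active p t -> ~~ separator t ->
  cell I (hd t) \in strip_cells ((p %/ n ^ d).-1 %% n.+1) ((p %/ n ^ d).-1 %/ n.+1).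
Proof.
move=> tm /andP[kt /hasP[v vt /hasP[p2 _ /and3P[pp2 gp2 tv]]]] st.
move: tv; rewrite touchE => /mapP[u ut2 cvu].
have [t2m k2] := goodP gp2; set t2 := code_of d I p2 in t2m k2 ut2.
have [_ _ dct] := marksP tm; have [_ _ dct2] := marksP t2m.
have nr : near (4 * d) (cell I (hd t)) (cell I (hd t2)).
  have h1 := dcyc_near d_gt2 (@adj_near R I) dct vt.
  have := dcyc_near d_gt2 (@adj_near R I) dct2 ut2; rewrite -cvu near_sym => h2.
  by have := near_trans h1 h2; rewrite !head_vertices -mulnDl.
have kt2 : p %/ n ^ d <= key t2 by rewrite k2 leq_div2r // ltnW.
have st2 : ~~ separator t2.
  by apply/negP => s2; move: (leq_trans kt kt2); rewrite !keyE s2 (negbTE st) addnS ltn0.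
have eQ : (block t + shift) %/ l = (block t2 + shift) %/ l.
  apply: strip_unique => //; rewrite -addSn leq_add2r; first exact: near_block nr.
  by rewrite near_sym in nr; exact: (near_block nr).
move: kt kt2 (nr); rewrite !keyE (negbTE st) (negbTE st2) -eQ => kt kt2 /and4P[/= n1 n2 _ _].
have a1 := level_le 0 I (hd t); have a2 := level_le 0 I (hd t2).
have [-> /andP[lb ub]] := interval_digits a1 a2 kt kt2 n2.
move: (_ %% n.+1) lb ub => b lb ub.
have w0 : 0 < 4 * d by rewrite muln_gt0.
apply/allpairsP; exists (level 0 I (hd t) + 4 * d - b,
  ((block t + shift) %% l, level 1 I (hd t) %% (4 * d))); split.
- by rewrite mem_iota /= add0n ltnS leq_subLR leq_add2r.
- by apply: allpairs_f; rewrite mem_iota /= ltn_mod.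
rewrite /cell /= -divn_eq mulnDl -addnA [shift * _ + _]addnC addnA addnK -divn_eq.
by rewrite subnKC // addnK.
Qed.

Lemma size_strip_cells a q : size (strip_cells a q) = (4 * d).+1 * (l * (4 * d)).
Proof. by rewrite !size_allpairs !size_iota. Qed.

Lemma count_active p :
  count (active p) marks <=
  count separator marks + (4 * d).+1 * (l * (4 * d)) * npat (2 * d) * reps.
Proof.
set a := (p %/ n ^ d).-1 %% n.+1; set q := (p %/ n ^ d).-1 %/ n.+1.
apply: (@leq_trans (count separator marks + count (fun t => active p t && ~~ separator t) marks)).
  rewrite -count_predUI; apply: leq_trans (leq_addr _ _); apply: sub_count => t /= ->.
  by case: (separator t).
rewrite leq_add2l.
pose L := [seq w | x <- strip_cells a q, w <- words (window (0 + 2 * d) x) d].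
apply: (@leq_trans (size L * reps)).
  apply: count_marks => t tm /andP[at_ st].
  apply/allpairsPdep; exists (cell I (hd t)), (pat (vx t)); split => //.
    exact: active_cell.
  by apply: marks_words => //; rewrite /near !addn0 !leqnn.
rewrite leq_mul2r; apply/orP; right; rewrite size_allpairs_dep -(size_strip_cells a q).
elim: (strip_cells a q) => //= x s IH.
by rewrite mulSn leq_add // size_words size_window add0n.
Qed.

(** A vertex that is both covered and pending lies on an active cycle, and each of these has [d]
    vertices. *)
Lemma width_bound : width d I am c <=
  d * (count separator marks + (4 * d).+1 * (l * (4 * d)) * npat (2 * d) * reps).
Proof.
rewrite /width big_seq; elim/big_ind: _ => // [x y hx hy|p _]; first by rewrite geq_max hx.
apply: leq_trans (leq_mul (leqnn d) (count_active p)).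
rewrite -!size_filter; set E := filter (active p) marks.
have -> : d * size E = size (flatten (map (fun t => vx t) E)).
  rewrite (size_flatten_const (d := d)) ?size_map //.
  by rewrite all_map; apply/allP => t _ /=; rewrite size_mkseq.
apply: uniq_leq_size; first by rewrite filter_uniq // iota_uniq.
move=> v; rewrite mem_filter => /andP[/andP[/hasP[p' _ /and3P[pp gp]] vp fv_] _].
move: vp; rewrite onE => vp.
have [tm kt] := goodP gp; apply/flattenP; exists (vx (code_of d I p')) => //.
apply/mapP; exists (code_of d I p') => //; rewrite mem_filter tm andbT /active kt leq_div2r //.
by apply/hasP; exists v.
Qed.

End Width.

Lemma uniq_map_refine (A B C : eqType) (f : A -> B) (h : A -> C) s :
  uniq (map f s) -> {in s &, forall x y, h x = h y -> f x = f y} -> uniq (map h s).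
Proof.
elim: s => //= x s IH /andP[fx us] hf; rewrite IH //; last first.
  by move=> y z ys zs; apply: hf; rewrite inE ?ys ?zs orbT.
rewrite andbT; apply: contra fx => /mapP[y ys e].
by apply/mapP; exists y => //; apply: hf; rewrite ?inE ?eqxx ?ys ?orbT.
Qed.

(** * Choice of the period and size of the tables *)

Section Tractable.

Variables (R : realType) (d : nat).
Hypothesis d_gt2 : 2 < d.
Implicit Types I : instance R.

Let d_gt0 : 0 < d. Proof. by lia. Qed.

Lemma best_min I am c : c < radix d I * radix d I ->
  width d I am (best d I am) <= width d I am c.
Proof.
rewrite /best; set f := fun b c => _; move: (radix d I * radix d I) => m.
have mono s b : width d I am (foldl f b s) <= width d I am b.
  elim: s b => //= x s IH b; apply: leq_trans (IH _) _.
  by rewrite /f; case: ifP => // /ltnW.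
elim: m => // m IH; have -> : iota 0 m.+1 = iota 0 m ++ [:: m] by rewrite -addn1 iotaD.
rewrite foldl_cat /= ltnS leq_eqVlt.
move: (foldl f 0 (iota 0 m)) IH => b IH /orP[/eqP -> |/IH le]; rewrite /f; case: ifP => //.
- by move/negbT; rewrite -leqNgt.
- by move/ltnW => h; apply: leq_trans h le.
Qed.

Definition mark_rate := d * npat d (4 * d) * Phi d (capacity d).

(** The successor accounts for the separators and the product under it for the other active cycles
    per unit of the period; [mark_rate] is the factor between the period and $\sqrt k$, and [d]
    turns cycles into vertices. *)
Definition width_rate :=
  d * (mark_rate * ((4 * d).+1 * (4 * d) * npat d (2 * d) * Phi d (capacity d)).+1).

Lemma Phi_gt0 q : 0 < Phi d q.
Proof. by case: q. Qed.

Lemma mark_rate_gt0 : 0 < mark_rate.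
Proof. by rewrite !muln_gt0 d_gt0 /npat !expn_gt0 Phi_gt0. Qed.

(** A period $L$ equal to [mark_rate] times $\lfloor\sqrt k\rfloor + 1$ balances [width_bound]:
    averaging leaves at most [mark_rate * k / L] separators, which is at most $L$, and the others
    number at most a constant times $L$. *)
Lemma best_width I am k : 0 < size_of I ->
  count (bit (greedy d I am)) (iota 0 (size_of I)) < d * k ->
  width d I am (best d I am) <= width_rate * (PeanoNat.Nat.sqrt k).+1.
Proof.
move=> n0 lt; have := size_marks d_gt2 n0 lt.
set s := (PeanoNat.Nat.sqrt k).+1; have ks : k <= s * s.
  by have [_] := PeanoNat.Nat.sqrt_spec k (PeanoNat.Nat.le_0_l k); rewrite /s; lia.
have K0 := mark_rate_gt0; rewrite (_ : d * k * _ * _ = mark_rate * k); last first.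
  by rewrite /mark_rate; lia.
move=> sM; pose L0 := mark_rate * s; pose L := minn L0 (radix d I).
have L00 : 0 < L by rewrite /L leq_min muln_gt0 K0 /=.
have [r rL cnt] := good_shift (marks d I am) (block d I) L00.
have Lr : L <= radix d I by exact: geq_minr.
pose c := L.-1 * radix d I + r.
have cdiv : c %/ radix d I = L.-1.
  by rewrite /c divnMDl // divn_small ?addn0 // (leq_trans rL).
have cmod : c %% radix d I = r by rewrite /c modnMDl modn_small // (leq_trans rL).
have cell : c < radix d I * radix d I.
  apply: (@leq_trans (L * radix d I)); last by rewrite leq_mul2r Lr orbT.
  have -> : L * radix d I = radix d I + L.-1 * radix d I by rewrite -mulSn prednK.
  by rewrite /c addnC ltn_add2r (leq_trans rL).
apply: leq_trans (best_min am cell) _; apply: leq_trans (width_bound d_gt2 am n0 c) _.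
have -> : count (separator d I c) (marks d I am) =
    count (fun t => (block d I t + r) %% L == 0) (marks d I am).
  by apply: eq_count => t; rewrite /separator cdiv cmod prednK.
rewrite cdiv prednK //.
have cL : count (fun t => (block d I t + r) %% L == 0) (marks d I am) <= L0.
  move: (count _ _) cnt => x cnt; have [le|gt] := leqP L0 (radix d I).
    have eL : L = L0 by exact/minn_idPl.
    rewrite -(leq_pmul2r L00); apply: leq_trans cnt _; apply: leq_trans sM _.
    rewrite eL /L0 mulnACA; apply: (@leq_trans (mark_rate * (s * s))); first by rewrite leq_mul2l ks orbT.
    by rewrite leq_mul2r leq_pmulr // orbT.
  (* The ideal period is beyond those tried. There are fewer marked cycles than [radix d I], so the
     average, and hence the count [x], is zero. *)
  have eL : L = radix d I by apply/minn_idPr; exact: ltnW.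
  have : size (marks d I am) <= size_of I ^ d.
    by rewrite /marks size_filter -[leqRHS](size_iota 0) count_size.
  case: x cnt => // x cnt sm; have := leq_trans cnt sm; rewrite eL mulSn /radix; lia.
rewrite /width_rate -[d * _ * s]mulnA leq_mul2l; apply/orP; right.
have LL : L <= L0 by exact: geq_minl.
apply: (@leq_trans (L0 + (4 * d).+1 * (L0 * (4 * d)) * npat d (2 * d) * Phi d (capacity d))).
  by apply: leq_add => //; do 2![apply: leq_mul => //]; apply: leq_mul => //; apply: leq_mul.
by rewrite /L0; move: (npat _ _) (Phi _ _) => a b; lia.
Qed.


Section TableSize.

Variables (I : instance R) (am g : nat).
Hypothesis n_gt0 : 0 < size_of I.
Local Notation dp := (dp_table d I am g).

(** The relation [same_key] becomes equality of these values, so that the states of a table can be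
    counted by their possible keys. *)
Definition table_key p m :=
  (fval d I am m, map (bit m) (filter (pending d I am g p) (iota 0 (size_of I)))).

Lemma same_keyE p m m' : same_key d I am g p m m' = (table_key p m == table_key p m').
Proof.
rewrite /same_key /table_key xpair_eqE; congr (_ && _).
elim: (iota 0 (size_of I)) => //= v s IH; case: ifP => _ /=; last exact: IH.
by rewrite eqseq_cons IH.
Qed.

Lemma insert_uniq p m acc : uniq (map (table_key p) acc) ->
  uniq (map (table_key p) (insert d I am g p m acc)).
Proof.
move=> ua; rewrite /insert; case: ifP => //= /negbT h; rewrite ua andbT.
apply: contra h => /mapP[m' ma e]; apply/hasP; exists m' => //.
by rewrite same_keyE e.
Qed.

Lemma dp_step_uniq p T : uniq (map (table_key p) (dp_step d I am g p T)).
Proof.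
rewrite /dp_step -[foldl _ _ _]/(foldl (absorb d I am g p) [::] T).
have : uniq (map (table_key p) [::]) by [].
elim: T [::] => //= m T IH acc ua; apply: IH; rewrite /absorb.
by case: ifP => _; do ?apply: insert_uniq.
Qed.

Lemma dp_covered i m v : m \in dp i -> bit m v ->
  v < size_of I /\ exists p, [/\ p < i, good d I am g p & v \in vertices d I (code_of d I p)].
Proof.
elim: i m => [|i IH] m; first by rewrite inE => /eqP ->; rewrite bit0.
have wk m' : m' \in dp i -> bit m' v -> v < size_of I /\
    exists p, [/\ p < i.+1, good d I am g p & v \in vertices d I (code_of d I p)].
  move=> m'i bv; have [vn [p [pi gp vp]]] := IH m' m'i bv.
  by split => //; exists p; split => //; exact: leqW.
rewrite dpS; case: ifP => [gi|_]; last exact: wk.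
case/absorb_mem => // -[m' m'T [->|[_ ->]]]; first exact: wk.
rewrite bit_add_tuple => /andP[vn /orP[bv|vi]]; first exact: wk m' m'T bv.
by split => //; exists i.
Qed.

Lemma fval_le i m : m \in dp i -> fval d I am m <= size_of I.
Proof.
move=> mi; have [P pP rP] := dp_sound d_gt2 n_gt0 mi.
have [Q [pQ sQ]] := packing_value_attained d_gt2 (@cell_adj R I) pP rP.
rewrite fvalE -sQ; apply: leq_trans (leq_pmull (size Q) d_gt0) _.
rewrite -(packing_size pQ) -[leqRHS](size_iota 0); apply: uniq_leq_size.
  by case/andP: pQ.
by move=> v /(packing_lt pQ)[vn _]; rewrite mem_iota.
Qed.

(** Bits outside the covered vertices are zero, so the key of a state is determined by its value, at
    most [n], and its bits at vertices both covered and pending. *)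
Lemma dp_size i : i <= npos d I -> size (dp i) <= (size_of I).+1 * 2 ^ width d I am g.
Proof.
elim: i => [_|i IH il]; first by rewrite /= muln_gt0 expn_gt0.
have [gi|ngi] := boolP (good d I am g i); last by rewrite dpS (negbTE ngi); exact: IH (ltnW il).
pose A := filter (fun v => covered d I am g i v && pending d I am g i v) (iota 0 (size_of I)).
pose k2 m := (fval d I am m, map (bit m) A).
have uk : uniq (map (table_key i) (dp i.+1)) by rewrite dpS gi; exact: dp_step_uniq.
have cv m v : m \in dp i.+1 -> bit m v -> covered d I am g i v.
  move=> mi /(dp_covered mi)[_ [p [pi gp vp]]]; apply/hasP; exists p.
    by rewrite mem_iota; apply: leq_ltn_trans il; rewrite -ltnS.
  by rewrite -ltnS pi gp onE.
have k2k : {in dp i.+1 &, forall m m', k2 m = k2 m' -> table_key i m = table_key i m'}.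
  move=> m m' mi mi' [ef ea]; rewrite /table_key ef; congr (_, _).
  apply/eq_in_map => v; rewrite mem_filter => /andP[fv_ vn].
  have [cvv|ncv] := boolP (covered d I am g i v).
    by move/eq_in_map: ea; apply; rewrite mem_filter cvv fv_.
  have -> : bit m v = false by apply: contraNF ncv; exact: cv.
  by apply/esym; apply: contraNF ncv; exact: cv.
have u2 : uniq (map k2 (dp i.+1)).
  exact: uniq_map_refine uk k2k.
have sA : size A <= width d I am g.
  rewrite size_filter /width (big_rem i) ?mem_iota //=; exact: leq_maxl.
have sub : {subset map k2 (dp i.+1) <=
    [seq (x, w) | x <- iota 0 (size_of I).+1, w <- words [:: true; false] (size A)]}.
  move=> y /mapP[m mi ->]; apply: allpairs_f; first by rewrite mem_iota ltnS (fval_le mi).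
  rewrite -(size_map (bit m)); apply: mem_words; apply/allP => b _.
  by rewrite !inE; case: b.
rewrite -(size_map k2); apply: leq_trans (uniq_leq_size u2 sub) _.
by rewrite size_allpairs size_iota size_words leq_mul2l leq_pexp2l ?orbT.
Qed.

End TableSize.

Definition table_bound n k := n.+1 * 2 ^ (width_rate * (PeanoNat.Nat.sqrt k).+1).

Lemma table_bound_gt0 n k : 0 < table_bound n k.
Proof. by rewrite muln_gt0 expn_gt0. Qed.

Lemma table_bound_size n k : n <= table_bound n k.
Proof. by rewrite /table_bound (leq_trans (leqnSn n)) // leq_pmulr // expn_gt0. Qed.

Definition table_growth := Growth table_bound_gt0 table_bound_size.

Lemma dp_tractable : tractable R d table_growth.
Proof.
move=> I am k i kp lt il; case: (posnP (size_of I)) => [n0|n0].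
  have nm j : ~~ (j < npos d I) by rewrite /npos n0 exp0n // muln0.
  have -> : i = 0 by case: i il => // j /(elimN idP (nm j)).
  by rewrite /= table_bound_gt0.
apply: leq_trans (dp_size am (best d I am) n0 il) _.
rewrite /= /table_bound leq_mul2l /= leq_pexp2l // (leq_trans (best_width n0 lt)) //.
rewrite leq_mul2l ltnS; apply/orP; right; apply/ssrnat.leP.
by apply: PeanoNat.Nat.sqrt_le_mono; apply/ssrnat.leP.
Qed.

End Tractable.

(** * The program *)

Section Assembly.

Variables (R : realType) (d : nat).
Hypothesis d_gt2 : 2 < d.
Implicit Types I : instance R.

Local Notation G := (table_growth d).

Let d_gt0 : 0 < d. Proof. by lia. Qed.

(** Instances with [k > n] have no packing and are rejected beforehand; for the others, loops of
    length [k] are bounded through [n]. *)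
Definition base : ctx R (instance R) :=
  Ctx (fun I => param_of I <= size_of I) id (fun=> [::]) 0.

Definition output_ctx := ext base (fun I t => t < d * param_of I).

Lemma Comp_decision : ComputableB G base (fun I => decide d I (mask (size_of I) xpredT) (param_of I)).
Proof.
apply: (@Comp_decide R d G (dp_tractable d_gt2) _ base (fun I => mask (size_of I) xpredT) (@param_of R)) => //.
- apply: (@Comp_mask _ _ _ base (@size_of R) (fun _ => xpredT)).
  + exact: (Bdd_size G base).
  + exact: (Comp_size G base).
  + exact: Comp_true.
- exact: (Comp_param G base).
Qed.

Lemma Comp_entry : Computable G output_ctx (fun x => nth 0 (solution d x.1) x.2).
Proof.
have bk : Bounded G base (@param_of R) by apply: (Bdd_le (Bdd_size G base)).
apply: (@Comp_output R d G (dp_tractable d_gt2) _ output_ctx (fun x => x.2)).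
- by move=> [I t] /= [].
- apply: (@Bdd_lt _ _ _ base (fun I => d * param_of I)).
  by apply: Bdd_mul => //; exact: Bdd_const.
- exact: Comp_var.
- by move=> [I t] /= [].
Qed.

(** The product [d * k] is unrolled into [d] additions, as words have no multiplication. *)
Definition times_param : wexp := iter d (WAdd (WGet 3 (WConst 0))) (WConst 0).

Lemma times_paramE (s : state R) : weval s times_param = d * wmem s 3 0.
Proof. by rewrite /times_param; elim: (d) => //= m ->; rewrite mulSn. Qed.

(** Each output cell comes from a fresh run of the program for one entry, which costs only a factor
    [d * k]. The counter in array 4 is the variable of that program, its result appears in array 5,
    and it leaves array 1 untouched. *)
Lemma write_solution : exists (p : com) (C : instance R -> nat), Bounded G base C /\
  forall I s, dom base I -> encodes base I s -> exists q s', [/\ exec p s q s', q <= C I &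
    forall t, t < d * param_of I -> wmem s' 1 t = nth 0 (solution d I) t].
Proof.
have [e [M [C [/= lM [K [D bC]] He]]]] := Comp_entry.
pose body := Seq e (Seq (WSet 1 (WGet 4 (WConst 0)) (WGet 5 (WConst 0)))
  (WSet 4 (WConst 0) (WAdd (WGet 4 (WConst 0)) (WConst 1)))).
pose b := WLe (WAdd (WGet 4 (WConst 0)) (WConst 1)) times_param.
pose S I := K * bound G base I ^ D.
exists (Seq (WSet 4 (WConst 0) (WConst 0)) (While b body)).
exists (fun I => 3 + (bcost b + d * param_of I * (bcost b + S I + 11))).
have bk : Bounded G base (@param_of R) by apply: (Bdd_le (Bdd_size G base)).
split.
  have bS : Bounded G base S by exists K, D.
  by do ?[apply: Bdd_add => // | apply: Bdd_mul => // | exact: Bdd_const].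
move=> I s PI rs.
have loop m : forall t (s1 : state R), t + m = d * param_of I -> encodes base I s1 ->
    wmem s1 4 0 = t -> (forall j, j < t -> wmem s1 1 j = nth 0 (solution d I) j) ->
    exists q s2, [/\ exec (While b body) s1 q s2, q <= bcost b + m * (bcost b + S I + 11) &
      forall j, j < d * param_of I -> wmem s2 1 j = nth 0 (solution d I) j].
  elim: m => [|m IH] t s1.
    rewrite addn0 => -> r1 e4 h; exists (bcost b), s1; split => //; last by rewrite mul0n addn0.
    apply: exec_while_false; rewrite /= times_paramE e4 (encodes_k r1) -ltnNge addn1.
    exact: ltnSn.
  move=> tm r1 e4 h.
  have tl : t < d * param_of I by rewrite -tm addnS ltnS leq_addr.
  have [q1 [s2 [ex1 lq1 o1]]] := He (I, t) s1 (conj PI tl) (encodes_ext _ r1 e4).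
  have fr a i : a < 5 -> wmem s2 a i = wmem s1 a i.
    by move=> a5; rewrite (out_frame o1) //=; apply/negP => /andP[_ /andP[]]; lia.
  pose s3 : state R := State (upd (wmem s2) 1 (wmem s2 4 0) (wmem s2 5 0)) (rmem s2).
  pose s4 : state R := State (upd (wmem s3) 4 0 (wmem s3 4 0 + 1)) (rmem s3).
  have v4 : wmem s4 4 0 = t.+1 by rewrite /= /upd /= fr // e4 addn1.
  have v1 j : wmem s4 1 j = if j == t then nth 0 (solution d I) t else wmem s1 1 j.
    by rewrite /= /upd /= (fr 4 0 isT) e4 (fr 1 j isT); case: eqP => // _; exact: out_val o1.
  have r4 : encodes base I s4.
    split => //=; first by rewrite (out_rmem o1) (encodes_rmem r1).
    - by rewrite /upd /= fr // (encodes_n r1).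
    - by rewrite /upd /= fr // (encodes_k r1).
  have [|j|q2 [s5 [ex2 lq2 h5]]] := IH t.+1 s4 _ r4 v4.
  - by rewrite addSnnS.
  - by rewrite ltnS leq_eqVlt v1 => /orP[/eqP ->|jt]; rewrite ?eqxx // (ltn_eqF jt) h.
  exists (bcost b + (q1 + (5 + 6)) + q2), s5; split => //.
  - apply: exec_while_true ex2.
      by rewrite /= times_paramE e4 (encodes_k r1) addn1.
    apply: exec_seq ex1 _; apply: exec_seq; last exact: exec_wset.
    exact: exec_wset.
  - have h1 : q1 <= S I := leq_trans lq1 (bC (I, t) (conj PI tl)).
    by rewrite mulSn; lia.
pose s0 := wset s 4 0.
have r0 : encodes base I s0 by apply: encodes_wset.
have [q [s' [ex lq h]]] := loop (d * param_of I) 0 s0 erefl r0 erefl (fun j => fun h => ltac:(by [])).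
exists (3 + q), s'; split; [|by rewrite leq_add2l|exact: h].
by apply: exec_seq ex; exact: exec_wset.
Qed.


Lemma decision_program : exists (p : com) (K D : nat), forall I (s : state R),
  wmem s 0 0 = size_of I -> wmem s 1 0 = param_of I -> rmem s = coord_of I ->
  let ok := (param_of I <= size_of I) && decide d I (mask (size_of I) xpredT) (param_of I) in
  exists q s', [/\ exec p s q s',
    q <= K * table_bound d (size_of I) (param_of I) ^ D, wmem s' 0 0 = ok &
    ok -> forall t, t < d * param_of I -> wmem s' 1 t = nth 0 (solution d I) t].
Proof.
have [e1 [M [C1 [/= lM bC1 He1]]]] := Comp_decision.
have [e2 [C2 [bC2 He2]]] := write_solution.
have [K [D bC]] : Bounded G base (fun I => 30 + (C1 I + C2 I)).
  by do ?[apply: Bdd_add => // | exact: Bdd_const].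
pose no := WSet 0 (WConst 0) (WConst 0).
pose yes := Seq e2 (WSet 0 (WConst 0) (WConst 1)).
pose inner := Seq e1 (If (WLe (WConst 1) (WGet 4 (WConst 0))) yes no).
(* The input words are moved to arrays 2 and 3, as arrays 0 and 1 receive the output. *)
exists (Seq (WSet 2 (WConst 0) (WGet 0 (WConst 0))) (Seq (WSet 3 (WConst 0) (WGet 1 (WConst 0)))
  (If (WLe (WGet 3 (WConst 0)) (WGet 2 (WConst 0))) inner no))).
exists (K + 30), D => I s sn sk sr /=.
pose s1 := wset s 2 (wmem s 0 0); pose s2 := wset s1 3 (wmem s1 1 0).
have B1 : 0 < table_bound d (size_of I) (param_of I) ^ D.
  by rewrite expn_gt0 table_bound_gt0.
have bE : beval s2 (WLe (WGet 3 (WConst 0)) (WGet 2 (WConst 0))) = (param_of I <= size_of I).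
  by rewrite /= /upd /= sk sn.
have start q s' : exec (if param_of I <= size_of I then inner else no) s2 q s' ->
    exec (Seq (WSet 2 (WConst 0) (WGet 0 (WConst 0))) (Seq (WSet 3 (WConst 0) (WGet 1 (WConst 0)))
      (If (WLe (WGet 3 (WConst 0)) (WGet 2 (WConst 0))) inner no))) s (4 + (4 + (5 + q))) s'.
  move=> ex; apply: exec_seq; first exact: exec_move.
  apply: exec_seq; first exact: exec_move.
  by apply: exec_if; rewrite bE.
have [kn|nk] := boolP (param_of I <= size_of I); last first.
  exists (4 + (4 + (5 + 3))), (wset s2 0 0); split => //; last first.
    by rewrite mulnDl; apply: leq_trans (leq_addl _ _); rewrite -[X in X <= _]muln1 leq_mul.
  by apply: start; rewrite (negbTE nk); exact: exec_wset.
rewrite kn in start.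
have r2 : encodes base I s2 by split => //=; rewrite /upd /=.
have [q1 [s3 [ex1 lq1 o1]]] := He1 I s2 kn r2.
have r3 : encodes base I s3 by exact: encodes_frame r2 o1.
have v3 : wmem s3 4 0 = decide d I (mask (size_of I) xpredT) (param_of I) by exact: out_val o1.
have lb : 30 + (C1 I + C2 I) <= (K + 30) * table_bound d (size_of I) (param_of I) ^ D.
  apply: leq_trans (bC I kn) _; rewrite mulnDl; exact: leq_addr.
rewrite /=; case dec: (decide d I (mask (size_of I) xpredT) (param_of I)) v3 => v3.
  have [q2 [s4 [ex2 lq2 h4]]] := He2 I s3 kn r3.
  exists (4 + (4 + (5 + (q1 + (4 + (q2 + 3)))))), (wset s4 0 1); split => //.
  - apply: start.
    apply: exec_seq ex1 _; apply: exec_if; rewrite /= v3 /=.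
    by apply: exec_seq ex2 _; exact: exec_wset.
  - by apply: leq_trans lb; lia.
exists (4 + (4 + (5 + (q1 + (4 + 3))))), (wset s3 0 0); split => //.
- apply: start.
  by apply: exec_seq ex1 _; apply: exec_if; rewrite /= v3 /=; exact: exec_wset.
- by apply: leq_trans lb; lia.
Qed.

End Assembly.

(** * From instances back to the unit disk graph *)

Section Output.

Variables (R : realType) (d n k : nat) (V : 'I_n -> R * R).
Hypothesis d_gt2 : 2 < d.

Definition instance_of : instance R := Instance n k (rmem (input k V)).
Local Notation I := instance_of.

Lemma coord_of_ord a (i : 'I_n) : coord_of I a i =
  match a with 0 => (V i).1 | 1 => (V i).2 | _ => 0%R end.
Proof. by rewrite /= valK; case: a => [|[|a]]. Qed.

Lemma unit_diskE (i j : 'I_n) : unit_disk_graph V i j = adj I i j.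
Proof.
rewrite /unit_disk_graph /adj /close !coord_of_ord; congr (_ && _).
rewrite /euclid_dist -!expr2 -{1}(sqrtr1 R) ler_psqrt // nnegrE; last exact: ler01.
by rewrite addr_ge0 // sqr_ge0.
Qed.

Lemma dcycle_val (c : seq 'I_n) :
  is_dcycle (unit_disk_graph V) d c = d_cycle n d (adj I) xpredT (map val c).
Proof.
rewrite /is_dcycle /d_cycle size_map (map_inj_uniq val_inj); congr (_ && _).
have -> : all (fun v => (v < n) && true) (map val c).
  by apply/allP => _ /mapP[i _ ->]; rewrite ltn_ord.
congr (_ && _); rewrite cycle_map; apply: eq_cycle => i j; exact: unit_diskE.
Qed.

Lemma uniq_flatten_pairwise (T : finType) (P : seq (seq T)) :
  uniq (flatten P) = all uniq P && pairwise (fun c c' : seq T => [disjoint c & c']) P.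
Proof.
elim: P => //= c P IH; rewrite cat_uniq IH.
have -> : has [in c] (flatten P) = ~~ all (fun c' : seq T => [disjoint c & c']) P.
  elim: P {IH} => //= c' P IHP; rewrite has_cat IHP negb_and; congr (_ || _).
  by rewrite disjoint_sym disjoint_has negbK.
rewrite negbK; case: (uniq c); case: (all uniq P); rewrite ?andbF //.
Qed.

Lemma dcycle_packingE (P : seq (seq 'I_n)) :
  is_dcycle_packing (unit_disk_graph V) d k P =
  (size P == k) && d_packing n d (adj I) xpredT (map (map val) P).
Proof.
rewrite /is_dcycle_packing /d_packing -map_flatten (map_inj_uniq val_inj) uniq_flatten_pairwise.
congr (_ && _); rewrite all_map.
have -> : all (is_dcycle (unit_disk_graph V) d) P =
    all (preim (map val) (d_cycle n d (adj I) xpredT)) P.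
  by apply: eq_all => c; exact: dcycle_val.
case aP: (all _ P) => //=; suff -> : all uniq P by [].
apply/allP => c cP; by have /and4P[_ _] := allP aP c cP; rewrite (map_inj_uniq val_inj).
Qed.

Lemma packing_lift P : d_packing n d (adj I) xpredT P ->
  exists P' : seq (seq 'I_n), P = map (map val) P'.
Proof.
move=> /andP[aP _]; exists (map (pmap insub) P); rewrite -map_comp -[LHS]map_id.
apply/eq_in_map => c cP /=; rewrite pmap_filter; last exact: insubK.
apply/esym/all_filterP/allP => v vc; rewrite isSome_insub.
by have /and4P[_ /allP/(_ v vc)/andP[]] := allP aP c cP.
Qed.

Lemma packing_param : (exists P, is_dcycle_packing (unit_disk_graph V) d k P) ->
  d * k <= n.
Proof.
case=> P; rewrite dcycle_packingE => /andP[/eqP <- pP].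
rewrite -(size_map (map val)) -(packing_size pP) -[leqRHS](size_iota 0).
apply: uniq_leq_size; first by case/andP: pP.
by move=> v /(packing_lt pP)[vn _]; rewrite mem_iota.
Qed.

Lemma decision_correct :
  (k <= n) && decide d I (mask n xpredT) k <->
  exists P, is_dcycle_packing (unit_disk_graph V) d k P.
Proof.
have d0 : 0 < d by exact: ltn_trans d_gt2.
(* Without vertices only [k = 0] admits a packing, and [decideP] does not apply. *)
case: (posnP n) => [n0|n0].
  rewrite {1}n0 leqn0; split => [/andP[/eqP k0 _]|].
    by exists [::]; rewrite dcycle_packingE k0.
  move/packing_param; rewrite n0 leqn0 muln_eq0 (gtn_eqF d0) /= => /eqP ->.
  by rewrite eqxx /decide muln0.
have decP := @decideP R d d_gt2 I (mask n xpredT) k n0.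
split.
  case/andP => _ /decP[P pP sP].
  have pP' : d_packing n d (adj I) xpredT P by apply: sub_packing pP.
  have [P' eP] := packing_lift pP'; exists P'.
  by rewrite dcycle_packingE -eP pP' -sP eP size_map eqxx.
move=> ex; have dk := packing_param ex; rewrite (leq_trans (leq_pmull k d0) dk) /=.
case: ex => P; rewrite dcycle_packingE => /andP[/eqP sP pP].
apply/decP; exists (map (map val) P); last by rewrite size_map.
by apply: (@sub_packing R d I xpredT) pP => v vn _; rewrite bit_mask vn.
Qed.

Lemma solution_output (s : state R) : (k <= n) && decide d I (mask n xpredT) k ->
  (forall t, t < d * k -> wmem s 1 t = nth 0 (solution d I) t) ->
  exists P : seq (seq 'I_n), is_dcycle_packing (unit_disk_graph V) d k P /\
    output_cycles d k s = map (map val) P.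
Proof.
move=> ok out; have /andP[kn dec] := ok.
(* For [k = 0] no entry of the solution is read; this alternative covers the empty graph, to which
   [solution_spec] does not apply. *)
have [P pP [sP fP]] : exists2 P, d_packing n d (adj I) xpredT P &
    size P = k /\ (k == 0) || (flatten P == solution d I).
  case: (posnP n) kn => [n0|n0 _]; last first.
    by have [P pP [sP fP]] := @solution_spec R d d_gt2 I n0 dec; exists P; rewrite // fP eqxx orbT.
  by rewrite n0 leqn0 => /eqP ->; exists [::].
have [P' eP] := packing_lift pP; exists P'; rewrite -eP; split.
  by rewrite dcycle_packingE -eP pP -sP eP size_map eqxx.
rewrite /output_cycles -sP; apply: (@eq_from_nth _ [::]); first by rewrite size_mkseq.
rewrite size_mkseq => j jP; rewrite nth_mkseq //.
have all_d : all (fun c => size c == d) P.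
  by case/andP: pP => aP _; apply: sub_all aP => c /and4P[].
have szj : size (nth [::] P j) = d by apply/eqP/(allP all_d); exact: mem_nth.
apply: (@eq_from_nth _ 0); first by rewrite size_mkseq szj.
rewrite size_mkseq => i id; rewrite nth_mkseq // out; last first.
  apply: (@leq_trans (j.+1 * d)); first by rewrite mulSn addnC ltn_add2r.
  by rewrite mulnC leq_mul2l -sP jP orbT.
have /eqP <- : flatten P == solution d I.
  by move: fP; rewrite -sP; case: (P) jP.
elim: P j {pP eP sP fP} jP szj all_d => // c P IH [|j] /= jP szj /andP[/eqP sc all_d].
  by rewrite mul0n add0n nth_cat sc id.
by rewrite mulSn -addnA nth_cat sc ltnNge leq_addr /= addKn; exact: IH.
Qed.

End Output.

(** By $n + 1 \le 2\max(n,1)$ the bound splits into a constant, a power of $2^{\lfloor\sqrt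
    k\rfloor}$ and a power of $\max(n,1)$. The constants of these three factors are added to form
    [c], which thus dominates each of them. *)
Lemma table_bound_time (R : realType) d K D : exists c, forall n k,
  ((K * table_bound d n k ^ D)%:R <= time_bound R c n k)%R.
Proof.
pose w := width_rate d; exists (K * 2 ^ (D + w * D) + w * D + D) => n k.
set c := _ + D; set s := PeanoNat.Nat.sqrt k.
have sk : s * s <= k by have [+ _] := PeanoNat.Nat.sqrt_spec k (PeanoNat.Nat.le_0_l k); rewrite /s; lia.
have le1 : K * table_bound d n k ^ D <=
    K * 2 ^ (D + w * D) * 2 ^ (w * D * s) * maxn n 1 ^ D.
  have h1 : n.+1 ^ D <= 2 ^ D * maxn n 1 ^ D.
    by rewrite -expnMn; case: (D) => // D'; rewrite leq_exp2r //; lia.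
  have e1 : w * s.+1 * D = w * D + w * D * s by rewrite mulnS mulnDl [w * s * D]mulnAC.
  rewrite /table_bound -/s -/w expnMn -expnM e1 !expnD.
  apply: (@leq_trans (K * (2 ^ D * maxn n 1 ^ D * (2 ^ (w * D) * 2 ^ (w * D * s))))).
    by rewrite leq_mul2l leq_mul2r h1 !orbT.
  move: (2 ^ D) (2 ^ (w * D)) (2 ^ (w * D * s)) (maxn n 1 ^ D) => a b e f.
  by rewrite [a * f * _]mulnAC -[a * _ * f]mulnA !mulnA.
have root_le : (s%:R <= Num.sqrt k%:R :> R)%R.
  rewrite -[leLHS]ger0_norm ?ler0n // -sqrtr_sqr; apply: ler_wsqrtr.
  by rewrite -natrX ler_nat -mulnn.
apply: (@le_trans _ _ (K * 2 ^ (D + w * D) * 2 ^ (w * D * s) * maxn n 1 ^ D)%:R%R).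
  by rewrite ler_nat.
rewrite /time_bound !natrM; apply: ler_pM.
- by rewrite !mulr_ge0 ?ler0n.
- exact: ler0n.
- rewrite -natrM; apply: ler_pM; rewrite ?ler0n //.
    by rewrite ler_nat /c -addnA leq_addr.
  rewrite natrX -powR_mulrn ?ler0n //; apply: ler_powR; first by rewrite ler1n.
  rewrite natrM; apply: ler_pM; rewrite ?ler0n //.
  by rewrite ler_nat /c addnAC leq_addl.
- by rewrite -natrX ler_nat leq_pexp2l ?leq_max ?orbT // /c leq_addl.
Qed.

Local Open Scope ring_scope.

Theorem theorem37 (R : realType) (d : nat) (hd : (2 < d)%N) :
  exists (p : com) (c : nat),
    forall (n : nat) (V : 'I_n -> R * R) (k : nat), injective V ->
      exists (t : nat) (s : state R),
        exec p (input k V) t s /\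
        (t%:R <= time_bound R c n k) /\
        correct_output (unit_disk_graph V) d k s.
Proof.
have [p [K [D hp]]] := decision_program R hd.
have [c hc] := table_bound_time R d K D.
exists p, c => n V k _.
have [t [s [ex lt s0 s1]]] := hp (instance_of k V) (input k V) erefl erefl erefl.
exists t, s; split => //; split; first by apply: le_trans (hc n k); rewrite ler_nat.
rewrite /correct_output /output_answer s0.
have dc := decision_correct k V hd.
case ok: (_ && _) s1 => s1; [left | right]; split => //.
  exact: (solution_output hd ok (s1 isT)).
by move/dc; rewrite ok.
Qed.
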